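(* Let $(r,\alpha)\in(0,\infty)\times(0,1)$ and let $Z$ be a random variable with a probability density function $\rho_Z$ on $\mathbb{R}^+=[0,\infty)$ such that, for some $c>1$, the function $x\mapsto x^{z-1}\rho_Z(x)$, $x\ge0$, is integrable for every $z\in\mathbb{C}$ in the strip $1-r<\Re(z)<c$. Suppose that $$Z\overset{\mathcal{L}}{=}Z^{\alpha}\,Y_{\alpha,r},$$ where $Y_{\alpha,r}$ is a positive random variable, independent of $Z$, with density $$\rho_{Y_{\alpha,r}}(t)=H_{1,1}^{1,0}\left(t\,\middle|\,\genfrac{}{}{0pt}{}{(r-\alpha,\alpha)}{(r-1,1)}\right),\quad t>0.$$ Then $Z\overset{\mathcal{L}}{=}Z_r$, where $Z_r$ is a gamma random variable with density $\frac{1}{\Gamma(r)}t^{r-1}e^{-t}$, $t>0$.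
   Context: $\overset{\mathcal{L}}{=}$ denotes equality in law. For $t>0$, $r>0$ and $0<\alpha<1$, the Fox $H$-function is $$H_{1,1}^{1,0}\left(t\,\middle|\,\genfrac{}{}{0pt}{}{(r-\alpha,\alpha)}{(r-1,1)}\right):=\frac{1}{2\pi i}\int_{\mathscr{L}}\frac{\Gamma(r-1+s)}{\Gamma(r-\alpha+\alpha s)}\,t^{-s}\,\mathrm{d}s,$$ where $t^{-s}=e^{-s\log t}$ and $\mathscr{L}$ is a loop contained in a horizontal strip, with both ends at $-\infty$ (one along $\Im s=-1$, the other along $\Im s=1$), encircling counterclockwise all the poles $s=1-r-l$, $l=0,1,2,\dots$, of $s\mapsto\Gamma(r-1+s)$. This function of $t$ is a probability density on $(0,\infty)$. *)

(* Defs.v *)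
From HB Require Import structures.
From mathcomp Require Import all_boot all_order all_algebra.
From mathcomp Require Import all_classical all_reals all_analysis.
From mathcomp Require Import complex.

Set Implicit Arguments.
Unset Strict Implicit.
Unset Printing Implicit Defensive.

Import Order.TTheory GRing.Theory Num.Theory.
Import numFieldNormedType.Exports.

Local Open Scope classical_set_scope.
Local Open Scope ring_scope.
Local Open Scope complex_scope.

Definition cexp (R : realType) (z : R[i]) : R[i] :=
  (expR (complex.Re z))%:C * (cos (complex.Im z) +i* sin (complex.Im z)).

(* The value at x <= 0 is meaningless: there ln x = 0. *)
Definition cpow (R : realType) (x : R) (z : R[i]) : R[i] :=
  cexp (z * (ln x)%:C).

Definition cintegrable (R : realType) (D : set R) (f : R -> R[i]) : Prop :=
  (@lebesgue_measure R).-integrable D (fun x => (complex.Re (f x))%:E) /\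
  (@lebesgue_measure R).-integrable D (fun x => (complex.Im (f x))%:E).

Definition cintegral (R : realType) (D : set R) (f : R -> R[i]) : R[i] :=
  (\int[@lebesgue_measure R]_(x in D) complex.Re (f x)) +i*
  (\int[@lebesgue_measure R]_(x in D) complex.Im (f x)).

Definition euler_integral (R : realType) (z : R[i]) : R[i] :=
  cintegral `]0, +oo[ (fun t => cpow t (z - 1) * (expR (- t))%:C).

(* [n] is the least natural number with 0 < Re z + n, as truncn vanishes on
   negative numbers: Gamma is Euler's integral on the right half-plane,
   continued by Gamma (z + 1) = z * Gamma z.  At the poles 0, -1, -2, ... the
   denominator vanishes, so that Gamma z = 0 there and 1 / Gamma is still the
   entire function with these zeros. *)
Definition Gamma (R : realType) (z : R[i]) : R[i] :=
  let n := Num.truncn (1 - complex.Re z) in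
  euler_integral (z + n%:R) / \prod_(k < n) (z + k%:R).

(* The loop -oo - i --> x0 - i --> x0 + i --> -oo + i with straight sides. *)
Definition loop_integral (R : realType) (x0 : R) (f : R[i] -> R[i]) : R[i] :=
  cintegral `]-oo, x0] (fun x => f (x +i* -1))
  + (0 +i* 1) * cintegral `[-1, 1] (fun y => f (x0 +i* y))
  - cintegral `]-oo, x0] (fun x => f (x +i* 1)).

(* The Fox function H^{1,0}_{1,1}(t | (a, A); (b, B)); the loop encircles all
   the poles of s |-> Gamma (b + B s) when - b / B < x0, and the value does not
   depend on such an x0. *)
Definition foxH1011 (R : realType) (x0 a A b B t : R) : R[i] :=
  (0 +i* (2 * pi))^-1 *
  loop_integral x0 (fun s =>
    Gamma (b%:C + B%:C * s) / Gamma (a%:C + A%:C * s) * cpow t (- s)).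

Definition gamma_density (R : realType) (r t : R) : R :=
  (complex.Re (Gamma r%:C))^-1 * t `^ (r - 1) * expR (- t).

Definition has_density (R : realType) (d : measure_display)
    (T : measurableType d) (P : probability T R) (X : T -> R)
    (D : set R) (rho : R -> R) : Prop :=
  [/\ measurable_fun D rho,
      forall x, D x -> 0 <= rho x &
      forall A : set R, measurable A ->
        P (X @^-1` A) = (\int[@lebesgue_measure R]_(x in A `&` D) (rho x)%:E)%E].

Definition eq_law (R : realType) (d d' : measure_display)
    (T : measurableType d) (T' : measurableType d')
    (P : probability T R) (P' : probability T' R)
    (X : T -> R) (X' : T' -> R) : Prop :=
  forall A : set R, measurable A -> P (X @^-1` A) = P' (X' @^-1` A).

Definition independent_rv (R : realType) (d : measure_display)
    (T : measurableType d) (P : probability T R) (X Y : T -> R) : Prop :=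
  forall A B : set R, measurable A -> measurable B ->
    P ((X @^-1` A) `&` (Y @^-1` B)) = (P (X @^-1` A) * P (Y @^-1` B))%E.

(* Main.v *)
Require Import Defs.
From HB Require Import structures.
From mathcomp Require Import all_boot all_order all_algebra.
From mathcomp Require Import all_classical all_reals all_analysis.
From mathcomp Require Import complex measurable_realfun ring lra.

(* With V = e^(- eta z), eta = pi / (1 + alpha), the loop integrals
     Phi(g, u, c) = \oint e^(g V - u V^alpha - c z) dz
   converge because Re V < 0 < Re V^alpha on the horizontal sides of the loop.
   A translation of z by ln g / eta gives Phi(1, u, c) as a power of g times
   Phi(g, u g^alpha, c), and the residue of 1 / (1 - V) at 0 gives
     int_0^oo e^(- g) Phi(g, u, c) dg = e^(- u) N,  N <> 0.
   For u = 0 these two facts are Hankel's formula for 1 / Gamma.  Inserting it in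
   the Fox function and integrating Gamma(s) e^(- xi s) over the loop first,
   which yields a multiple of exp(- e^xi), shows that rho_Y(t) is a multiple of
   t^(r - 1) Phi(1, t, c); then the two facts, now with u = x, say that the gamma
   law solves Z = Z^alpha Y in law.  The solution is unique, since the operator
   phi |-> (x |-> E phi(x^alpha Y)) preserves E phi(Z) and multiplies the
   Lipschitz constant of phi, as a function of ln x, by alpha < 1. *)

Set Implicit Arguments.
Unset Strict Implicit.
Unset Printing Implicit Defensive.

Import Order.TTheory GRing.Theory Num.Theory.
Import numFieldNormedType.Exports.
Import Normc.

Local Open Scope classical_set_scope.
Local Open Scope ring_scope.
Local Open Scope complex_scope.

Local Notation Re := complex.Re.
Local Notation Im := complex.Im.
Local Notation mu := (@lebesgue_measure _).
Local Notation intble D f := (mu.-integrable D (EFin \o f)).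
Local Notation pos := (`]0, +oo[%classic).

(** * Complex numbers *)

Section complex_exponential.
Context {R : realType}.
Implicit Types (z w : R[i]) (x y : R).

(** In the coordinate z the loop of the Fox function and Hankel's contour have the same shape,
    V^alpha is an entire function instead of a branch, multiplication of V by g is a translation,
    and Cauchy's theorem is only needed on rectangles. Since dV = - eta V dz, for c = eta (1 - w)
    the form e^(- c z) dz is a multiple of V^(- w) dV: Phi(1, u, c) is a Wright function of - u, and
    the law of Y corresponds to w = r (1 - alpha). No constant is computed. That N is nonzero
    expresses Gamma as a quotient by a loop integral, and the last unknown factor is 1 because the
    laws have mass one. Two interchanges of integrals shape the estimates. For the two loops,
    Gamma(s) e^(- xi s) with xi = ln t - alpha eta z brings a factor exp(D |V|^alpha), which e^(Re
    V) absorbs because alpha < 1. For the Laplace integral the difficulty is at g = 0, where decay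
    in V is traded for an integrable singularity g^(- theta). *)

Lemma cReD z w : Re (z + w) = Re z + Re w. Proof. by case: z; case: w. Qed.
Lemma cImD z w : Im (z + w) = Im z + Im w. Proof. by case: z; case: w. Qed.
Lemma cReN z : Re (- z) = - Re z. Proof. by case: z. Qed.
Lemma cImN z : Im (- z) = - Im z. Proof. by case: z. Qed.
Lemma cReM z w : Re (z * w) = Re z * Re w - Im z * Im w.
Proof. by case: z; case: w. Qed.
Lemma cImM z w : Im (z * w) = Re z * Im w + Im z * Re w.
Proof. by case: z; case: w. Qed.
Lemma cReV z : Re z^-1 = Re z / (Re z ^+ 2 + Im z ^+ 2).
Proof. by case: z. Qed.
Lemma cImV z : Im z^-1 = - Im z / (Re z ^+ 2 + Im z ^+ 2).
Proof. by case: z => a b /=; rewrite mulNr. Qed.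
Lemma cRe1 : Re (1 : R[i]) = 1. Proof. by []. Qed.
Lemma cIm1 : Im (1 : R[i]) = 0. Proof. by []. Qed.
Lemma cReZ x z : Re (x%:C * z) = x * Re z.
Proof. by rewrite cReM /= mul0r subr0. Qed.
Lemma cImZ x z : Im (x%:C * z) = x * Im z.
Proof. by rewrite cImM /= mul0r addr0. Qed.
Lemma complexP z w : Re z = Re w -> Im z = Im w -> z = w.
Proof. by case: z; case: w => a b c d /= -> ->. Qed.

Lemma cexpD z w : cexp (z + w) = cexp z * cexp w.
Proof.
by apply: complexP; rewrite /cexp !(cReM, cImM, cReD, cImD) /= expRD ?cosD ?sinD; ring.
Qed.

Lemma cexp0 : cexp (0 : R[i]) = 1.
Proof. by apply: complexP; rewrite /cexp !(cReM, cImM) /= expR0 cos0 sin0; ring. Qed.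

Lemma Re_cexp z : Re (cexp z) = expR (Re z) * cos (Im z).
Proof. by rewrite /cexp cReM /=; ring. Qed.
Lemma Im_cexp z : Im (cexp z) = expR (Re z) * sin (Im z).
Proof. by rewrite /cexp cImM /=; ring. Qed.

Lemma cexp_real x : cexp x%:C = (expR x)%:C.
Proof. by apply: complexP; rewrite ?Re_cexp ?Im_cexp /= ?cos0 ?sin0; ring. Qed.

Lemma normc_cexp z : normc (cexp z) = expR (Re z).
Proof.
have := Re_cexp z; have := Im_cexp z.
case: (cexp z) => a b /= -> ->.
rewrite !exprMn -mulrDr cos2Dsin2 mulr1 sqrtr_sqr ger0_norm //; exact: expR_ge0.
Qed.

Lemma normc_real x : normc x%:C = `|x|.
Proof. by rewrite /= expr0n addr0 sqrtr_sqr. Qed.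

Lemma normc_ge0 z : 0 <= normc z.
Proof. by case: z => a b; exact: sqrtr_ge0. Qed.

Lemma Re_le_normc z : `|Re z| <= normc z.
Proof. by case: z => a b /=; rewrite -sqrtr_sqr ler_wsqrtr // lerDl sqr_ge0. Qed.

Lemma Im_le_normc z : `|Im z| <= normc z.
Proof. by case: z => a b /=; rewrite -sqrtr_sqr ler_wsqrtr // lerDr sqr_ge0. Qed.

Lemma normc_le_ReIm z : normc z <= `|Re z| + `|Im z|.
Proof.
case: z => a b /=; rewrite -[leRHS]ger0_norm ?addr_ge0 // -sqrtr_sqr.
rewrite ler_wsqrtr // sqrrD !real_normK ?num_real // -addrA lerD2l lerDr.
by rewrite mulrn_wge0 // mulr_ge0.
Qed.

Lemma normc_triangle z w : normc (z + w) <= normc z + normc w.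
Proof. exact: le_normcD. Qed.

Lemma normc_gt0 z : z != 0 -> 0 < normc z.
Proof.
move=> z0; rewrite lt_neqAle normc_ge0 andbT eq_sym.
by apply: contra z0 => /eqP/eq0_normc ->.
Qed.

Lemma normc_sub z w : `|normc z - normc w| <= normc (z - w).
Proof.
have h (a b : R[i]) : normc a - normc b <= normc (a - b).
  by rewrite lerBlDr -{1}[a](subrK b); exact: normc_triangle.
by rewrite ler_norml h andbT lerNl opprB -[normc (z - w)]normcN opprB h.
Qed.

End complex_exponential.

(** * Differentiation along paths *)

Section real_derivatives.
Context {R : realType}.
Implicit Types (f g : R -> R) (x a b : R).

Lemma is_deriveDf f g x a b : is_derive x (1 : R) f a -> is_derive x (1 : R) g b ->
  is_derive x (1 : R) (fun t => f t + g t) (a + b).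
Proof. by move=> fa gb; exact: is_deriveD. Qed.

Lemma is_deriveMf f g x a b : is_derive x (1 : R) f a -> is_derive x (1 : R) g b ->
  is_derive x (1 : R) (fun t => f t * g t) (f x * b + g x * a).
Proof. by move=> fa gb; exact: is_deriveM. Qed.

Lemma is_deriveNf f x a : is_derive x (1 : R) f a ->
  is_derive x (1 : R) (fun t => - f t) (- a).
Proof. by move=> fa; exact: is_deriveN. Qed.

Lemma is_deriveVf f x a : f x != 0 -> is_derive x (1 : R) f a ->
  is_derive x (1 : R) (fun t => (f t)^-1) (- a / f x ^+ 2).
Proof.
move=> fx0 fa; apply: is_derive_eq.
by rewrite /GRing.scale /= !mulNr mulrC.
Qed.

End real_derivatives.

(* [cderive] is differentiability of a path in the complex plane; [holo F F' z]
   is the chain rule along every path through [z], a form of complex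
   differentiability that needs no topology on [R[i]]. *)
Section complex_derivatives.
Context {R : realType}.
Implicit Types (f g : R -> R[i]) (F G : R[i] -> R[i]) (z w l m : R[i]) (t : R).

Definition cderive f t l :=
  is_derive t (1 : R) (fun x => Re (f x)) (Re l) /\
  is_derive t (1 : R) (fun x => Im (f x)) (Im l).

Definition holo F F' z := forall f t l, f t = z -> cderive f t l ->
  cderive (fun x => F (f x)) t (F' z * l).

Lemma cderive_eq f t l m : cderive f t l -> l = m -> cderive f t m.
Proof. by move=> ? <-. Qed.

Lemma cderive_cst z t : cderive (fun=> z) t 0.
Proof. by split; exact: is_derive_cst. Qed.

Lemma cderiveD f g t l m : cderive f t l -> cderive g t m ->
  cderive (fun x => f x + g x) t (l + m).
Proof.
move=> [f1 f2] [g1 g2]; split.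
  under eq_fun do rewrite cReD.
  by rewrite cReD; exact: is_deriveDf.
under eq_fun do rewrite cImD.
by rewrite cImD; exact: is_deriveDf.
Qed.

Lemma cderiveM f g t l m : cderive f t l -> cderive g t m ->
  cderive (fun x => f x * g x) t (f t * m + l * g t).
Proof.
move=> [f1 f2] [g1 g2]; split.
  under eq_fun do rewrite cReM.
  refine (is_derive_eq (is_deriveDf (is_deriveMf f1 g1)
    (is_deriveNf (is_deriveMf f2 g2))) _).
  by rewrite !(cReD, cReM); ring.
under eq_fun do rewrite cImM.
refine (is_derive_eq (is_deriveDf (is_deriveMf f1 g2) (is_deriveMf f2 g1)) _).
by rewrite !(cImD, cImM); ring.
Qed.

Lemma cderiveN f t l : cderive f t l -> cderive (fun x => - f x) t (- l).
Proof.
move=> [f1 f2]; split.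
  under eq_fun do rewrite cReN.
  by rewrite cReN; exact: is_deriveNf.
under eq_fun do rewrite cImN.
by rewrite cImN; exact: is_deriveNf.
Qed.

Lemma cderive_real (h : R -> R) t a : is_derive t (1 : R) h a ->
  cderive (fun x => (h x)%:C) t a%:C.
Proof. by move=> ha; split => //=; exact: is_derive_cst. Qed.

Lemma cderive_cexp f t l : cderive f t l ->
  cderive (fun x => cexp (f x)) t (cexp (f t) * l).
Proof.
move=> [f1 f2].
have de := is_derive1_comp (is_derive_expR (Re (f t))) f1.
have dc := is_derive1_comp (is_derive_cos (Im (f t))) f2.
have ds := is_derive1_comp (is_derive_sin (Im (f t))) f2.
split.
  under eq_fun do rewrite Re_cexp.
  refine (is_derive_eq (is_deriveMf de dc) _).
  by rewrite /= cReM Re_cexp Im_cexp; ring.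
under eq_fun do rewrite Im_cexp.
refine (is_derive_eq (is_deriveMf de ds) _).
by rewrite /= cImM Re_cexp Im_cexp; ring.
Qed.

Lemma sqr_ReIm_neq0 z : z != 0 -> Re z ^+ 2 + Im z ^+ 2 != 0.
Proof.
case: z => a b; rewrite eq_complex /= negb_and => ab0.
by rewrite paddr_eq0 ?sqr_ge0 // !sqrf_eq0 negb_and.
Qed.

Lemma cderiveV f t l : f t != 0 -> cderive f t l ->
  cderive (fun x => (f x)^-1) t (- l / f t ^+ 2).
Proof.
move=> /sqr_ReIm_neq0 n0 [f1 f2].
have dn := is_deriveDf (is_deriveMf f1 f1) (is_deriveMf f2 f2).
have n0' : Re (f t) * Re (f t) + Im (f t) * Im (f t) != 0 by rewrite -!expr2.
have fV : - l / f t ^+ 2 = - l * ((f t)^-1 * (f t)^-1) by rewrite expr2 invfM.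
have dV := @is_deriveVf R (fun t => Re (f t) * Re (f t) + Im (f t) * Im (f t)) _ _ n0' dn.
split.
  under eq_fun do rewrite cReV !expr2.
  refine (is_derive_eq (is_deriveMf f1 dV) _).
  rewrite fV !(cReM, cReN, cImM, cImN) !(cReV, cImV) !expr2.
  by move: n0'; move: (Re (f t)) (Im (f t)) (Re l) (Im l) => a b c d n0'; field.
under eq_fun do rewrite cImV !expr2.
refine (is_derive_eq (is_deriveMf (is_deriveNf f2) dV) _).
rewrite fV !(cReM, cReN, cImM, cImN) !(cReV, cImV) !expr2.
by move: n0'; move: (Re (f t)) (Im (f t)) (Re l) (Im l) => a b c d n0'; field.
Qed.

Lemma holo_cst w z : holo (fun=> w) (fun=> 0) z.
Proof. by move=> f t l _ _; rewrite mul0r; exact: cderive_cst. Qed.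

Lemma holo_id z : holo id (fun=> 1) z.
Proof. by move=> f t l _; rewrite mul1r. Qed.

Lemma holoD F G F' G' z : holo F F' z -> holo G G' z ->
  holo (fun x => F x + G x) (fun x => F' x + G' x) z.
Proof.
by move=> hF hG f t l ft fl; rewrite mulrDl; apply: cderiveD; [exact: hF|exact: hG].
Qed.

Lemma holoN F F' z : holo F F' z -> holo (fun x => - F x) (fun x => - F' x) z.
Proof. by move=> hF f t l ft fl; rewrite mulNr; apply: cderiveN; exact: hF. Qed.

Lemma holoM F G F' G' z : holo F F' z -> holo G G' z ->
  holo (fun x => F x * G x) (fun x => F x * G' x + F' x * G x) z.
Proof.
move=> hF hG f t l ft fl; apply: cderive_eq.
  by apply: cderiveM; [exact: hF ft fl|exact: hG ft fl].
by rewrite /= ft; ring.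
Qed.

Lemma holo_cexp F F' z : holo F F' z ->
  holo (fun x => cexp (F x)) (fun x => cexp (F x) * F' x) z.
Proof.
move=> hF f t l ft fl; apply: cderive_eq.
  by apply: cderive_cexp; exact: hF ft fl.
by rewrite /= ft mulrA.
Qed.

Lemma holoV F F' z : F z != 0 -> holo F F' z ->
  holo (fun x => (F x)^-1) (fun x => - F' x / F x ^+ 2) z.
Proof.
move=> Fz hF f t l ft fl; apply: cderive_eq.
  by apply: cderiveV; [rewrite ft|exact: hF ft fl].
by rewrite /= ft; ring.
Qed.

Lemma cderive_line z w t : cderive (fun x : R => z + x%:C * w) t w.
Proof.
apply: cderive_eq.
  apply: cderiveD (cderive_cst _ _) (cderiveM _ (cderive_cst _ _)).
  by apply: cderive_real; exact: is_derive_id.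
by rewrite mulr0 !add0r mul1r.
Qed.

Lemma cderive_cont f t l : cderive f t l ->
  {for t, continuous (fun x => Re (f x))} /\ {for t, continuous (fun x => Im (f x))}.
Proof.
move=> [f1 f2]; split; apply: differentiable_continuous;
  by apply/derivable1_diffP; apply: ex_derive.
Qed.

End complex_derivatives.

Arguments holo_cst {R} w z _ _ _ _ _.
Arguments holo_id {R} z _ _ _ _ _.
Arguments holoD {R F G F' G' z} _ _ _ _ _ _ _.
Arguments holoN {R F F' z} _ _ _ _ _ _.
Arguments holoM {R F G F' G' z} _ _ _ _ _ _ _.
Arguments holo_cexp {R F F' z} _ _ _ _ _ _.
Arguments holoV {R F F' z} _ _ _ _ _ _ _.

(** * Integrals over the line *)

Section real_integrals.
Context {R : realType}.
Implicit Types (f g F : R -> R) (D : set R) (a b c x : R).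

Lemma le_intble D f g : measurable D -> measurable_fun D f ->
  (forall x, D x -> `|f x| <= g x) -> intble D g -> intble D f.
Proof.
move=> mD mf fg ig; apply: (@le_integrable _ _ _ mu D mD _ (EFin \o g) _ _ ig); first exact/measurable_EFinP.
by move=> x Dx /=; rewrite lee_fin (le_trans (fg x Dx)) // ler_norm.
Qed.

Lemma intbleMl D f c : measurable D -> intble D f -> intble D (fun x => c * f x).
Proof. by move=> mD fi; exact: (@integrableZl _ _ _ mu D mD c (EFin \o f)). Qed.

Lemma intble_norm D f : intble D f -> intble D (fun x => `|f x|).
Proof. exact: (@integrable_norm _ (measurableTypeR R) R mu D f). Qed.

Lemma intbleD D f g : measurable D -> intble D f -> intble D g ->
  intble D (fun x => f x + g x).
Proof.
by move=> mD; exact: (@integrableD _ (measurableTypeR R) R mu D mD (EFin \o f) (EFin \o g)).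
Qed.

Lemma intbleN D f : measurable D -> intble D f -> intble D (fun x => - f x).
Proof.
move=> mD fi; under [X in EFin \o X]eq_fun do rewrite -mulN1r.
exact: intbleMl.
Qed.

Lemma eq_intble D f g : measurable D -> (forall x, D x -> f x = g x) ->
  intble D f -> intble D g.
Proof.
move=> mD fg; apply: (@eq_integrable _ (measurableTypeR R) R mu D mD).
by move=> x /set_mem Dx /=; rewrite fg.
Qed.

Lemma le_normr_int D f : measurable D -> intble D f ->
  `|\int[mu]_(x in D) f x| <= \int[mu]_(x in D) `|f x|.
Proof. exact: (@le_normr_Rintegral _ (measurableTypeR R) R mu D f). Qed.

Lemma le_int D f g : measurable D -> intble D f -> intble D g ->
  (forall x, D x -> f x <= g x) -> \int[mu]_(x in D) f x <= \int[mu]_(x in D) g x.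
Proof. exact: (@le_Rintegral _ (measurableTypeR R) R mu D f g). Qed.

Lemma intMl D f c : measurable D -> intble D f ->
  \int[mu]_(x in D) (c * f x) = c * \int[mu]_(x in D) f x.
Proof. exact: (@RintegralZl _ (measurableTypeR R) R mu D f c). Qed.

Lemma intD D f g : measurable D -> intble D f -> intble D g ->
  \int[mu]_(x in D) (f x + g x) = \int[mu]_(x in D) f x + \int[mu]_(x in D) g x.
Proof. exact: (@RintegralD _ (measurableTypeR R) R mu D f g). Qed.

Lemma intN D f : measurable D -> intble D f ->
  \int[mu]_(x in D) (- f x) = - \int[mu]_(x in D) f x.
Proof.
move=> mD fi; rewrite -mulN1r -intMl //.
by apply: eq_Rintegral => x _; rewrite mulN1r.
Qed.

Lemma int_fin D f : measurable D -> intble D f ->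
  (\int[mu]_(x in D) (f x)%:E = (\int[mu]_(x in D) f x)%:E)%E.
Proof.
move=> mD fi; rewrite /Rintegral fineK //.
exact: (@integrable_fin_num _ (measurableTypeR R) R mu D mD).
Qed.

Lemma intble_sub D E f : measurable D -> measurable E -> D `<=` E ->
  intble E f -> intble D f.
Proof.
move=> mD mE; exact: (@integrableS _ (measurableTypeR R) R mu E D (EFin \o f) mE mD).
Qed.

Lemma intble_bounded D f (M : R) : measurable D -> (mu D < +oo)%E ->
  measurable_fun D f -> (forall x, D x -> `|f x| <= M) -> intble D f.
Proof.
move=> mD Doo mf fM; apply: (@measurable_bounded_integrable _ (measurableTypeR R)) => //.
exists M; split; first exact: num_real.
by move=> N MN x Dx; apply: (le_trans (fM x Dx)); exact: ltW.
Qed.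

(** Uniqueness of Lebesgue measure: the scaled image measure on the right also gives []p, q]] the
    mass q - p. *)
Lemma lebesgue_measure_affine a c : 0 < a -> forall A : set R, measurable A ->
  mu A = (a%:E * mu ((fun x => (a * x + c)%R) @^-1` A))%E.
Proof.
move=> a0 A mA.
have mphi : measurable_fun setT (fun x : measurableTypeR R => a * x + c : measurableTypeR R).
  by apply: measurable_funD => //; exact: measurable_funM.
have := @lebesgue_measure_unique R (mscale (NngNum (ltW a0))
  (pushforward mu (fun x : measurableTypeR R => a * x + c : measurableTypeR R))).
move=> /(_ mphi) h; rewrite h //= => _ [[p q]] _ <-.
rewrite /mscale /= /pushforward.
have -> : (fun x => a * x + c) @^-1` `]p, q] = `](p - c) / a, (q - c) / a]%classic.
  apply/seteqP; split=> x /=; rewrite !in_itv /= ltr_pdivrMr // ler_pdivlMr //;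
  by rewrite ltrBlDr lerBrDr [x * a]mulrC.
rewrite !lebesgue_measure_itv /= !lte_fin ltr_pM2r ?invr_gt0 // ltrD2r.
case: ifPn => _; last by rewrite mule0.
by rewrite -EFinB -EFinM; congr EFin; field; rewrite gt_eqF.
Qed.

Lemma ge0_integral_affine a c D (f : R -> \bar R) : 0 < a -> measurable D ->
  measurable_fun D f -> (forall x, 0 <= f x)%E ->
  (\int[mu]_(x in D) f x =
   a%:E * \int[mu]_(x in (fun x => (a * x + c)%R) @^-1` D) f (a * x + c)%R)%E.
Proof.
move=> a0 mD mf f0.
have mphi : measurable_fun setT (fun x : measurableTypeR R => a * x + c : measurableTypeR R).
  by apply: measurable_funD => //; exact: measurable_funM.
pose phi := (fun x : measurableTypeR R => a * x + c : measurableTypeR R).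
have := @ge0_integral_pushforward _ _ _ _ _ phi mphi mu D f mD mf (fun x _ => f0 x).
move=> /= <-.
have := @ge0_integral_mscale _ _ R (pushforward mu phi) D mD (NngNum (ltW a0)) f.
move=> /(_ mphi mf (fun x _ => f0 x)) /= <-.
by apply: eq_measure_integral => A mA AD; rewrite /= /mscale /= [LHS](lebesgue_measure_affine c a0).
Qed.

Lemma integral_shift c D (f : R -> \bar R) : measurable D -> measurable_fun D f ->
  (\int[mu]_(x in D) f x =
   \int[mu]_(x in (fun x => (x + c)%R) @^-1` D) f (x + c)%R)%E.
Proof.
move=> mD mf.
have h (g : R -> \bar R) : measurable_fun D g -> (forall x, 0 <= g x)%E -> (\int[mu]_(x in D) g x =
   \int[mu]_(x in (fun x => (x + c)%R) @^-1` D) g (x + c)%R)%E.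
  move=> mg g0; rewrite (@ge0_integral_affine 1 c D) // mul1e.
  by under eq_fun do rewrite mul1r; under eq_integral do rewrite mul1r.
rewrite [LHS]integralE [RHS]integralE; congr (_ - _)%E.
  rewrite h //; last exact: measurable_funepos.
  apply: eq_integral => x _.
  exact: (congr1 (@^~ x) (esym (funepos_comp f (fun x => x + c)))).
rewrite h //; last exact: measurable_funeneg.
apply: eq_integral => x _.
exact: (congr1 (@^~ x) (esym (funeneg_comp f (fun x => x + c)))).
Qed.

(** Dominated convergence with |f| itself as majorant. It makes an improper integral a limit over
    compact intervals, where the fundamental theorem of calculus applies. *)
Lemma cvg_Rintegral_bigcup (A : (set R)^nat) f : (forall n, measurable (A n)) ->
  nondecreasing_seq A -> intble (\bigcup_n A n) f ->
  \int[mu]_(x in A n) f x @[n --> \oo] --> \int[mu]_(x in \bigcup_n A n) f x.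
Proof.
move=> mA ndA intf; set D := \bigcup_n A n.
have mD : measurable D by exact: bigcup_measurable.
have mf : measurable_fun D (EFin \o f) by exact: measurable_int intf.
have AD n : A n `<=` D by exact: bigcup_sup.
pose f_ n := (EFin \o f) \_ (A n).
have [] := @dominated_convergence _ _ _ mu _ mD f_ (EFin \o f) (abse \o (EFin \o f)).
- move=> n; apply/(measurable_restrict _ (mA n) mD).
  by apply: (measurable_funS mD _ mf) => x [].
- exact: mf.
- apply: aeW => x Dx; have [k _ Akx] := Dx.
  apply: cvg_near_cst; exists k => // n /= kn; rewrite /f_ patchE mem_set //.
  by move: (ndA _ _ kn) => /subsetPset; exact.
- exact: integrable_abse.
- apply: aeW => x n Dx; rewrite /f_ patchE; case: ifPn => //= _.
  by rewrite normr0 lee_fin.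
move=> _ _ H.
have -> : (fun n => \int[mu]_(x in A n) f x) =
    (fun n => fine (\int[mu]_(x in D) f_ n x)%E).
  apply/funext => n; rewrite /Rintegral; congr fine.
  by rewrite /f_ -integral_mkcondr; congr integral; rewrite setIidr.
apply: fine_cvg; move: H.
by rewrite /Rintegral fineK //; exact: integrable_fin_num.
Qed.

(** Monotone convergence turns one bound for all the pieces, in practice read off from an
    antiderivative, into integrability. *)
Lemma ge0_intble_bigcup (A : (set R)^nat) f (M : R) : (forall n, measurable (A n)) ->
  nondecreasing_seq A -> measurable_fun (\bigcup_n A n) f ->
  (forall x, (\bigcup_n A n) x -> 0 <= f x) ->
  (forall n, \int[mu]_(x in A n) (f x)%:E <= M%:E)%E ->
  intble (\bigcup_n A n) f.
Proof.
move=> mA ndA mf f0 fM; set D := \bigcup_n A n.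
have mD : measurable D by exact: bigcup_measurable.
have AD n : A n `<=` D by exact: bigcup_sup.
apply/integrableP; split; first exact/measurable_EFinP.
rewrite (_ : (\int[mu]_(x in D) `|(EFin \o f) x| = \int[mu]_(x in D) (f x)%:E)%E); last first.
  by apply: eq_integral => x /set_mem Dx; rewrite /= ger0_norm ?f0.
apply: (@le_lt_trans _ _ M%:E); last exact: ltry.
have mfA n : measurable_fun (A n) (EFin \o f).
  by apply/measurable_EFinP; exact: measurable_funS mD (AD n) mf.
have f0A n x : A n x -> (0 <= (EFin \o f) x)%E by move=> /AD; rewrite /= lee_fin; exact: f0.
have cv := @ge0_nondecreasing_set_cvg_integral _ (measurableTypeR R) R A _ mu ndA mA mfA f0A.
rewrite -(cvg_lim _ cv) //.
apply: lime_le; last exact: nearW.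
by apply/cvg_ex; eexists; exact: cv.
Qed.

End real_integrals.

(** * Integrals depending on a parameter, and Fubini's theorem *)

Section parametric_integrals.
Context {R : realType}.
Implicit Types (D A B : set R) (g h : R -> R).

Let mI (D : set R) : measurable D -> measurable_fun setT (\1_D : R -> R).
Proof. by move=> mD; exact: measurable_indic. Qed.

Let tonelli d (T : measurableType d) (G : T * R -> \bar R) : measurable_fun setT G ->
  (forall p, 0 <= G p)%E -> measurable_fun setT (fun x => \int[mu]_y G (x, y))%E.
Proof.
exact: (@measurable_fun_fubini_tonelli_F _ _ T (measurableTypeR R) R mu G).
Qed.

(** The integral is the difference of the integrals of the positive and negative parts, and each of
    these is measurable in x by Tonelli, whether or not [f x] is integrable. *)
Lemma measurable_Rintegral d (T : measurableType d) D (f : T -> R -> R) : measurable D ->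
  measurable_fun setT (fun p : T * R => f p.1 p.2) ->
  measurable_fun setT (fun x => \int[mu]_(y in D) f x y).
Proof.
move=> mD mf; apply: measurableT_comp; first exact: fine_measurable.
pose F (p : T * R) := (f p.1 p.2 * \1_D p.2)%:E.
have mF : measurable_fun setT F.
  apply/measurable_EFinP; apply: measurable_funM => //.
  exact: (measurableT_comp (mI mD) measurable_snd).
rewrite (_ : (fun x => _) = (fun x => \int[mu]_y (F^\+ (x, y)) - \int[mu]_y (F^\- (x, y)))%E).
  apply: emeasurable_funB.
    by apply: tonelli => //; exact: measurable_funepos.
  by apply: tonelli => //; exact: measurable_funeneg.
apply/funext => x; rewrite integral_mkcond.
have -> : (EFin \o f x) \_ D = F \o (fun y => (x, y)).
  apply/funext => z; rewrite patchE /F /= indicE.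
  by case: ifPn => _; rewrite ?mulr1 ?mulr0.
by rewrite integralE funepos_comp funeneg_comp.
Qed.

(** A majorant of product form g(x) h(y) yields integrability of all sections, of both partial
    integrals and on the product. *)
Lemma Rintegral_Fubini A B (f : R -> R -> R) g h : measurable A -> measurable B ->
  measurable_fun setT (fun p : R * R => f p.1 p.2) ->
  (forall x, A x -> 0 <= g x) -> (forall y, B y -> 0 <= h y) ->
  (forall x y, A x -> B y -> `|f x y| <= g x * h y) -> intble A g -> intble B h ->
  [/\ intble A (fun x => \int[mu]_(y in B) f x y),
      intble B (fun y => \int[mu]_(x in A) f x y) &
      \int[mu]_(x in A) \int[mu]_(y in B) f x y =
      \int[mu]_(y in B) \int[mu]_(x in A) f x y].
Proof.
move=> mA mB mf g0 h0 fgh ig ih.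
have mfT : measurable_fun setT (fun p : R * R => f p.2 p.1).
  exact: (measurableT_comp mf (measurable_fun_pair measurable_snd measurable_fst)).
have mfx x : measurable_fun setT (f x).
  exact: (measurableT_comp mf (measurable_fun_pair (measurable_cst x) (@measurable_id _ _ setT))).
have mfy y : measurable_fun setT (f ^~ y).
  exact: (measurableT_comp mf (measurable_fun_pair (@measurable_id _ _ setT) (measurable_cst y))).
have ifx x : A x -> intble B (f x).
  move=> Ax; apply: (@le_intble _ _ _ (fun y => g x * h y)) => //.
  - exact: measurable_funTS.
  - by move=> y By; exact: fgh.
  - exact: intbleMl.
have ify y : B y -> intble A (f ^~ y).
  move=> By; apply: (@le_intble _ _ _ (fun x => h y * g x)) => //.
  - exact: measurable_funTS.
  - by move=> x Ax; rewrite mulrC; exact: fgh.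
  - exact: intbleMl.
have intA : intble A (fun x => \int[mu]_(y in B) f x y).
  apply: (@le_intble _ _ _ (fun x => (\int[mu]_(y in B) h y) * g x)) => //.
  - exact: (measurable_funTS (measurable_Rintegral mB mf)).
  - move=> x Ax; rewrite mulrC -intMl //.
    apply: (le_trans (le_normr_int mB (ifx x Ax))); apply: le_int => //.
    + exact: intble_norm (ifx x Ax).
    + exact: intbleMl.
    + by move=> y By; exact: fgh.
  - exact: intbleMl.
have intB : intble B (fun y => \int[mu]_(x in A) f x y).
  apply: (@le_intble _ _ _ (fun y => (\int[mu]_(x in A) g x) * h y)) => //.
  - exact: (measurable_funTS (measurable_Rintegral mA mfT)).
  - move=> y By; rewrite mulrC -intMl //.
    apply: (le_trans (le_normr_int mA (ify y By))); apply: le_int => //.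
    + exact: intble_norm (ify y By).
    + exact: intbleMl.
    + by move=> x Ax; rewrite mulrC; exact: fgh.
  - exact: intbleMl.
split => //.
(* Extension by zero outside A x B reduces the claim to Fubini's theorem on the whole plane. *)
pose F (p : R * R) := (f p.1 p.2 * (\1_A p.1 * \1_B p.2))%:E.
have mF : measurable_fun setT F.
  apply/measurable_EFinP; apply: measurable_funM => //; apply: measurable_funM.
    exact: (measurableT_comp (mI mA) measurable_fst).
  exact: (measurableT_comp (mI mB) measurable_snd).
have Fx (x : R) : (\int[mu]_y F (x, y) = (\int[mu]_(y in B) f x y * \1_A x)%:E)%E.
  rewrite /F /= indicE; case: (boolP (x \in A)) => xA; last first.
    by rewrite mulr0 integral0_eq // => y _; rewrite mul0r mulr0.
  rewrite mulr1 -(int_fin mB (ifx _ (set_mem xA))) [RHS]integral_mkcond; apply: eq_integral => y _.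
  by rewrite patchE mul1r indicE; case: ifPn; rewrite ?mulr1 ?mulr0.
have Fy (y : R) : (\int[mu]_x F (x, y) = (\int[mu]_(x in A) f x y * \1_B y)%:E)%E.
  rewrite /F /= indicE; case: (boolP (y \in B)) => yB; last first.
    by rewrite mulr0 integral0_eq // => x _; rewrite !mulr0.
  rewrite mulr1 -(int_fin mA (ify _ (set_mem yB))) [RHS]integral_mkcond; apply: eq_integral => x _.
  by rewrite patchE mulr1 indicE; case: ifPn; rewrite ?mulr1 ?mulr0.
have iF : (mu \x mu)%E.-integrable setT F.
  apply/(@integrable12ltyP _ _ (measurableTypeR R) (measurableTypeR R) R mu mu F mF).
  pose G := \int[mu]_(y in B) h y.
  apply: (@le_lt_trans _ _ (\int[mu]_(x in A) (G * g x)%:E)%E); last first.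
    by rewrite (int_fin mA (intbleMl G mA ig)) ltry.
  rewrite [leRHS]integral_mkcond; apply: ge0_le_integral => //.
  - by move=> x _; apply: integral_ge0.
  - apply: (tonelli (G := fun p => `|F p|%E)); last by move=> p; exact: abse_ge0.
    exact: (measurableT_comp (@abse_measurable R setT) mF).
  - apply/(measurable_restrictT _ mA); exact: measurable_int (intbleMl G mA ig).
  move=> x _; rewrite patchE; case: ifPn => [/set_mem Ax|xA]; last first.
    rewrite integral0_eq // => y _; rewrite /F /= indicE (negbTE xA).
    by rewrite mul0r mulr0 normr0.
  rewrite mulrC -intMl // -(int_fin mB (intbleMl (g x) mB ih)) [leRHS]integral_mkcond; apply: ge0_le_integral => //.
  - by apply: measurableT_comp => //; exact: (measurableT_comp mF (measurable_fun_pair _ _)).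
  - apply/(measurable_restrictT _ mB); exact: measurable_int (intbleMl (g x) mB ih).
  move=> y _; rewrite patchE /F /= !indicE mem_set //.
  case: ifPn => [/set_mem By|_]; last by rewrite mulr0 mulr0 normr0.
  by rewrite mulr1 mulr1 lee_fin fgh.
have := Fubini iF.
under eq_integral do rewrite Fx.
under [in RHS]eq_integral do rewrite Fy.
move=> H; rewrite [LHS]Rintegral_mkcond [RHS]Rintegral_mkcond; congr fine.
have E1 : (\int[mu]_x (((fun x => \int[mu]_(y in B) f x y) \_ A) x)%:E =
    \int[mu]_x (\int[mu]_(y in B) f x y * \1_A x)%:E)%E.
  by apply: eq_integral => x _; rewrite patchE indicE; case: ifPn; rewrite ?mulr1 ?mulr0.
have E2 : (\int[mu]_x (((fun y => \int[mu]_(x in A) f x y) \_ B) x)%:E =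
    \int[mu]_y (\int[mu]_(x in A) f x y * \1_B y)%:E)%E.
  by apply: eq_integral => x _; rewrite patchE indicE; case: ifPn; rewrite ?mulr1 ?mulr0.
by rewrite E1 E2.
Qed.

End parametric_integrals.

(** * Complex-valued integrals *)

Section complex_measurability.
Context {R : realType} d {T : measurableType d}.
Implicit Types (D : set T) (f g : T -> R[i]).

Definition cmeas D f :=
  measurable_fun D (fun x => Re (f x)) /\ measurable_fun D (fun x => Im (f x)).

Lemma cmeas_sub D f : measurable D -> cmeas setT f -> cmeas D f.
Proof. by move=> mD [f1 f2]; split; exact: measurable_funTS. Qed.

Lemma cmeas_cst D (z : R[i]) : cmeas D (fun=> z).
Proof. by split; exact: measurable_cst. Qed.

Lemma cmeas_real D (h : T -> R) : measurable_fun D h -> cmeas D (fun x => (h x)%:C).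
Proof. by move=> mh; split => //=; exact: measurable_cst. Qed.

Lemma cmeasD D f g : cmeas D f -> cmeas D g -> cmeas D (fun x => f x + g x).
Proof.
move=> [f1 f2] [g1 g2]; split.
  by under eq_fun do rewrite cReD; exact: measurable_funD.
by under eq_fun do rewrite cImD; exact: measurable_funD.
Qed.

Lemma cmeasN D f : cmeas D f -> cmeas D (fun x => - f x).
Proof.
move=> [f1 f2]; split.
  by under eq_fun do rewrite cReN; exact: measurable_funN.
by under eq_fun do rewrite cImN; exact: measurable_funN.
Qed.

Lemma cmeasM D f g : cmeas D f -> cmeas D g -> cmeas D (fun x => f x * g x).
Proof.
move=> [f1 f2] [g1 g2]; split.
  under eq_fun do rewrite cReM.
  by apply: measurable_funB; exact: measurable_funM.
under eq_fun do rewrite cImM.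
by apply: measurable_funD; exact: measurable_funM.
Qed.

Lemma cmeas_cexp D f : cmeas D f -> cmeas D (fun x => cexp (f x)).
Proof.
move=> [f1 f2]; split.
  under eq_fun do rewrite Re_cexp; apply: measurable_funM.
    exact: (measurableT_comp (@measurable_expR R) f1).
  exact: (measurableT_comp (continuous_measurable_fun (@continuous_cos R)) f2).
under eq_fun do rewrite Im_cexp; apply: measurable_funM.
  exact: (measurableT_comp (@measurable_expR R) f1).
exact: (measurableT_comp (continuous_measurable_fun (@continuous_sin R)) f2).
Qed.

Lemma cmeasV D f : cmeas D f -> cmeas D (fun x => (f x)^-1).
Proof.
move=> [f1 f2].
have mn : measurable_fun D (fun x => (Re (f x) ^+ 2 + Im (f x) ^+ 2)^-1).
  under eq_fun do rewrite -powR_inv1 ?addr_ge0 ?sqr_ge0 //.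
  apply: (measurableT_comp (measurable_powR (-1))).
  by apply: measurable_funD; exact: measurable_funX.
split.
  by under eq_fun do rewrite cReV; exact: measurable_funM.
under eq_fun do rewrite cImV; apply: measurable_funM => //.
exact: measurable_funN.
Qed.

End complex_measurability.

Section complex_integrals.
Context {R : realType}.
Implicit Types (D A B : set R) (f : R -> R[i]) (z w : R[i]) (g h : R -> R).

Lemma cintegrable_dom D f g : measurable D -> cmeas D f ->
  (forall x, D x -> normc (f x) <= g x) -> intble D g -> cintegrable D f.
Proof.
move=> mD [f1 f2] fg ig; split.
  apply: le_intble ig => // x Dx; exact: le_trans (Re_le_normc _) (fg x Dx).
apply: le_intble ig => // x Dx; exact: le_trans (Im_le_normc _) (fg x Dx).
Qed.

Lemma eq_cintegral D f f' : (forall x, D x -> f x = f' x) ->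
  cintegral D f = cintegral D f'.
Proof.
move=> ff; apply: complexP => /=; apply: eq_Rintegral => x /set_mem Dx;
by rewrite ff.
Qed.

Lemma cintegrableD D f f' : measurable D -> cintegrable D f -> cintegrable D f' ->
  cintegrable D (fun x => f x + f' x).
Proof.
move=> mD [f1 f2] [f3 f4]; split.
  by under eq_fun do rewrite cReD; exact: intbleD.
by under eq_fun do rewrite cImD; exact: intbleD.
Qed.

Lemma cintegrableZ D f z : measurable D -> cintegrable D f ->
  cintegrable D (fun x => z * f x).
Proof.
move=> mD [f1 f2]; split.
  under eq_fun do rewrite cReM -mulNr.
  by apply: intbleD => //; exact: intbleMl.
under eq_fun do rewrite cImM.
by apply: intbleD => //; exact: intbleMl.
Qed.

Lemma cintegralD D f f' : measurable D -> cintegrable D f -> cintegrable D f' ->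
  cintegral D (fun x => f x + f' x) = cintegral D f + cintegral D f'.
Proof.
move=> mD [f1 f2] [f3 f4]; apply: complexP; rewrite ?(cReD, cImD) /=.
  by under eq_Rintegral do rewrite cReD; exact: intD.
by under eq_Rintegral do rewrite cImD; exact: intD.
Qed.

Lemma cintegralZ D f z : measurable D -> cintegrable D f ->
  cintegral D (fun x => z * f x) = z * cintegral D f.
Proof.
move=> mD [f1 f2]; apply: complexP; rewrite ?(cReM, cImM) /=.
  under eq_Rintegral do rewrite cReM -mulNr.
  by rewrite intD ?intMl ?mulNr //; exact: intbleMl.
under eq_Rintegral do rewrite cImM.
by rewrite intD ?intMl //; exact: intbleMl.
Qed.

Lemma cintegralB D f f' : measurable D -> cintegrable D f -> cintegrable D f' ->
  cintegral D (fun x => f x - f' x) = cintegral D f - cintegral D f'.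
Proof.
move=> mD i1 i2; have i3 := cintegrableZ (-1) mD i2.
rewrite -mulN1r -(cintegralZ (-1) mD i2) -(cintegralD mD i1 i3).
by apply: eq_cintegral => x _; rewrite mulN1r.
Qed.

(** The real and imaginary parts are bounded separately, whence the factor 2. *)
Lemma normc_cintegral_le D f g : measurable D -> cmeas D f ->
  (forall x, D x -> normc (f x) <= g x) -> intble D g ->
  normc (cintegral D f) <= 2 * \int[mu]_(x in D) g x.
Proof.
move=> mD mf fg ig; have [f1 f2] := cintegrable_dom mD mf fg ig.
rewrite (le_trans (normc_le_ReIm _)) // mulr_natl mulr2n /=.
have h (k : R -> R) : intble D k -> (forall x, D x -> `|k x| <= g x) ->
    `|\int[mu]_(x in D) k x| <= \int[mu]_(x in D) g x.
  move=> ik kg; apply: (le_trans (le_normr_int mD ik)).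
  by apply: le_int => //; exact: intble_norm.
apply: lerD; apply: h => // x Dx.
  exact: le_trans (Re_le_normc _) (fg x Dx).
exact: le_trans (Im_le_normc _) (fg x Dx).
Qed.

Lemma cintegral_shift D f (c : R) : measurable D -> cmeas D f ->
  cintegral D f = cintegral ((fun x => (x + c)%R) @^-1` D) (fun x => f (x + c)).
Proof.
move=> mD [f1 f2]; apply: complexP; rewrite /= /Rintegral; congr fine.
  by rewrite (integral_shift c) //; exact/measurable_EFinP.
by rewrite (integral_shift c) //; exact/measurable_EFinP.
Qed.

Lemma cmeas_cintegral d (T : measurableType d) D (f : T -> R -> R[i]) : measurable D ->
  cmeas setT (fun p : T * R => f p.1 p.2) -> cmeas setT (fun x => cintegral D (f x)).
Proof.
move=> mD [f1 f2]; split => /=.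
  exact: (measurable_Rintegral (f := fun x y => Re (f x y))).
exact: (measurable_Rintegral (f := fun x y => Im (f x y))).
Qed.

Lemma cintegral_Fubini A B (f : R -> R -> R[i]) g h : measurable A -> measurable B ->
  cmeas setT (fun p : R * R => f p.1 p.2) ->
  (forall x, A x -> 0 <= g x) -> (forall y, B y -> 0 <= h y) ->
  (forall x y, A x -> B y -> normc (f x y) <= g x * h y) -> intble A g -> intble B h ->
  [/\ cintegrable A (fun x => cintegral B (f x)),
      cintegrable B (fun y => cintegral A (f ^~ y)) &
      cintegral A (fun x => cintegral B (f x)) =
      cintegral B (fun y => cintegral A (f ^~ y))].
Proof.
move=> mA mB [f1 f2] g0 h0 fgh ig ih.
have [|i1 i2 e] := @Rintegral_Fubini R A B (fun x y => Re (f x y)) g h mA mB f1 g0 h0 _ ig ih.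
  by move=> x y Ax By; exact: le_trans (Re_le_normc _) (fgh x y Ax By).
have [|i3 i4 e'] := @Rintegral_Fubini R A B (fun x y => Im (f x y)) g h mA mB f2 g0 h0 _ ig ih.
  by move=> x y Ax By; exact: le_trans (Im_le_normc _) (fgh x y Ax By).
by split; [split|split|exact: complexP].
Qed.

(** Differentiability of f' on the segment serves as its continuity, under which the fundamental
    theorem holds for both coordinates. *)
Lemma cFTC f f' a b : a < b ->
  (forall t, a <= t <= b -> cderive f t (f' t)) ->
  (forall t, a <= t <= b -> exists l, cderive f' t l) ->
  cintegral `[a, b] f' = f b - f a.
Proof.
move=> ab df df'.
have h (k l : R -> R) : (forall t, a <= t <= b -> is_derive t (1 : R) k (l t)) ->
    (forall t, a <= t <= b -> {for t, continuous l}) ->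
    \int[mu]_(x in `[a, b]) l x = k b - k a.
  move=> dk cl; rewrite /Rintegral (@continuous_FTC2 _ _ k) //.
  - apply: continuous_in_subspaceT => t /set_mem /=; rewrite in_itv /=; exact: cl.
  - have ck t : a <= t <= b -> {for t, continuous k}.
      move=> /dk dt; apply: differentiable_continuous.
      by apply/derivable1_diffP; exact: (@ex_derive _ _ _ _ _ _ _ dt).
    split.
    + move=> t; rewrite in_itv /= => /andP[at_ tb].
      by have := dk t; rewrite !ltW // => /(_ isT) dt; exact: (@ex_derive _ _ _ _ _ _ _ dt).
    + by apply: cvg_at_right_filter; apply: (ck a); rewrite lexx ltW.
    + by apply: cvg_at_left_filter; apply: (ck b); rewrite lexx ltW.
  - move=> t; rewrite in_itv /= => /andP[at_ tb].
    by have := dk t; rewrite !ltW // => /(_ isT) dt; rewrite derive1E derive_val.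
apply: complexP; rewrite ?(cReD, cImD, cReN, cImN) /=.
  apply: (h (fun x => Re (f x)) (fun x => Re (f' x))); first by move=> t /df [].
  by move=> t /df' [l /cderive_cont[]].
apply: (h (fun x => Im (f x)) (fun x => Im (f' x))); first by move=> t /df [].
by move=> t /df' [l /cderive_cont[]].
Qed.

End complex_integrals.

(** * Loop integrals *)

Section loops.
Context {R : realType}.
Implicit Types (D B : set R) (z w : R[i]) (F G : R[i] -> R[i]) (g h : R -> R) (x y : R).

Definition cmeas2 F := cmeas setT (fun p : R * R => F (p.1 +i* p.2)).

Definition on_loop x0 z := [/\ Re z <= x0, `|Im z| <= 1 & Re z = x0 \/ `|Im z| = 1].

Definition loop_integrable x0 F :=
  [/\ cintegrable `]-oo, x0] (fun x => F (x +i* -1)),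
      cintegrable `[-1, 1] (fun y => F (x0 +i* y)) &
      cintegrable `]-oo, x0] (fun x => F (x +i* 1))].

Lemma on_loop_bot x0 x : x <= x0 -> on_loop x0 (x +i* -1).
Proof. by move=> xx; split => //=; rewrite normrN normr1 //; right. Qed.

Lemma on_loop_top x0 x : x <= x0 -> on_loop x0 (x +i* 1).
Proof. by move=> xx; split => //=; rewrite normr1 //; right. Qed.

Lemma on_loop_right x0 y : -1 <= y <= 1 -> on_loop x0 (x0 +i* y).
Proof. by move=> yy; split => //=; [rewrite ler_norml|left]. Qed.

Lemma cmeas_fst2 d (T : measurableType d) F (a b : T -> R) : measurable_fun setT a ->
  measurable_fun setT b -> cmeas2 F -> cmeas setT (fun t => F (a t +i* b t)).
Proof.
move=> ma mb [f1 f2]; split.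
  exact: (measurableT_comp f1 (measurable_fun_pair ma mb)).
exact: (measurableT_comp f2 (measurable_fun_pair ma mb)).
Qed.

Lemma cmeas_hline F b : cmeas2 F -> cmeas setT (fun x : R => F (x +i* b)).
Proof. by apply: cmeas_fst2; [exact: measurable_id|exact: measurable_cst]. Qed.

Lemma cmeas_vline F a : cmeas2 F -> cmeas setT (fun y : R => F (a +i* y)).
Proof. by apply: cmeas_fst2; [exact: measurable_cst|exact: measurable_id]. Qed.

Lemma eq_loop x0 F G : (forall z, on_loop x0 z -> F z = G z) ->
  loop_integral x0 F = loop_integral x0 G.
Proof.
move=> FG; rewrite /loop_integral; congr (_ + _ * _ - _); apply: eq_cintegral => t /=;
  rewrite in_itv /= => ht; apply: FG.
- exact: on_loop_bot.
- exact: on_loop_right.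
- exact: on_loop_top.
Qed.

Lemma lebesgue_measure_N11 : (@lebesgue_measure R `[(-1)%R, 1%R]%classic < +oo)%E.
Proof. by rewrite lebesgue_measure_itv /=; case: ifP => _; rewrite ltry. Qed.

Lemma intble_cst11 (c : R) : intble `[-1, 1] (fun=> c).
Proof.
apply: (@intble_bounded _ _ _ `|c|) => //; first exact: lebesgue_measure_N11.
Qed.

(** The majorant depends on Re z only: it is integrable along the horizontal sides and constant on
    the vertical one. *)
Lemma loop_dom x0 F g : cmeas2 F ->
  (forall z, on_loop x0 z -> normc (F z) <= g (Re z)) -> intble `]-oo, x0] g ->
  loop_integrable x0 F.
Proof.
move=> mF Fg ig; split.
- apply: cintegrable_dom ig => //; first by apply: cmeas_sub => //; exact: cmeas_hline.
  by move=> x /=; rewrite in_itv /= => /on_loop_bot/Fg.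
- apply: (@cintegrable_dom _ _ _ (fun=> g x0)) => //; last exact: intble_cst11.
    by apply: cmeas_sub => //; exact: cmeas_vline.
  by move=> y /=; rewrite in_itv /= => /(on_loop_right x0)/Fg.
- apply: cintegrable_dom ig => //; first by apply: cmeas_sub => //; exact: cmeas_hline.
  by move=> x /=; rewrite in_itv /= => /on_loop_top/Fg.
Qed.

(** Each horizontal side costs twice the integral of g, and the vertical side, of length 2, costs
    twice 2 g(x0). *)
Lemma normc_loop_le x0 F g : cmeas2 F ->
  (forall z, on_loop x0 z -> normc (F z) <= g (Re z)) -> intble `]-oo, x0] g ->
  normc (loop_integral x0 F) <= 4 * \int[mu]_(x in `]-oo, x0]) g x + 4 * g x0.
Proof.
move=> mF Fg ig; rewrite /loop_integral.
apply: (le_trans (normc_triangle _ _)); rewrite normcN.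
have h1 : normc (cintegral `]-oo, x0] (fun x => F (x +i* -1))) <=
    2 * \int[mu]_(x in `]-oo, x0]) g x.
  apply: normc_cintegral_le => //; first by apply: cmeas_sub => //; exact: cmeas_hline.
  by move=> x /=; rewrite in_itv /= => /on_loop_bot/Fg.
have h3 : normc (cintegral `]-oo, x0] (fun x => F (x +i* 1))) <=
    2 * \int[mu]_(x in `]-oo, x0]) g x.
  apply: normc_cintegral_le => //; first by apply: cmeas_sub => //; exact: cmeas_hline.
  by move=> x /=; rewrite in_itv /= => /on_loop_top/Fg.
have h2 : normc (cintegral `[-1, 1] (fun y => F (x0 +i* y))) <= 4 * g x0.
  have -> : 4 * g x0 = 2 * \int[mu]_(y in `[-1, 1]) (fun=> g x0) y.
    have N11 : (-1 : R) < 1 by lra.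
    by rewrite Rintegral_cst //= lebesgue_measure_itv /= lte_fin N11 /=; ring.
  apply: normc_cintegral_le => //; last exact: intble_cst11.
    by apply: cmeas_sub => //; exact: cmeas_vline.
  by move=> y /=; rewrite in_itv /= => /(on_loop_right x0)/Fg.
have h2' : normc ((0 +i* 1) * cintegral `[-1, 1] (fun y => F (x0 +i* y))) <= 4 * g x0.
  by rewrite normcM /= expr0n expr1n add0r sqrtr1 mul1r.
have := normc_triangle (cintegral `]-oo, x0] (fun x => F (x +i* -1)))
  ((0 +i* 1) * cintegral `[-1, 1] (fun y => F (x0 +i* y))).
move: h1 h2' h3; lra.
Qed.

Lemma loop_integrableZ x0 F w : loop_integrable x0 F -> loop_integrable x0 (fun z => w * F z).
Proof. by move=> [? ? ?]; split; exact: cintegrableZ. Qed.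

Lemma loop_integrableD x0 F G : loop_integrable x0 F -> loop_integrable x0 G ->
  loop_integrable x0 (fun z => F z + G z).
Proof. by move=> [? ? ?] [? ? ?]; split; exact: cintegrableD. Qed.

Lemma loopZ x0 F w : loop_integrable x0 F ->
  loop_integral x0 (fun z => w * F z) = w * loop_integral x0 F.
Proof. by move=> [i1 i2 i3]; rewrite /loop_integral !cintegralZ //; ring. Qed.

Lemma loopD x0 F G : loop_integrable x0 F -> loop_integrable x0 G ->
  loop_integral x0 (fun z => F z + G z) = loop_integral x0 F + loop_integral x0 G.
Proof.
by move=> [i1 i2 i3] [i4 i5 i6]; rewrite /loop_integral !cintegralD //; ring.
Qed.

Lemma loop_shift x0 c F : cmeas2 F ->
  loop_integral x0 (fun z => F (z + c%:C)) = loop_integral (x0 + c) F.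
Proof.
move=> mF; rewrite /loop_integral.
have E : (fun x : R => x + c) @^-1` `]-oo, x0 + c] = `]-oo, x0]%classic.
  by apply/seteqP; split => x /=; rewrite !in_itv /= lerD2r.
have S b : cintegral `]-oo, x0] (fun x => F ((x +i* b) + c%:C)) =
    cintegral `]-oo, (x0 + c)] (fun x => F (x +i* b)).
  rewrite [RHS](cintegral_shift c) //; last by apply: cmeas_sub => //; exact: cmeas_hline.
  by rewrite E; apply: eq_cintegral => x _; congr F; apply: complexP => /=; rewrite ?addr0.
rewrite !S; congr (_ + _ * _ - _); apply: eq_cintegral => y _; congr F.
by apply: complexP => /=; rewrite ?addr0.
Qed.

Lemma cintegral_comb B (k1 k2 k3 : R -> R[i]) w : measurable B ->
  cintegrable B k1 -> cintegrable B k2 -> cintegrable B k3 ->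
  cintegrable B (fun y => k1 y + w * k2 y - k3 y) /\
  cintegral B (fun y => k1 y + w * k2 y - k3 y) =
  cintegral B k1 + w * cintegral B k2 - cintegral B k3.
Proof.
move=> mB i1 i2 i3.
have i3' := cintegrableZ (-1) mB i3.
have i2' := cintegrableZ w mB i2.
have i12 := cintegrableD mB i1 i2'.
have eN : (fun y => k1 y + w * k2 y - k3 y) = (fun y => (k1 y + w * k2 y) + -1 * k3 y).
  by apply/funext => y; rewrite mulN1r.
rewrite eN; split; first exact: (cintegrableD mB i12 i3').
rewrite (cintegralD mB i12 i3') (cintegralD mB i1 i2') (cintegralZ w mB i2).
by rewrite (cintegralZ (-1) mB i3) mulN1r.
Qed.

(** Fubini on each of the three sides; the vertical one carries the constant majorant g(x0). *)
Lemma loop_set_Fubini x0 B (f : R[i] -> R -> R[i]) g h : measurable B ->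
  cmeas setT (fun p : (R * R) * R => f (p.1.1 +i* p.1.2) p.2) ->
  (forall z y, on_loop x0 z -> B y -> normc (f z y) <= g (Re z) * h y) ->
  (forall x, x <= x0 -> 0 <= g x) -> (forall y, B y -> 0 <= h y) ->
  intble `]-oo, x0] g -> intble B h ->
  [/\ loop_integrable x0 (fun z => cintegral B (f z)),
      cintegrable B (fun y => loop_integral x0 (f ^~ y)) &
      loop_integral x0 (fun z => cintegral B (f z)) =
      cintegral B (fun y => loop_integral x0 (f ^~ y))].
Proof.
move=> mB mf fgh g0 h0 ig ih.
have mh (a b : R -> R) : measurable_fun setT a -> measurable_fun setT b ->
    cmeas setT (fun p : R * R => f (a p.1 +i* b p.1) p.2).
  move=> ma mb.
  have mp : measurable_fun setT (fun p : R * R => ((a p.1, b p.1), p.2)).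
    apply: measurable_fun_pair => //; apply: measurable_fun_pair.
      exact: (measurableT_comp ma measurable_fst).
    exact: (measurableT_comp mb measurable_fst).
  case: mf => f1 f2; split; [exact: (measurableT_comp f1 mp)|exact: (measurableT_comp f2 mp)].
have [//|||i1 i2 e1] := @cintegral_Fubini R `]-oo, x0] B (fun x y => f (x +i* -1) y) g h _ mB
    (mh id (fun=> -1) (@measurable_id _ _ setT) (measurable_cst _)) _ h0 _ ig ih.
- by move=> x /=; rewrite in_itv /=; exact: g0.
- by move=> x y /=; rewrite in_itv /= => /on_loop_bot/fgh k; exact: k.
have [//|||i3 i4 e3] := @cintegral_Fubini R `]-oo, x0] B (fun x y => f (x +i* 1) y) g h _ mB
    (mh id (fun=> 1) (@measurable_id _ _ setT) (measurable_cst _)) _ h0 _ ig ih.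
- by move=> x /=; rewrite in_itv /=; exact: g0.
- by move=> x y /=; rewrite in_itv /= => /on_loop_top/fgh k; exact: k.
have [//|||i5 i6 e5] := @cintegral_Fubini R `[-1, 1] B (fun x y => f (x0 +i* x) y) (fun=> g x0) h _ mB
    (mh (fun=> x0) id (measurable_cst _) (@measurable_id _ _ setT)) _ h0 _ (intble_cst11 _) ih.
- by move=> x _; exact: g0.
- by move=> x y /=; rewrite in_itv /= => /(on_loop_right x0)/fgh k; exact: k.
have [j e] := cintegral_comb (0 +i* 1) mB i2 i6 i4.
split; [by split|exact: j|].
by rewrite /loop_integral e1 e3 e5 -e.
Qed.

Lemma loop_loop_Fubini x0 x1 (f : R[i] -> R[i] -> R[i]) g h :
  cmeas setT (fun p : (R * R) * (R * R) => f (p.1.1 +i* p.1.2) (p.2.1 +i* p.2.2)) ->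
  (forall z w, on_loop x0 z -> on_loop x1 w -> normc (f z w) <= g (Re z) * h (Re w)) ->
  (forall x, x <= x0 -> 0 <= g x) -> (forall y, y <= x1 -> 0 <= h y) ->
  intble `]-oo, x0] g -> intble `]-oo, x1] h ->
  loop_integral x0 (fun z => loop_integral x1 (f z)) =
  loop_integral x1 (fun w => loop_integral x0 (f ^~ w)).
Proof.
move=> mf fgh g0 h0 ig ih.
have mh (a b : R -> R) : measurable_fun setT a -> measurable_fun setT b ->
    cmeas setT (fun p : (R * R) * R => f (p.1.1 +i* p.1.2) (a p.2 +i* b p.2)).
  move=> ma mb.
  have mp : measurable_fun setT (fun p : (R * R) * R => (p.1, (a p.2, b p.2))).
    apply: measurable_fun_pair => //; apply: measurable_fun_pair.
      exact: (measurableT_comp ma measurable_snd).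
    exact: (measurableT_comp mb measurable_snd).
  case: mf => f1 f2; split; [exact: (measurableT_comp f1 mp)|exact: (measurableT_comp f2 mp)].
have [//|||i1 i2 e1] := @loop_set_Fubini x0 `]-oo, x1] (fun z y => f z (y +i* -1)) g h _
    (mh id (fun=> -1) (@measurable_id _ _ setT) (measurable_cst _)) _ g0 _ ig ih.
- by move=> z y zl /=; rewrite in_itv /= => /on_loop_bot yl; exact: fgh zl yl.
- by move=> x /=; rewrite in_itv /=; exact: h0.
have [//|||i3 i4 e3] := @loop_set_Fubini x0 `]-oo, x1] (fun z y => f z (y +i* 1)) g h _
    (mh id (fun=> 1) (@measurable_id _ _ setT) (measurable_cst _)) _ g0 _ ig ih.
- by move=> z y zl /=; rewrite in_itv /= => /on_loop_top yl; exact: fgh zl yl.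
- by move=> x /=; rewrite in_itv /=; exact: h0.
have [//|||i5 i6 e5] := @loop_set_Fubini x0 `[-1, 1] (fun z y => f z (x1 +i* y)) g (fun=> h x1) _
    (mh (fun=> x1) id (measurable_cst _) (@measurable_id _ _ setT)) _ g0 _ ig (intble_cst11 _).
- by move=> z y zl /=; rewrite in_itv /= => /(on_loop_right x1) yl; exact: fgh zl yl.
- by move=> x _; exact: h0.
rewrite [RHS]/loop_integral -e1 -e3 -e5 -(loopZ _ i5).
have i5' := loop_integrableZ (0 +i* 1) i5.
have i3' := loop_integrableZ (-1) i3.
rewrite -[- loop_integral _ _]mulN1r -(loopZ _ i3) -loopD // -loopD //; last exact: loop_integrableD.
by apply: eq_loop => z _; rewrite mulN1r.
Qed.

End loops.

(** * Cauchy's theorem on rectangles and loops *)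

Section cauchy.
Context {R : realType}.
Implicit Types (z w : R[i]) (F G : R[i] -> R[i]) (g h : R -> R) (x y : R).

Definition rect_integral (x1 x2 : R) F :=
  cintegral `[x1, x2] (fun x => F (x +i* -1))
  + (0 +i* 1) * cintegral `[-1, 1] (fun y => F (x2 +i* y))
  - cintegral `[x1, x2] (fun x => F (x +i* 1))
  - (0 +i* 1) * cintegral `[-1, 1] (fun y => F (x1 +i* y)).

Lemma cintegral_split f (x1 x2 : R) : x1 <= x2 -> cintegrable `]-oo, x2] f ->
  cintegral `]-oo, x2] f = cintegral `]-oo, x1] f + cintegral `[x1, x2] f.
Proof.
move=> x12 [f1 f2].
have h (k : R -> R) : intble `]-oo, x2] k -> \int[mu]_(x in `]-oo, x2]) k x =
    \int[mu]_(x in `]-oo, x1]) k x + \int[mu]_(x in `[x1, x2]) k x.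
  move=> ik; have := @Rintegral_itvB R k -oo%O (BRight x2) x1 ik.
  rewrite bnd_simp => /(_ isT) H.
  rewrite -(@Rintegral_itv_obnd_cbnd R x1 (BRight x2) k).
    by rewrite -H ?bnd_simp // addrC subrK.
  apply: intble_sub ik => // y /=; rewrite !in_itv /= => /andP[_ ->] //.
by apply: complexP; rewrite ?(cReD, cImD) /=; exact: h.
Qed.

Lemma loop_diff (x1 x2 : R) F : x1 <= x2 -> loop_integrable x2 F ->
  loop_integral x2 F = loop_integral x1 F + rect_integral x1 x2 F.
Proof.
move=> x12 [i1 i2 i3]; rewrite /loop_integral /rect_integral.
rewrite (cintegral_split x12 i1) (cintegral_split x12 i3); ring.
Qed.

Lemma cintegrable_cont f (a b : R) : (forall t, a <= t <= b -> exists l, cderive f t l) ->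
  cintegrable `[a, b] f.
Proof.
move=> df.
have h (k : R -> R) : (forall t, a <= t <= b -> {for t, continuous k}) -> intble `[a, b] k.
  move=> ck; apply: continuous_compact_integrable; first exact: segment_compact.
  apply: continuous_in_subspaceT => t /set_mem /=; rewrite in_itv /=; exact: ck.
by split; apply: h => t /df [l /cderive_cont[]].
Qed.

Lemma cderive_hline b t : cderive (fun x : R => x +i* b) t 1.
Proof. by split => /=; [exact: is_derive_id|exact: is_derive_cst]. Qed.

Lemma cderive_vline a t : cderive (fun y : R => a +i* y) t (0 +i* 1).
Proof. by split => /=; [exact: is_derive_cst|exact: is_derive_id]. Qed.

(** By the fundamental theorem, the difference of the horizontal sides is i times the double
    integral of F' and that of the vertical sides is the double integral of F'; after Fubini the two
    contributions cancel. F'' makes F' continuous along lines, and M dominates it. *)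
Lemma rect_integral0 (x1 x2 M : R) F F' F'' : x1 < x2 -> cmeas2 F' ->
  (forall z, x1 <= Re z <= x2 -> -1 <= Im z <= 1 ->
     [/\ holo F F' z, holo F' F'' z & normc (F' z) <= M]) ->
  rect_integral x1 x2 F = 0.
Proof.
move=> x12 mF' hF.
have hol z : x1 <= Re z <= x2 -> -1 <= Im z <= 1 -> holo F F' z.
  by move=> a b; have [] := hF z a b.
have hol' z : x1 <= Re z <= x2 -> -1 <= Im z <= 1 -> holo F' F'' z.
  by move=> a b; have [] := hF z a b.
have N11 : (-1 : R) < 1 by lra.
have cy x : x1 <= x <= x2 -> F (x +i* 1) - F (x +i* -1) =
    (0 +i* 1) * cintegral `[-1, 1] (fun y => F' (x +i* y)).
  move=> xx; rewrite -cintegralZ //; last first.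
    apply: cintegrable_cont => t tt; eexists.
    exact: (hol' (x +i* t) xx tt _ _ _ erefl (cderive_vline _ _)).
  rewrite (@cFTC _ (fun y => F (x +i* y)) (fun y => (0 +i* 1) * F' (x +i* y)) (-1) 1) //.
    move=> t tt; apply: cderive_eq.
      exact: (hol (x +i* t) xx tt _ _ _ erefl (cderive_vline _ _)).
    exact: mulrC.
  move=> t tt; eexists; apply: cderiveM; first exact: cderive_cst.
  exact: (hol' (x +i* t) xx tt _ _ _ erefl (cderive_vline _ _)).
have cx y : -1 <= y <= 1 -> F (x2 +i* y) - F (x1 +i* y) =
    cintegral `[x1, x2] (fun x => F' (x +i* y)).
  move=> yy.
  rewrite (@cFTC _ (fun x => F (x +i* y)) (fun x => F' (x +i* y)) x1 x2) //.
    move=> t tt; apply: cderive_eq.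
      exact: (hol (t +i* y) tt yy _ _ _ erefl (cderive_hline _ _)).
    exact: mulr1.
  move=> t tt; eexists.
  exact: (hol' (t +i* y) tt yy _ _ _ erefl (cderive_hline _ _)).
have iF b : -1 <= b <= 1 -> cintegrable `[x1, x2] (fun x => F (x +i* b)).
  move=> bb; apply: cintegrable_cont => t tt; eexists.
  exact: (hol (t +i* b) tt bb _ _ _ erefl (cderive_hline _ _)).
have iG a : x1 <= a <= x2 -> cintegrable `[-1, 1] (fun y => F (a +i* y)).
  move=> aa; apply: cintegrable_cont => t tt; eexists.
  exact: (hol (a +i* t) aa tt _ _ _ erefl (cderive_vline _ _)).
have ii : intble `[x1, x2] (fun=> M).
  apply: (@intble_bounded _ _ _ `|M|) => //.
  by rewrite lebesgue_measure_itv /=; case: ifP => _; rewrite -?EFinB ltry.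
have M0 : 0 <= M.
  have [|//|_ _] := hF (x1 +i* 0); first by rewrite /= lexx ltW.
    by rewrite /=; lra.
  exact: le_trans (normc_ge0 _).
have [|j1 j2 e] := @cintegral_Fubini R `[x1, x2] `[-1, 1]
  (fun x y => F' (x +i* y)) (fun=> M) (fun=> 1)
  (measurable_itv _) (measurable_itv _) mF' (fun _ _ => M0) (fun _ _ => ler01) _ ii (intble_cst11 1).
  move=> x y /=; rewrite !in_itv /= mulr1 => xx yy.
  by have [] := hF (x +i* y) xx yy.
have E1 : cintegral `[x1, x2] (fun x => F (x +i* 1)) - cintegral `[x1, x2] (fun x => F (x +i* -1))
    = (0 +i* 1) * cintegral `[x1, x2] (fun x => cintegral `[-1, 1] (fun y => F' (x +i* y))).
  have i1 := iF 1 ltac:(lra); have i2 := iF (-1) ltac:(lra).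
  rewrite -(cintegralB (measurable_itv _) i1 i2) -(cintegralZ _ (measurable_itv _) j1).
  by apply: eq_cintegral => x /=; rewrite in_itv /=; exact: cy.
have E2 : cintegral `[-1, 1] (fun y => F (x2 +i* y)) - cintegral `[-1, 1] (fun y => F (x1 +i* y))
    = cintegral `[-1, 1] (fun y => cintegral `[x1, x2] (fun x => F' (x +i* y))).
  have i1 : cintegrable `[-1, 1] (fun y => F (x2 +i* y)) by apply: iG; rewrite lexx ltW.
  have i2 : cintegrable `[-1, 1] (fun y => F (x1 +i* y)) by apply: iG; rewrite lexx ltW.
  rewrite -(cintegralB (measurable_itv _) i1 i2).
  by apply: eq_cintegral => y /=; rewrite in_itv /=; exact: cx.
rewrite /rect_integral; move: E1 E2; rewrite e.
set a := cintegral _ _; set b := cintegral _ _; set c := cintegral _ _.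
set p := cintegral _ _; set q := cintegral _ _ => E1 E2.
transitivity (- (a - b) + (0 +i* 1) * (p - q)); first by rewrite /a /b /p /q; ring.
by rewrite E1 E2 addNr.
Qed.

Lemma loop_invariant (x1 x2 M : R) F F' F'' : x1 < x2 -> cmeas2 F' ->
  (forall z, x1 <= Re z <= x2 -> -1 <= Im z <= 1 ->
     [/\ holo F F' z, holo F' F'' z & normc (F' z) <= M]) ->
  loop_integrable x2 F -> loop_integral x2 F = loop_integral x1 F.
Proof.
move=> x12 mF' hF iF.
by rewrite (loop_diff (ltW x12) iF) (rect_integral0 x12 mF' hF) addr0.
Qed.

Lemma itvNy_bigcup (x0 : R) :
  `]-oo, x0]%classic = \bigcup_n [set` `[x0 - n.+1%:R, x0]].
Proof.
apply/seteqP; split => x /=; last by move=> [n _] /=; rewrite !in_itv /= => /andP[].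
rewrite in_itv /= => xx; exists (Num.truncn (x0 - x)) => //=.
by rewrite in_itv /= xx andbT lerBlDr -lerBlDl ltW //; exact: truncnS_gt.
Qed.

Lemma nondecreasing_itvN (x0 : R) : nondecreasing_seq (fun n => [set` `[x0 - n.+1%:R, x0]]).
Proof.
move=> m n mn; apply/subsetPset => x /=; rewrite !in_itv /= => /andP[xm ->].
by rewrite andbT (le_trans _ xm) // lerB // ler_nat ltnS.
Qed.

Lemma cvg_expRN c (x0 : R) : 0 < c -> expR (c * (x0 - n.+1%:R)) @[n --> \oo] --> (0 : R).
Proof.
move=> c0.
have -> : (fun n => expR (c * (x0 - n.+1%:R))) =
    (fun n => expR (c * (x0 - 1)) * (expR (- c)) ^+ n).
  apply/funext => n; rewrite -expRM_natl -expRD; congr expR.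
  by rewrite -natr1; ring.
rewrite -[X in _ --> X](mulr0 (expR (c * (x0 - 1)))).
apply: cvgM; first exact: cvg_cst.
apply: cvg_expr; rewrite ger0_norm ?expR_ge0 //.
by rewrite -expR0 ltr_expR oppr_lt0.
Qed.

(** Over [x0 - n - 1, x0] the integral is f(x0) - f(x0 - n - 1), and the exponential bound sends the
    second term to 0. *)
Lemma cFTC_Ny f f' (c K x0 : R) : 0 < c ->
  (forall t, t <= x0 -> cderive f t (f' t)) ->
  (forall t, t <= x0 -> exists l, cderive f' t l) ->
  (forall t, t <= x0 -> normc (f t) <= K * expR (c * t)) ->
  cintegrable `]-oo, x0] f' -> cintegral `]-oo, x0] f' = f x0.
Proof.
move=> c0 df df' fK [i1 i2].
have xn n : x0 - n.+1%:R < x0 by rewrite ltrBlDr ltrDl.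
have I n : cintegral `[x0 - n.+1%:R, x0] f' = f x0 - f (x0 - n.+1%:R).
  by apply: cFTC => // t /andP[_ tx]; [exact: df|exact: df'].
have h (k l : R -> R) : intble `]-oo, x0] k ->
    (forall n, \int[mu]_(x in `[x0 - n.+1%:R, x0]) k x = l x0 - l (x0 - n.+1%:R)) ->
    (forall t, t <= x0 -> `|l t| <= K * expR (c * t)) ->
    \int[mu]_(x in `]-oo, x0]) k x = l x0.
  rewrite itvNy_bigcup => ik Ik lK.
  have := cvg_Rintegral_bigcup (fun n => measurable_itv _) (@nondecreasing_itvN x0) ik.
  under eq_fun do rewrite Ik.
  have l0 : l (x0 - n.+1%:R) @[n --> \oo] --> (0 : R).
    apply/norm_cvg0P; apply: (@squeeze_cvgr _ _ _ _ (fun=> 0)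
        (fun n => K * expR (c * (x0 - n.+1%:R)))).
    - by apply: nearW => n; rewrite normr_ge0 /=; apply: lK; exact: ltW.
    - exact: cvg_cst.
    - by rewrite -[X in _ --> X](mulr0 K); apply: cvgM; [exact: cvg_cst|exact: cvg_expRN].
  move=> H; have H2 : l x0 - l (x0 - n.+1%:R) @[n --> \oo] --> l x0.
    by rewrite -[X in _ --> X]subr0; apply: cvgB => //; exact: cvg_cst.
  by rewrite -(cvg_lim _ H) // (cvg_lim _ H2).
apply: complexP => /=.
  apply: (h _ (fun t => Re (f t))) => //.
    by move=> n; have /(congr1 (@complex.Re R)) := I n; rewrite cReD cReN.
  by move=> t tx; exact: le_trans (Re_le_normc _) (fK t tx).
apply: (h _ (fun t => Im (f t))) => //.
  by move=> n; have /(congr1 (@complex.Im R)) := I n; rewrite cImD cImN.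
by move=> t tx; exact: le_trans (Im_le_normc _) (fK t tx).
Qed.

Lemma cderive_expRZ c t : cderive (fun x : R => (expR (c * x))%:C) t (c * expR (c * t))%:C.
Proof.
apply: cderive_real.
have d1 : is_derive t (1 : R) (fun x : R => c * x) c.
  refine (is_derive_eq (is_deriveMf (is_derive_cst c t 1) (is_derive_id t (1 : R))) _).
  by rewrite /cst /=; ring.
by refine (is_derive_eq (is_derive1_comp (is_derive_expR (c * t)) d1) _); exact: mulrC.
Qed.

Lemma continuous_expRZ c : continuous (fun x : R => expR (c * x)).
Proof. by move=> t; have /cderive_cont[] := cderive_expRZ c t. Qed.

Lemma intble_expNy c (x0 : R) : 0 < c -> intble `]-oo, x0] (fun x => expR (c * x)).
Proof.
move=> c0.
rewrite itvNy_bigcup; apply: (@ge0_intble_bigcup _ _ _ (expR (c * x0) / c)) => //.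
- exact: nondecreasing_itvN.
- apply: measurable_funTS; apply: continuous_measurable_fun; exact: continuous_expRZ.
move=> n; have xn : x0 - n.+1%:R < x0 by rewrite ltrBlDr ltrDl.
rewrite int_fin //; last first.
  apply: continuous_compact_integrable; first exact: segment_compact.
  by apply: continuous_subspaceT; exact: continuous_expRZ.
have d (t : R) : cderive (fun x : R => (c^-1)%:C * (expR (c * x))%:C) t (expR (c * t))%:C.
  apply: cderive_eq.
    exact: (cderiveM (cderive_cst _ t) (cderive_expRZ c t)).
  by rewrite mul0r addr0 -rmorphM mulrA mulVf ?mul1r // gt_eqF.
have := cFTC xn (fun t _ => d t) (fun t _ => ex_intro _ _ (cderive_expRZ c t)).
move=> /(congr1 (@complex.Re R)); rewrite cReD cReN -!rmorphM /= => ->.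
by rewrite lee_fin mulrC lerBlDr lerDl mulr_ge0 ?expR_ge0 // invr_ge0 ltW.
Qed.

Lemma int_expNy c (x0 : R) : 0 < c ->
  \int[mu]_(x in `]-oo, x0]) expR (c * x) = expR (c * x0) / c.
Proof.
move=> c0.
have d (t : R) : cderive (fun x : R => (c^-1)%:C * (expR (c * x))%:C) t (expR (c * t))%:C.
  apply: cderive_eq.
    exact: (cderiveM (cderive_cst _ t) (cderive_expRZ c t)).
  by rewrite mul0r addr0 -rmorphM mulrA mulVf ?mul1r // gt_eqF.
have /(congr1 (@complex.Re R)) : cintegral `]-oo, x0] (fun t => (expR (c * t))%:C) =
    (c^-1)%:C * (expR (c * x0))%:C.
  apply: (@cFTC_Ny (fun x => (c^-1)%:C * (expR (c * x))%:C) _ c c^-1) => //.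
  - by move=> t _; eexists; exact: cderive_expRZ.
  - move=> t _; rewrite -rmorphM normc_real ger0_norm //.
    by rewrite mulr_ge0 ?expR_ge0 // invr_ge0 ltW.
  - split => /=; first exact: intble_expNy.
    exact: (@integrable0 _ (measurableTypeR R) R mu).
by rewrite -rmorphM /= => ->; exact: mulrC.
Qed.

(** The three sides contribute F(x0 - i), F(x0 + i) - F(x0 - i) and - F(x0 + i). *)
Lemma loop_derivative0 (c K x0 : R) F F' F'' : 0 < c ->
  (forall z, Re z <= x0 -> -1 <= Im z <= 1 -> holo F F' z /\ holo F' F'' z) ->
  (forall z, on_loop x0 z -> normc (F z) <= K * expR (c * Re z)) ->
  loop_integrable x0 F' -> loop_integral x0 F' = 0.
Proof.
move=> c0 hF FK [i1 i2 i3]; rewrite /loop_integral.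
have N11 : (-1 : R) < 1 by lra.
have H b : -1 <= b <= 1 -> (forall x, x <= x0 -> on_loop x0 (x +i* b)) ->
    cintegrable `]-oo, x0] (fun x => F' (x +i* b)) ->
    cintegral `]-oo, x0] (fun x => F' (x +i* b)) = F (x0 +i* b).
  move=> bb lb ib.
  rewrite (@cFTC_Ny (fun x => F (x +i* b)) _ c K x0) //.
  - move=> t tx; have [h1 _] := hF (t +i* b) tx bb.
    by apply: cderive_eq; [exact: (h1 _ _ _ erefl (cderive_hline b t))|exact: mulr1].
  - move=> t tx; have [_ h2] := hF (t +i* b) tx bb; eexists.
    exact: (h2 _ _ _ erefl (cderive_hline b t)).
  - by move=> t tx; exact: FK (lb t tx).
rewrite (H (-1)) //; last 2 first.
- by lra.
- exact: on_loop_bot.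
rewrite (H 1) //; last 2 first.
- by lra.
- exact: on_loop_top.
rewrite -cintegralZ //.
rewrite (@cFTC _ (fun y => F (x0 +i* y)) (fun y => (0 +i* 1) * F' (x0 +i* y)) (-1) 1) //.
- ring.
- move=> t tt; have [h1 _] := hF (x0 +i* t) (lexx _) tt.
  by apply: cderive_eq; [exact: (h1 _ _ _ erefl (cderive_vline x0 t))|exact: mulrC].
move=> t tt; have [_ h2] := hF (x0 +i* t) (lexx _) tt; eexists.
exact: (cderiveM (cderive_cst _ t) (h2 _ _ _ erefl (cderive_vline x0 t))).
Qed.

End cauchy.

(** * The kernel e^(g V - u V^alpha - c z) with V = e^(- eta z) *)

Section exponential_growth.
Context {R : realType}.
Implicit Types (a k D kappa x v : R).

Lemma expR_dominates_linear k kappa : 0 < kappa ->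
  exists K, forall v, k * v <= kappa * expR v + K + 2 * `|k| * `|Num.min v 0|.
Proof.
move=> k0; pose m := `|k| + 1.
have m0 : 0 < m by rewrite ltr_wpDl.
(* The tangent of kappa e^v at v = L has slope m, so convexity gives kappa e^v >= m (1 + v - L). *)
pose L := ln (m / kappa).
have H v : m * v <= kappa * expR v + m * (L - 1).
  have -> : kappa * expR v = m * expR (v - L).
    by rewrite expRB lnK ?posrE ?divr_gt0 //; field; rewrite !gt_eqF.
  have := expR_ge1Dx (v - L); rewrite -(ler_pM2l m0) => h.
  by move: h; rewrite mulrDr mulrBr => h; lra.
exists (`|m * (L - 1)|) => v.
have hK := ler_norm (m * (L - 1)).
have := H v; have := ler_norm k; have := ler_norm (- k); rewrite normrN => h1 h2 h3.
have hm : m = `|k| + 1 by [].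
have E := expR_ge0 v.
have kE : 0 <= kappa * expR v by rewrite mulr_ge0 // ltW.
have [v0|v0] := leP v 0.
  rewrite (ler0_norm v0).
  have := normr_ge0 (m * (L - 1)); have := normr_ge0 k; nra.
rewrite normr0 mulr0 addr0.
have : k * v <= m * v by rewrite ler_pM2r // hm; lra.
lra.
Qed.

(** Up to the abscissa L the left side is at most m e^(alpha L); beyond L, kappa e^((1 - alpha) v)
    >= m. *)
Lemma expR_dominates_sublinear (alpha kappa D : R) : 0 < alpha < 1 -> 0 < kappa ->
  exists K, forall v, D * expR (alpha * v) <= kappa * expR v + K.
Proof.
move=> /andP[a0 a1] k0; pose m := `|D| + 1.
have m0 : 0 < m by rewrite ltr_wpDl.
pose L := ln (m / kappa) / (1 - alpha).
exists (m * expR (alpha * L)) => v.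
have Dm : D * expR (alpha * v) <= m * expR (alpha * v).
  by rewrite ler_pM2r ?expR_gt0 // (le_trans (ler_norm _)) // lerDl.
apply: (le_trans Dm); have [vL|Lv] := leP v L.
  rewrite -[leLHS]add0r lerD // ?mulr_ge0 ?expR_ge0 ?(ltW k0) //.
  by rewrite ler_pM2l // ler_expR ler_pM2l.
rewrite -[leLHS]addr0 lerD //; last by rewrite mulr_ge0 ?expR_ge0 ?(ltW m0).
have -> : v = alpha * v + (1 - alpha) * v by ring.
rewrite [in leRHS]expRD mulrA mulrAC [alpha * (_ + _)](_ : _ = alpha * v); last by ring.
rewrite ler_pM2r ?expR_gt0 // mulrC -ler_pdivrMr //.
rewrite -[leLHS]lnK ?posrE ?divr_gt0 // ler_expR.
have a1' : 0 < 1 - alpha by rewrite subr_gt0.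
by have := ltW Lv; rewrite /L ler_pdivrMr // [v * _]mulrC.
Qed.

(* The double exponential of the loop through the half-plane Re V < 0 beats
   every other factor of the integrands. *)
Lemma double_expR_bound (a alpha kappa D k x0 : R) : 0 < a -> 0 < alpha < 1 -> 0 < kappa ->
  exists K : R, 0 <= K /\ forall x, x <= x0 ->
    expR (- kappa * expR (- a * x) + D * expR (- (alpha * a) * x) + k * x) <= K.
Proof.
move=> a0 al k0.
(* One half of kappa e^v absorbs the linear term, the other the slower exponential; v = - a x is
   bounded below because x <= x0. *)
have k2 : 0 < kappa / 2 by rewrite divr_gt0.
have [K1 H1] := expR_dominates_linear (- k / a) k2.
have [K2 H2] := expR_dominates_sublinear D al k2.
pose W := 2 * `|- k / a| * `|a * x0|.
exists (expR (K1 + K2 + W)); split; first exact: expR_ge0.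
move=> x xx; rewrite ler_expR.
have h1 := H1 (- a * x); have h2 := H2 (- a * x).
have e1 : - k / a * (- a * x) = k * x by field; rewrite gt_eqF.
have e2 : alpha * (- a * x) = - (alpha * a) * x by ring.
rewrite e1 in h1; rewrite e2 in h2.
have h3 : 2 * `|- k / a| * `|Num.min (- a * x) 0| <= W.
  rewrite /W ler_wpM2l ?mulr_ge0 //.
  have [v0|v0] := leP (- a * x) 0; last by rewrite normr0.
  rewrite ler0_norm // mulNr opprK (le_trans _ (ler_norm _)) //.
  by rewrite ler_pM2l.
lra.
Qed.

End exponential_growth.

Section contour_functions.
Context {R : realType}.
Variables alpha eta : R.
Hypotheses (alpha01 : 0 < alpha < 1) (eta_gt : pi / 2 < eta) (eta_lt : eta < pi)
  (alphaeta : alpha * eta < pi / 2).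
Implicit Types (z w c : R[i]) (g u x y : R).

(** The horizontal sides Im z = -1 and Im z = 1 are sent to the rays of argument eta and - eta, so
    the loop is Hankel's contour in a logarithmic coordinate. *)
Definition Vexp z : R[i] := cexp (- eta%:C * z).
Definition Vaexp z : R[i] := cexp (- (alpha * eta)%:C * z).
Definition fox_phase g u c z : R[i] := g%:C * Vexp z - u%:C * Vaexp z - c * z.
Definition fox_kernel g u c z : R[i] := cexp (fox_phase g u c z).
Definition fox_kernel1 g u c z : R[i] := fox_kernel g u c z *
  (- (eta * g)%:C * Vexp z + (alpha * eta * u)%:C * Vaexp z - c).
Definition kappa : R := - cos eta.

Lemma eta_gt0 : 0 < eta.
Proof. by apply: lt_trans eta_gt; rewrite divr_gt0 // pi_gt0. Qed.

Lemma kappa_gt0 : 0 < kappa.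
Proof.
have h : cos eta = - sin (eta - pi / 2).
  by rewrite -[in LHS](subrK (pi / 2) eta) cosDpihalf.
rewrite /kappa h opprK sin_gt0_pihalf // subr_gt0 eta_gt /= ltrBlDr.
by apply: (lt_le_trans eta_lt); lra.
Qed.

Lemma sin_eta_gt0 : 0 < sin eta.
Proof. by rewrite sin_gt0_pi // eta_gt0. Qed.

Lemma Re_V z : Re (Vexp z) = expR (- eta * Re z) * cos (eta * Im z).
Proof.
rewrite /Vexp Re_cexp !(cReM, cImM, cReN, cImN) /=.
by rewrite oppr0 !mul0r subr0 addr0 mulNr [- _ * Im z]mulNr cosN.
Qed.

Lemma Im_V z : Im (Vexp z) = - (expR (- eta * Re z) * sin (eta * Im z)).
Proof.
rewrite /Vexp Im_cexp !(cReM, cImM, cReN, cImN) /=.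
by rewrite oppr0 !mul0r subr0 addr0 mulNr [- _ * Im z]mulNr sinN mulrN.
Qed.

Lemma normc_V z : normc (Vexp z) = expR (- eta * Re z).
Proof. by rewrite normc_cexp !(cReM, cReN, cImN) /= oppr0 mul0r subr0. Qed.

Lemma normc_Va z : normc (Vaexp z) = expR (- (alpha * eta) * Re z).
Proof. by rewrite normc_cexp !(cReM, cReN, cImN) /= oppr0 mul0r subr0. Qed.

(** On the whole strip the argument of V^alpha is at most alpha eta < pi / 2 in absolute value.
    Hence the term - u V^alpha with u >= 0 never increases the modulus of the kernel. *)
Lemma Re_Va_ge0 z : `|Im z| <= 1 -> 0 <= Re (Vaexp z).
Proof.
move=> z1; rewrite /Vaexp Re_cexp mulr_ge0 ?expR_ge0 //.
have e0 := eta_gt0; case/andP: alpha01 => a0 a1.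
have ae0 : 0 < alpha * eta by rewrite mulr_gt0.
rewrite !(cImM, cReN, cImN) /= oppr0 mul0r addr0.
move: z1; rewrite ler_norml => /andP[z1 z2].
move: ae0 alphaeta; move: (alpha * eta) (Im z) z1 z2 => b y y1 y2 b0 bp.
by apply: cos_ge0_pihalf; apply/andP; split; nra.
Qed.

Lemma Re_V_ray z : `|Im z| = 1 -> Re (Vexp z) = - kappa * expR (- eta * Re z).
Proof.
move=> zi; rewrite Re_V /kappa opprK mulrC; congr (_ * _).
have [h|h] := leP 0 (Im z).
  by move: zi; rewrite ger0_norm // => ->; rewrite mulr1.
by move: zi; rewrite ltr0_norm // => /(congr1 -%R); rewrite opprK => ->; rewrite mulrN1 cosN.
Qed.

(** On the rays Re V = - kappa |V|. On the right side only Re V <= |V| = e^(- eta x0) is available,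
    and the added constant makes up for the difference. *)
Lemma Re_V_loop x0 z : on_loop x0 z ->
  Re (Vexp z) <= - kappa * expR (- eta * Re z) + (1 + kappa) * expR (- eta * x0).
Proof.
move=> [zx z1 [zx0|zi]]; rewrite Re_V.
  have E := expR_gt0 (- eta * x0); rewrite zx0.
  have := cos_le1 (eta * Im z); rewrite -(ler_pM2l E) mulr1; lra.
have := Re_V_ray zi; rewrite Re_V => ->; rewrite lerDl mulr_ge0 ?expR_ge0 //.
by have := cos_le1 eta; rewrite /kappa; lra.
Qed.

Lemma holo_V z : holo Vexp (fun z => - eta%:C * Vexp z) z.
Proof.
move=> f t l ft fl; apply: cderive_eq.
  exact: (holo_cexp (holoM (holo_cst (- eta%:C) z) (holo_id z)) _ _ _ ft fl).
by rewrite /Vexp /=; ring.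
Qed.

Lemma holo_Va z : holo Vaexp (fun z => - (alpha * eta)%:C * Vaexp z) z.
Proof.
move=> f t l ft fl; apply: cderive_eq.
  exact: (holo_cexp (holoM (holo_cst (- (alpha * eta)%:C) z) (holo_id z)) _ _ _ ft fl).
by rewrite /Vaexp /=; ring.
Qed.

Lemma eq_holo (H G G' : R[i] -> R[i]) z : G z = G' z -> holo H G z -> holo H G' z.
Proof. by move=> e h f t l ft fl; rewrite -e; exact: h. Qed.

Lemma holo_F g u c z : holo (fox_kernel g u c) (fox_kernel1 g u c) z.
Proof.
apply: eq_holo; last first.
  exact: (holo_cexp (holoD (holoD (holoM (holo_cst g%:C z) (@holo_V z))
    (holoN (holoM (holo_cst u%:C z) (@holo_Va z)))) (holoN (holoM (holo_cst c z) (holo_id z))))).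
by rewrite /fox_kernel1 /fox_kernel /fox_phase /= !rmorphM /=; ring.
Qed.

Definition fox_kernel2 g u c z : R[i] :=
  fox_kernel g u c z * ((eta * eta * g)%:C * Vexp z - (alpha * eta * (alpha * eta) * u)%:C * Vaexp z)
  + fox_kernel1 g u c z * (- (eta * g)%:C * Vexp z + (alpha * eta * u)%:C * Vaexp z - c).

Lemma holo_F1 g u c z : holo (fox_kernel1 g u c) (fox_kernel2 g u c) z.
Proof.
apply: eq_holo; last first.
  exact: (holoM (@holo_F g u c z) (holoD (holoD (holoM (holo_cst (- (eta * g)%:C) z) (@holo_V z))
    (holoM (holo_cst (alpha * eta * u)%:C z) (@holo_Va z))) (holo_cst (- c) z))).
by rewrite /fox_kernel2 /= !rmorphM /=; ring.
Qed.

Section measurability.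
Context d (T : measurableType d).
Variables (zz cc : T -> R[i]) (gg uu : T -> R).
Hypotheses (mz : cmeas setT zz) (mc : cmeas setT cc)
  (mg : measurable_fun setT gg) (mu : measurable_fun setT uu).

Lemma cmeas_V : cmeas setT (fun t => Vexp (zz t)).
Proof. by apply: cmeas_cexp; apply: cmeasM => //; exact: cmeas_cst. Qed.

Lemma cmeas_F : cmeas setT (fun t => fox_kernel (gg t) (uu t) (cc t) (zz t)).
Proof.
apply: cmeas_cexp; apply: cmeasD; last by apply: cmeasN; exact: cmeasM.
apply: cmeasD; first by apply: cmeasM; [exact: cmeas_real|exact: cmeas_V].
apply: cmeasN; apply: cmeasM; first exact: cmeas_real.
by apply: cmeas_cexp; apply: cmeasM => //; exact: cmeas_cst.
Qed.

End measurability.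

Lemma cmeas_pair : cmeas setT (fun p : R * R => p.1 +i* p.2).
Proof. by split => /=; [exact: measurable_fst|exact: measurable_snd]. Qed.

Lemma cmeas2V : cmeas2 Vexp.
Proof. exact: cmeas_V cmeas_pair. Qed.

Lemma cmeas2F g u c : cmeas2 (fox_kernel g u c).
Proof.
exact: (cmeas_F cmeas_pair (cmeas_cst _ c) (measurable_cst g) (measurable_cst u)).
Qed.

Lemma cmeas2F1 g u c : cmeas2 (fox_kernel1 g u c).
Proof.
apply: cmeasM (cmeas2F g u c) _; apply: cmeasD (cmeas_cst _ _).
apply: cmeasD; apply: cmeasM (cmeas_cst _ _) _; first exact: cmeas2V.
by apply: cmeas_cexp; apply: cmeasM cmeas_pair; exact: cmeas_cst.
Qed.

Lemma F1_bounded g u c x1 x2 : exists M : R, forall z, x1 <= Re z <= x2 -> -1 <= Im z <= 1 ->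
  normc (fox_kernel g u c z) <= M /\ normc (fox_kernel1 g u c z) <= M.
Proof.
pose b1 := expR (- eta * x1); pose b2 := expR (- (alpha * eta) * x1).
pose B := `|g| * b1 + `|u| * b2 + normc c * (`|x1| + `|x2| + 1).
pose B1 := `|eta * g| * b1 + `|alpha * eta * u| * b2 + normc c.
have e0 := eta_gt0; case/andP: alpha01 => a0 a1.
have ae0 : 0 < alpha * eta by rewrite mulr_gt0.
exists (expR B * (1 + B1)) => z /andP[z1 z2] /andP[y1 y2].
have v1 : normc (Vexp z) <= b1 by rewrite normc_V ler_expR !mulNr lerN2 ler_pM2l.
have v2 : normc (Vaexp z) <= b2 by rewrite normc_Va ler_expR !mulNr lerN2 ler_pM2l.
have nz : normc z <= `|x1| + `|x2| + 1.
  apply: (le_trans (normc_le_ReIm z)); apply: lerD; last by rewrite ler_norml y1 y2.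
  rewrite ler_norml; apply/andP; split.
    rewrite lerNl (le_trans (_ : _ <= - x1)) ?lerN2 //.
    by rewrite (le_trans (ler_norm _)) // normrN lerDl.
  by rewrite (le_trans z2) // (le_trans (ler_norm _)) // lerDr.
have nP : normc (fox_phase g u c z) <= B.
  apply: (le_trans (normc_triangle _ _)); apply: lerD.
    apply: (le_trans (normc_triangle _ _)); apply: lerD.
      by rewrite normcM normc_real ler_wpM2l.
    by rewrite normcN normcM normc_real ler_wpM2l.
  by rewrite normcN normcM ler_wpM2l ?normc_ge0.
have nF : normc (fox_kernel g u c z) <= expR B.
  by rewrite normc_cexp ler_expR (le_trans _ nP) // (le_trans (ler_norm _)) // Re_le_normc.
have B1_ge0 : 0 <= B1.
  by rewrite !addr_ge0 ?mulr_ge0 ?normr_ge0 ?expR_ge0 ?normc_ge0.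
split; first by rewrite (le_trans nF) // ler_peMr ?expR_ge0 // lerDl.
rewrite normcM ler_pM ?normc_ge0 // (@le_trans _ _ B1) //; last by rewrite lerDr.
apply: (le_trans (normc_triangle _ _)); rewrite normcN lerD //.
apply: (le_trans (normc_triangle _ _)); rewrite lerD //.
  by rewrite normcM normcN normc_real ler_wpM2l.
by rewrite normcM normc_real ler_wpM2l.
Qed.

End contour_functions.

(** * Residue at the origin *)

Section pole.
Context {R : realType}.
Variables alpha eta : R.
Hypotheses (alpha01 : 0 < alpha < 1) (eta_gt : pi / 2 < eta) (eta_lt : eta < pi)
  (alphaeta : alpha * eta < pi / 2).
Implicit Types (z w c : R[i]) (g u x y : R).
Local Notation V := (Vexp eta).
Local Notation Va := (Vaexp alpha eta).
Local Notation F := (fox_kernel alpha eta).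
Local Notation F1 := (fox_kernel1 alpha eta).
Local Notation F2 := (fox_kernel2 alpha eta).
Local Notation Fexp := (fox_phase alpha eta).
Local Notation kappa := (kappa eta).
Let eta0 := eta_gt0 eta_gt.
Let kappa0 := kappa_gt0 eta_gt eta_lt.
Let ae0 : 0 < alpha * eta. Proof. by case/andP: alpha01 => a0 _; rewrite mulr_gt0. Qed.

(** On the right side |V| is compared with 1; on the rays Re (1 - V) = 1 + kappa |V|. As |V| = e^(-
    eta Re z), the inverse of 1 - V decays like e^(eta Re z). *)
Lemma normc_1V_loop x0 (delta : R) z : delta <= kappa -> delta <= `|1 - expR (eta * x0)| ->
  on_loop x0 z -> delta * expR (- eta * Re z) <= normc (1 - V z).
Proof.
move=> dk dx [_ _ [zx|zi]].
  apply: le_trans (normc_sub _ _); rewrite normc1 normc_V zx distrC.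
  have -> : expR (- eta * x0) - 1 = expR (- eta * x0) * (1 - expR (eta * x0)).
    by rewrite mulrBr mulr1 -expRD -mulrDl addNr mul0r expR0.
  by rewrite normrM ger0_norm ?expR_ge0 // mulrC ler_wpM2l ?expR_ge0.
apply: le_trans (Re_le_normc _); apply: le_trans (ler_norm _).
rewrite cReD cReN cRe1 (Re_V_ray _ zi) [- kappa * _]mulNr opprK.
have := ler_wpM2r (expR_ge0 (- eta * Re z)) dk; lra.
Qed.

(** For x0 > 0 the right side lies in |V| < 1, so Re (1 - V) is bounded below on the whole loop.
    This makes e^(- g (1 - V)) integrable over g > 0, uniformly in z. *)
Lemma Re_1V_loop x0 (delta : R) z : 0 < x0 -> delta <= kappa -> 0 <= delta ->
  delta <= 1 - expR (- eta * x0) -> on_loop x0 z ->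
  delta * expR (- eta * Re z) <= Re (1 - V z) /\ delta <= Re (1 - V z).
Proof.
move=> x00 dk d0 dx [_ _ [zx|zi]].
  have h : 1 - expR (- eta * x0) <= Re (1 - V z).
    rewrite cReD cReN cRe1 lerD // lerN2 -zx -normc_V.
    exact: le_trans (ler_norm _) (Re_le_normc _).
  split; last exact: le_trans dx h.
  apply: le_trans h; apply: le_trans dx; rewrite zx ler_piMr //.
  by rewrite -expR0 ler_expR mulNr oppr_le0 ltW // mulr_gt0.
have E := expR_ge0 (- eta * Re z).
rewrite cReD cReN cRe1 (Re_V_ray _ zi) [- kappa * _]mulNr opprK; split.
  by have := ler_wpM2r E dk; lra.
rewrite (le_trans dx) // lerD2l (@le_trans _ _ 0) // ?oppr_le0 ?expR_ge0 //.
by rewrite mulr_ge0 // ltW.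
Qed.

(** This is t <= tan t: the mean value theorem gives sin t = t cos s with 0 < s < t. *)
Lemma sin_ge_cos (t : R) : 0 <= t <= pi / 2 -> t * cos t <= sin t.
Proof.
move=> /andP[t0 tp]; have [->|tn] := eqVneq t 0; first by rewrite mul0r sin0.
have t0' : 0 < t by rewrite lt_neqAle eq_sym tn.
have [] := @MVT R sin cos 0 t t0' (fun x _ => is_derive_sin x).
  by apply: continuous_subspaceT; exact: continuous_sin.
move=> s; rewrite in_itv /= => /andP[s0 st]; rewrite sin0 subr0 subr0 => ->.
have pp := @pi_gt0 R.
have i1 : s \in `[0, pi] by rewrite in_itv /=; apply/andP; split; lra.
have i2 : t \in `[0, pi] by rewrite in_itv /= t0; lra.
by rewrite mulrC ler_wpM2r // ltW // ltr_cos.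
Qed.

Lemma one_sub_expRN (t : R) : `|t| * expR (- `|t|) <= `|1 - expR (- t)|.
Proof.
have [t0|t0] := leP 0 t.
  have -> : `|t| = t by rewrite ger0_norm.
  apply: le_trans (ler_norm _).
  have := expR_ge1Dx t; have E := expR_gt0 (- t).
  rewrite -(ler_pM2r E) -expRD addrN expR0; lra.
have -> : `|t| = - t by rewrite ltr0_norm.
rewrite opprK distrC; apply: le_trans (ler_norm _).
have := expR_ge1Dx (- t); have := expR_ge0 t.
have : expR t <= 1 by rewrite expR_le1 ltW.
by move: (expR t) (expR (- t)) => a b; nra.
Qed.

(** The origin is a simple zero of 1 - V and, as eta < pi, its only zero in the square. The distance
    of |V| to 1 controls Re z, and the imaginary part, of size |V| |sin (eta Im z)|, controls Im
    z. *)
Lemma normc_1V_near0 : exists c : R, 0 < c /\ forall z, `|Re z| <= 1 -> `|Im z| <= 1 ->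
  c * normc z <= normc (1 - V z).
Proof.
pose C := cos (eta / 2).
have C0 : 0 < C by apply: cos_gt0_pihalf; have := eta_lt; have := eta0; lra.
pose c1 := eta * expR (- eta); pose c2 := expR (- eta) * (eta * C ^+ 2).
have c10 : 0 < c1 by rewrite mulr_gt0 // expR_gt0.
have c20 : 0 < c2 by rewrite !mulr_gt0 ?expR_gt0 // exprn_gt0.
exists (Num.min c1 c2 / 2); split; first by rewrite divr_gt0 // lt_min c10.
move=> z x1 y1.
have h1 : c1 * `|Re z| <= normc (1 - V z).
  apply: le_trans (normc_sub _ _); rewrite normc1 normc_V mulNr.
  apply: le_trans (one_sub_expRN _); rewrite normrM (gtr0_norm eta0) /c1 mulrAC.
  by rewrite ler_wpM2l ?mulr_ge0 ?(ltW eta0) // ler_expR lerN2 ger_pMr.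
have h2 : c2 * `|Im z| <= normc (1 - V z).
  apply: le_trans (Im_le_normc _); rewrite cImD cImN cIm1 Im_V add0r opprK.
  rewrite normrM ger0_norm ?expR_ge0 // /c2 -mulrA.
  apply: ler_pM; rewrite ?expR_ge0 ?mulr_ge0 ?exprn_ge0 ?(ltW eta0) ?(ltW C0) //.
    by rewrite ler_expR !mulNr lerN2 ger_pMr // (le_trans (ler_norm _)).
  have -> : `|sin (eta * Im z)| = `|sin (eta * `|Im z|)|.
    have [h|h] := leP 0 (Im z); first by rewrite (ger0_norm h).
    by rewrite (ltr0_norm h) mulrN sinN normrN.
  set y := `|Im z|; have y0 : 0 <= y by exact: normr_ge0.
  (* The half angle t stays below pi / 2 even when eta y exceeds it: sin 2t = 2 sin t cos t >= 2 t
     (cos t)^2 >= 2 t C^2. *)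
  pose t := eta * y / 2.
  have te : eta * y <= eta by rewrite ger_pMr.
  have t0 : 0 <= t by rewrite divr_ge0 // mulr_ge0 // ltW.
  have tle : t <= eta / 2 by rewrite ler_pM2r.
  have tC : C <= cos t.
    have [->//|tn] := eqVneq t (eta / 2).
    have pe := eta_lt; have pe0 := eta0.
    have i1 : t \in `[0, pi] by rewrite in_itv /= t0; lra.
    have i2 : eta / 2 \in `[0, pi] by rewrite in_itv /=; apply/andP; split; lra.
    by rewrite ltW // ltr_cos // lt_neqAle tn.
  have st : t * cos t <= sin t by apply: sin_ge_cos; have := eta_lt; lra.
  have -> : eta * y = t *+ 2 by rewrite /t -mulr_natr; field.
  rewrite sin_mulr2n; apply: le_trans (ler_norm _).
  have -> : eta * C ^+ 2 * y = (t * C ^+ 2) *+ 2 by rewrite /t -mulr_natr; field.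
  rewrite lerMn2r /= expr2.
  have a1 : t * C * C <= t * cos t * cos t by rewrite ler_pM // ?ler_wpM2l // ?mulr_ge0 // ltW.
  have a2 : t * cos t * cos t <= sin t * cos t by rewrite ler_wpM2r // (le_trans (ltW C0)).
  by rewrite mulrA [cos t * _]mulrC; exact: le_trans a1 a2.
apply: (le_trans (ler_wpM2l _ (normc_le_ReIm z))).
  by rewrite divr_ge0 // le_min (ltW c10) ltW.
have m1 : Num.min c1 c2 * `|Re z| <= normc (1 - V z).
  by apply: le_trans h1; rewrite ler_wpM2r // ge_min lexx.
have m2 : Num.min c1 c2 * `|Im z| <= normc (1 - V z).
  by apply: le_trans h2; rewrite ler_wpM2r // ge_min lexx orbT.
lra.
Qed.

(** e^z - 1 is the integral of z e^(t z) over [0, 1]; the factor 2 is that of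
    [normc_cintegral_le]. *)
Lemma normc_cexp_sub1 z : normc (cexp z - 1) <= 2 * normc z * expR (normc z).
Proof.
have dl t : cderive (fun x : R => cexp (x%:C * z)) t (cexp (t%:C * z) * z).
  apply: cderive_cexp; have := cderive_line 0 z t.
  by under eq_fun do rewrite add0r.
have := @cFTC R (fun x => cexp (x%:C * z)) (fun t => cexp (t%:C * z) * z) 0 1 ltr01
  (fun t _ => dl t).
rewrite mul0r cexp0 mul1r => <-; last first.
  by move=> t _; eexists; exact: (cderiveM (dl t) (cderive_cst z t)).
have -> : 2 * normc z * expR (normc z) =
    2 * \int[mu]_(x in `[0, 1]) (fun=> normc z * expR (normc z)) x.
  rewrite Rintegral_cst //= lebesgue_measure_itv /= lte_fin ltr01 /=.
  by rewrite subr0 mulr1 mulrA.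
apply: normc_cintegral_le => //.
- apply: cmeas_sub => //; apply: cmeasM (cmeas_cst _ _); apply: cmeas_cexp.
  by apply: cmeasM (cmeas_cst _ _); apply: cmeas_real.
- move=> t /=; rewrite in_itv /= => /andP[t0 t1].
  rewrite normcM normc_cexp mulrC ler_wpM2l ?normc_ge0 // ler_expR.
  rewrite cReM /= mul0r subr0 (le_trans _ (_ : t * normc z <= _)) //.
    by rewrite ler_wpM2l // (le_trans (ler_norm _)) // Re_le_normc.
  by rewrite ler_piMl ?normc_ge0.
apply: (@intble_bounded _ _ _ `|normc z * expR (normc z)|) => //.
by rewrite lebesgue_measure_itv /=; case: ifP => _; rewrite -?EFinB ltry.
Qed.

End pole.

Section bounded_convergence.
Context {R : realType}.

(** The exceptional ordinate is that of the pole, which vertical segments meet when they reach the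
    imaginary axis; a single point is negligible. *)
Lemma bounded_convergence_except0 (f_ : nat -> R -> R) (f : R -> R) (M : R) :
  (forall n, measurable_fun setT (f_ n)) -> measurable_fun setT f ->
  (forall y : R, -1 <= y <= 1 -> y != 0 -> f_ n y @[n --> \oo] --> f y) ->
  (forall n (y : R), -1 <= y <= 1 -> `|f_ n y| <= M) ->
  \int[mu]_(y in `[-1, 1]) f_ n y @[n --> \oo] --> \int[mu]_(y in `[-1, 1]) f y.
Proof.
move=> mf_ mf cf fM.
have mD : measurable ([set` `[(-1 : R), (1 : R)]] : set (measurableTypeR R)) by exact: measurable_itv.
have [] := @dominated_convergence _ (measurableTypeR R) R mu _ mD (fun n => EFin \o f_ n)
  (EFin \o f) (fun=> M%:E).
- by move=> n; apply/measurable_EFinP; exact: (measurable_funTS (mf_ n)).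
- by apply/measurable_EFinP; exact: (measurable_funTS mf).
- exists [set 0]; split => //; first exact: lebesgue_measure_set1.
  move=> y /= /not_implyP[yD ncv]; apply/eqP; apply: contra_notT ncv => y0.
  by apply/cvg_EFin; [exact: nearW|apply: cf => //; move: yD; rewrite /= in_itv].
- exact: intble_cst11.
- by apply: aeW => y n /=; rewrite in_itv /= => yD; rewrite lee_fin fM.
move=> i1 _ H; apply: fine_cvg; move: H.
by rewrite /Rintegral fineK //; exact: (@integrable_fin_num _ (measurableTypeR R) R mu).
Qed.

End bounded_convergence.

(** * Removal of the pole of 1 / (1 - V) at the origin *)

Section pole_removal.
Context {R : realType}.
Variables alpha eta : R.
Hypotheses (alpha01 : 0 < alpha < 1) (eta_gt : pi / 2 < eta) (eta_lt : eta < pi)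
  (alphaeta : alpha * eta < pi / 2).
Implicit Types (z w c : R[i]) (g u x y : R).
Local Notation V := (Vexp eta).
Local Notation Va := (Vaexp alpha eta).
Local Notation F := (fox_kernel alpha eta).
Local Notation F1 := (fox_kernel1 alpha eta).
Local Notation F2 := (fox_kernel2 alpha eta).
Local Notation Fexp := (fox_phase alpha eta).
Local Notation kappa := (kappa eta).
Let eta0 : 0 < eta := eta_gt0 eta_gt.
Let kappa0 : 0 < kappa := kappa_gt0 eta_gt eta_lt.
Let ae0 : 0 < alpha * eta. Proof. by case/andP: alpha01 => a0 _; rewrite mulr_gt0. Qed.

Lemma V0 : V 0 = 1. Proof. by rewrite /V mulr0 cexp0. Qed.
Lemma Va0 : Va 0 = 1. Proof. by rewrite /Va mulr0 cexp0. Qed.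
Lemma F00 u c : F 0 u c 0 = (expR (- u))%:C.
Proof. by rewrite /F /Fexp V0 Va0 mul0r sub0r mulr1 mulr0 subr0 -rmorphN cexp_real. Qed.

Lemma normc_F_le g u c z : 0 <= u -> `|Im z| <= 1 ->
  normc (F g u c z) <= expR (g * Re (V z)) * (expR (normc c) * expR (- Re c * Re z)).
Proof.
move=> u0 z1; rewrite normc_cexp -!expRD ler_expR /Fexp !cReD !cReN.
rewrite (cReZ g (V z)) (cReZ u (Va z)) (cReM c z).
have uV : 0 <= u * Re (Va z) by rewrite mulr_ge0 // (Re_Va_ge0 alpha01 eta_gt alphaeta).
have cI : Im c * Im z <= normc c.
  rewrite (le_trans (ler_norm _)) // normrM -[leRHS]mulr1 ler_pM //.
  exact: Im_le_normc.
by rewrite mulNr; lra.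
Qed.

Definition pole_inv z : R[i] := (1 - V z)^-1.
Definition pole_inv1 z : R[i] := - (eta%:C * V z) * (pole_inv z * pole_inv z).
Definition pole_inv2 z : R[i] :=
  - (eta%:C * V z) * (pole_inv z * pole_inv1 z + pole_inv1 z * pole_inv z)
  + eta%:C * (eta%:C * V z) * (pole_inv z * pole_inv z).

Lemma holo_pole_inv z : 1 - V z != 0 -> holo pole_inv pole_inv1 z.
Proof.
move=> z0; apply: eq_holo; last first.
  exact: (holoV (F := fun z => 1 - V z) z0 (holoD (holo_cst 1 z) (holoN (@holo_V _ eta z)))).
by rewrite /pole_inv1 /pole_inv /= expr2 invfM; ring.
Qed.

Lemma holo_pole_inv1 z : 1 - V z != 0 -> holo pole_inv1 pole_inv2 z.
Proof.
move=> z0; apply: eq_holo; last first.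
  apply: (holoM (holoN (holoM (holo_cst eta%:C z) (@holo_V _ eta z)))).
  exact: (holoM (holo_pole_inv z0) (holo_pole_inv z0)).
by rewrite /pole_inv2 /=; ring.
Qed.

Lemma cmeas2_pole_inv : cmeas2 pole_inv.
Proof.
apply: cmeasV; apply: cmeasD (cmeas_cst _ _) _; apply: cmeasN; exact: cmeas2V.
Qed.

Variables (u : R) (c : R[i]).
Hypotheses (u0 : 0 <= u) (cEta : Re c < eta).

Definition pole_num z : R[i] := F 0 u c z - F 0 u c 0.
(** The numerator vanishes at the simple zero of 1 - V, so the singularity is removable. At 0 itself
    the value is 0 by the convention on inverses, whatever the limit is. *)
Definition pole_rem z : R[i] := pole_num z * pole_inv z.
Definition pole_rem1 z : R[i] := pole_num z * pole_inv1 z + F1 0 u c z * pole_inv z.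
Definition pole_rem2 z : R[i] :=
  (pole_num z * pole_inv2 z + F1 0 u c z * pole_inv1 z)
  + (F1 0 u c z * pole_inv1 z + F2 0 u c z * pole_inv z).

Lemma holo_pole_num z : holo pole_num (F1 0 u c) z.
Proof.
apply: eq_holo; last exact: (holoD (@holo_F _ alpha eta 0 u c z) (holo_cst (- F 0 u c 0) z)).
by rewrite /= addr0.
Qed.

Lemma holo_pole_rem z : 1 - V z != 0 ->
  holo pole_rem pole_rem1 z /\ holo pole_rem1 pole_rem2 z.
Proof.
move=> z0; split; first exact: (holoM (@holo_pole_num z) (holo_pole_inv z0)).
exact: (holoD (holoM (@holo_pole_num z) (holo_pole_inv1 z0))
  (holoM (@holo_F1 _ alpha eta 0 u c z) (holo_pole_inv z0))).
Qed.

Lemma cmeas2_pole_num : cmeas2 pole_num.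
Proof. by apply: cmeasD; [exact: cmeas2F|exact: cmeas_cst]. Qed.

Lemma cmeas2_pole_rem : cmeas2 pole_rem.
Proof. exact: cmeasM cmeas2_pole_num cmeas2_pole_inv. Qed.

Lemma cmeas2_pole_rem1 : cmeas2 pole_rem1.
Proof.
apply: cmeasD; last by apply: cmeasM (cmeas2_pole_inv); exact: cmeas2F1.
apply: cmeasM cmeas2_pole_num _; apply: cmeasM.
  by apply: cmeasN; apply: cmeasM (cmeas_cst _ _) _; exact: cmeas2V.
exact: cmeasM cmeas2_pole_inv cmeas2_pole_inv.
Qed.

Let G x := expR (normc c) * expR ((eta - Re c) * x) + expR (eta * x).

(** The numerator is at most a multiple of e^(- Re c Re z) plus 1, and the inverse of 1 - V decays
    like e^(eta Re z); Re c < eta makes the product integrable at -oo. *)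
Lemma normc_pole_rem_loop x0 (delta : R) z : 0 < delta -> delta <= kappa ->
  delta <= `|1 - expR (eta * x0)| -> on_loop x0 z ->
  normc (pole_rem z) <= delta^-1 * G (Re z).
Proof.
move=> d0 dk dx zl; have h := normc_1V_loop dk dx zl.
have E := expR_gt0 (- eta * Re z).
have [_ z1 _] := zl.
rewrite /pole_rem normcM Normc.normcV mulrC.
have h2 : (normc (1 - V z))^-1 <= delta^-1 * expR (eta * Re z).
  have dE0 := mulr_gt0 d0 E; have n0 := lt_le_trans dE0 h.
  have -> : delta^-1 * expR (eta * Re z) = (delta * expR (- eta * Re z))^-1.
    by rewrite invfM -expRN mulNr opprK.
  by rewrite lef_pV2 ?posrE.
have h3 : normc (pole_num z) <= expR (normc c) * expR (- Re c * Re z) + 1.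
  apply: (le_trans (normc_triangle _ _)); rewrite normcN F00 normc_real ger0_norm ?expR_ge0 //.
  apply: lerD; last by rewrite expR_le1 oppr_le0.
  by have := normc_F_le 0 c u0 z1; rewrite mul0r expR0 mul1r.
apply: (le_trans (ler_pM _ _ h2 h3)); rewrite ?invr_ge0 ?normc_ge0 //.
rewrite -mulrA ler_pM2l ?invr_gt0 // mulrDr mulr1 mulrCA -expRD /G.
by rewrite mulrBl mulNr.
Qed.

Lemma intble_G x0 : intble `]-oo, x0] G.
Proof.
apply: intbleD => //; last exact: intble_expNy.
by apply: intbleMl => //; apply: intble_expNy; rewrite subr_gt0.
Qed.

Lemma pole_delta x0 : x0 != 0 ->
  exists delta, [/\ 0 < delta, delta <= kappa & delta <= `|1 - expR (eta * x0)|].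
Proof.
move=> x00; exists (Num.min kappa `|1 - expR (eta * x0)|).
rewrite ge_min lexx ge_min lexx orbT lt_min kappa0 normr_gt0; split => //=.
rewrite subr_eq0 -expR0; apply: contra x00 => /eqP/expR_inj/esym/eqP.
by rewrite mulf_eq0 gt_eqF.
Qed.

Lemma pole_rem_integrable x0 : x0 != 0 -> loop_integrable x0 pole_rem.
Proof.
move=> /pole_delta[delta [d0 dk dx]].
apply: (@loop_dom _ x0 _ (fun x => delta^-1 * G x) cmeas2_pole_rem).
  by move=> z; exact: normc_pole_rem_loop.
by apply: intbleMl => //; exact: intble_G.
Qed.

(** Between two loops on the same side of the imaginary axis |V| stays away from 1, so 1 - V is
    bounded away from 0 and Cauchy's theorem applies. *)
Lemma pole_rem_invariant x1 x2 : x1 < x2 -> 0 < x1 \/ x2 < 0 ->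
  loop_integral x2 pole_rem = loop_integral x1 pole_rem.
Proof.
move=> x12 xs.
have [d [d0 hd]] : exists d, 0 < d /\ forall z, x1 <= Re z <= x2 -> d <= normc (1 - V z).
  case: xs => [x10|x20].
    exists (1 - expR (- eta * x1)); split.
      by rewrite subr_gt0 expR_lt1 mulNr oppr_lt0 mulr_gt0.
    move=> z /andP[z1 z2]; apply: le_trans (normc_sub _ _); rewrite normc1 normc_V.
    apply: le_trans (ler_norm _); rewrite lerD2l lerN2 ler_expR !mulNr lerN2.
    by rewrite ler_pM2l.
  exists (expR (- eta * x2) - 1); split.
    by rewrite subr_gt0 expR_gt1 mulNr oppr_gt0 pmulr_rlt0.
  move=> z /andP[z1 z2]; apply: le_trans (normc_sub _ _); rewrite normc1 normc_V distrC.
  apply: le_trans (ler_norm _); rewrite lerD2r ler_expR !mulNr lerN2.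
  by rewrite ler_pM2l.
have [M hM] := F1_bounded alpha01 eta_gt 0 u c x1 x2.
pose b := expR (- eta * x1).
apply: (@loop_invariant _ x1 x2 ((M + 1) * (eta * b * (d^-1 * d^-1)) + M * d^-1)
  pole_rem pole_rem1 pole_rem2 x12 cmeas2_pole_rem1); last first.
  apply: pole_rem_integrable; case: xs => h; last by rewrite lt_eqF.
  by rewrite gt_eqF // (lt_trans h).
move=> z zx zy.
have z0 : 1 - V z != 0.
  apply/eqP => e; have := hd z zx; rewrite e normc0; lra.
have [h1 h2] := holo_pole_rem z0; split => //.
have [MF MF1] := hM z zx zy.
have hI : normc (pole_inv z) <= d^-1.
  rewrite /pole_inv Normc.normcV lef_pV2 ?posrE //; first exact: hd.
  exact: lt_le_trans (hd z zx).
have hV : normc (V z) <= b.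
  by rewrite normc_V ler_expR !mulNr lerN2 ler_pM2l //; case/andP: zx.
have hI1 : normc (pole_inv1 z) <= eta * b * (d^-1 * d^-1).
  rewrite /pole_inv1 !normcM normcN normcM normc_real (gtr0_norm eta0).
  by rewrite !ler_pM ?mulr_ge0 ?normc_ge0 ?(ltW eta0).
have hN : normc (pole_num z) <= M + 1.
  apply: (le_trans (normc_triangle _ _)); rewrite lerD // normcN F00 normc_real.
  by rewrite ger0_norm ?expR_ge0 // expR_le1 oppr_le0.
apply: (le_trans (normc_triangle _ _)).
rewrite (normcM (pole_num z) (pole_inv1 z)) (normcM (F1 0 u c z) (pole_inv z)).
by apply: lerD; apply: ler_pM; rewrite ?normc_ge0.
Qed.

(** The numerator is O(|z|) by [normc_cexp_sub1], the denominator is at least k |z|. *)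
Lemma normc_pole_rem_near0 : exists B, forall z, `|Re z| <= 1 -> `|Im z| <= 1 -> z != 0 ->
  normc (pole_rem z) <= B.
Proof.
have [k [k0 hk]] := normc_1V_near0 eta_gt eta_lt.
pose C1 := u * (2 * (alpha * eta) * expR (alpha * eta * 2)) + normc c.
have C10 : 0 <= C1.
  apply: addr_ge0; last exact: normc_ge0.
  by rewrite mulr_ge0 // mulr_ge0 ?expR_ge0 // mulr_ge0 // ltW.
exists (2 * C1 * expR (C1 * 2) / k) => z z1 z2 z0.
have nz := normc_gt0 z0.
have nz2 : normc z <= 2 by rewrite (le_trans (normc_le_ReIm z)) //; lra.
have hVa : normc (Va z - 1) <= 2 * (alpha * eta) * expR (alpha * eta * 2) * normc z.
  apply: (le_trans (normc_cexp_sub1 _)); rewrite normcM normcN normc_real (gtr0_norm ae0).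
  have : expR (alpha * eta * normc z) <= expR (alpha * eta * 2) by rewrite ler_expR ler_pM2l.
  have : 0 <= 2 * (alpha * eta * normc z) by rewrite mulr_ge0 // mulr_ge0 ?normc_ge0 // ltW.
  move=> p /(ler_wpM2l p)/le_trans; apply.
  by rewrite le_eqVlt; apply/orP; left; apply/eqP; ring.
have dP : Fexp 0 u c z - Fexp 0 u c 0 = - (u%:C * (Va z - 1)) - c * z.
  by rewrite /Fexp Va0; ring.
have nP : normc (Fexp 0 u c z - Fexp 0 u c 0) <= C1 * normc z.
  rewrite dP; apply: (le_trans (normc_triangle _ _)); rewrite !normcN !normcM normc_real.
  by rewrite ger0_norm // /C1 mulrDl lerD // -mulrA ler_wpM2l.
have eN : pole_num z = (cexp (Fexp 0 u c z - Fexp 0 u c 0) - 1) * F 0 u c 0.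
  by rewrite mulrBl mul1r -cexpD subrK.
have nN : normc (pole_num z) <= 2 * C1 * expR (C1 * 2) * normc z.
  rewrite eN normcM F00 normc_real ger0_norm ?expR_ge0 //.
  apply: (@le_trans _ _ (normc (cexp (Fexp 0 u c z - Fexp 0 u c 0) - 1))).
    by rewrite ler_piMr ?normc_ge0 // expR_le1 oppr_le0.
  apply: (le_trans (normc_cexp_sub1 _)).
  rewrite [leRHS](_ : _ = 2 * (C1 * normc z) * expR (C1 * 2)); last by ring.
  apply: ler_pM; rewrite ?mulr_ge0 ?normc_ge0 ?expR_ge0 ?ler_pM2l //.
  rewrite ler_expR; apply: (le_trans nP); exact: ler_wpM2l.
rewrite /pole_rem normcM Normc.normcV ler_pdivrMr; last first.
  by apply: lt_le_trans (hk z z1 z2); rewrite mulr_gt0.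
have A0 : 0 <= 2 * C1 * expR (C1 * 2) / k.
  by rewrite divr_ge0 ?(ltW k0) // mulr_ge0 ?expR_ge0 // mulr_ge0.
apply: (le_trans nN); apply: le_trans (ler_wpM2l A0 (hk z z1 z2)).
by rewrite le_eqVlt; apply/orP; left; apply/eqP; field; rewrite gt_eqF.
Qed.

Let dn (n : nat) : R := n.+1%:R^-1.

Let dn0 n : 0 < dn n. Proof. by rewrite invr_gt0. Qed.
Let dn1 n : dn n <= 1. Proof. by rewrite invf_le1 // ler1n. Qed.

(** This plays the role of the removable singularity theorem. The horizontal sides have length
    tending to 0 under a bounded integrand; the two vertical sides tend to the same integral along
    the imaginary axis and cancel. *)
Lemma pole_rem_rect_cvg : normc (rect_integral (- dn n) (dn n) pole_rem) @[n --> \oo] --> (0 : R).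
Proof.
have [B hB] := normc_pole_rem_near0.
have m2 := cmeas2_pole_rem.
have dcv : dn n @[n --> \oo] --> (0 : R) by exact: cvg_harmonic.
have nz b (x : R) : b != 0 -> x +i* b != 0 by move=> b0; rewrite eq_complex /= negb_and b0 orbT.
have nzx (x b : R) : x != 0 -> x +i* b != 0 by move=> x0; rewrite eq_complex /= negb_and x0.
have B0 : 0 <= B.
  apply: le_trans (normc_ge0 (pole_rem (1 +i* 0))) _.
  by apply: hB; rewrite /= ?normr1 ?normr0 // nzx // oner_eq0.
have hor b n : `|b| = 1 -> normc (cintegral `[- dn n, dn n] (fun x => pole_rem (x +i* b))) <= 4 * B * dn n.
  move=> b1.
  have dd : - dn n < dn n by have := dn0 n; lra.
  have -> : 4 * B * dn n = 2 * \int[mu]_(x in `[- dn n, dn n]) (fun=> B) x.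
    by rewrite Rintegral_cst //= lebesgue_measure_itv /= lte_fin dd /=; ring.
  apply: normc_cintegral_le => //; first by apply: cmeas_sub => //; exact: cmeas_hline.
    move=> x /=; rewrite in_itv /= => /andP[x1 x2]; apply: hB => //=.
    - by rewrite ler_norml; have := dn1 n; lra.
    - by rewrite b1.
    - by apply: nz; rewrite -normr_gt0 b1.
  apply: (@intble_bounded _ _ _ `|B|) => //.
  by rewrite lebesgue_measure_itv /=; case: ifP => _; rewrite -?EFinB ltry.
have ver (s : nat -> R) : (forall n, s n != 0) -> (forall n, `|s n| <= 1) ->
    s n @[n --> \oo] --> (0 : R) ->
    (\int[mu]_(y in `[-1, 1]) Re (pole_rem (s n +i* y)) @[n --> \oo] -->
      \int[mu]_(y in `[-1, 1]) Re (pole_rem (0 +i* y))) /\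
    (\int[mu]_(y in `[-1, 1]) Im (pole_rem (s n +i* y)) @[n --> \oo] -->
      \int[mu]_(y in `[-1, 1]) Im (pole_rem (0 +i* y))).
  move=> s0 s1 scv.
  have cont (y : R) : -1 <= y <= 1 -> y != 0 ->
      {for 0, continuous (fun x => Re (pole_rem (x +i* y)))} /\
      {for 0, continuous (fun x => Im (pole_rem (x +i* y)))}.
    move=> y1 y0; have z0 : 1 - V (0 +i* y) != 0.
      have [k [k0 hk]] := normc_1V_near0 eta_gt eta_lt.
      apply/eqP => e; have := hk (0 +i* y).
      rewrite e normc0 /= normr0 ler01 ler_norml => /(_ isT y1); apply/negP; rewrite -ltNge.
      by rewrite mulr_gt0 // (normc_gt0 (nz _ 0 y0)).
    have [h _] := holo_pole_rem z0.
    exact: (cderive_cont (h _ _ _ erefl (cderive_hline y 0))).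
  have mv n := cmeas_vline (s n) m2.
  have mv0 := cmeas_vline 0 m2.
  split.
    apply: (@bounded_convergence_except0 _ _ _ B).
    - by move=> n; have [] := mv n.
    - by have [] := mv0.
    - by move=> y y1 y0; have [h _] := cont y y1 y0; exact: (cvg_comp _ _ scv h).
    - move=> n y y1; apply: (le_trans (Re_le_normc _)); apply: hB => //=.
        by rewrite ler_norml.
      exact: nzx.
  apply: (@bounded_convergence_except0 _ _ _ B).
  - by move=> n; have [] := mv n.
  - by have [] := mv0.
  - by move=> y y1 y0; have [_ h] := cont y y1 y0; exact: (cvg_comp _ _ scv h).
  - move=> n y y1; apply: (le_trans (Im_le_normc _)); apply: hB => //=.
      by rewrite ler_norml.
    exact: nzx.
have [r1 i1] := ver dn (fun n => lt0r_neq0 (dn0 n))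
  (fun n => ltac:(by rewrite (gtr0_norm (dn0 n)) dn1)) dcv.
have ncv : (- dn n) @[n --> \oo] --> (0 : R).
  by rewrite -[X in _ --> X]oppr0; exact: cvgN.
have [r2 i2] := ver (fun n => - dn n) (fun n => ltac:(by rewrite oppr_eq0 lt0r_neq0))
  (fun n => ltac:(by rewrite normrN (gtr0_norm (dn0 n)) dn1)) ncv.
pose D n := cintegral `[-1, 1] (fun y => pole_rem (dn n +i* y)) -
  cintegral `[-1, 1] (fun y => pole_rem (- dn n +i* y)).
have Dcv : `|Re (D n)| + `|Im (D n)| @[n --> \oo] --> (0 : R).
  have cR : Re (D n) @[n --> \oo] --> (0 : R).
    under eq_fun do rewrite cReD cReN.
    by rewrite -(subrr (\int[mu]_(y in `[-1, 1]) Re (pole_rem (0 +i* y)))); exact: cvgB.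
  have cI : Im (D n) @[n --> \oo] --> (0 : R).
    under eq_fun do rewrite cImD cImN.
    by rewrite -(subrr (\int[mu]_(y in `[-1, 1]) Im (pole_rem (0 +i* y)))); exact: cvgB.
  have n0 : `|0 : R| + `|0 : R| = 0 by rewrite normr0 addr0.
  by rewrite -[X in _ --> X]n0; apply: cvgD; apply: cvg_norm.
apply: (@squeeze_cvgr _ _ _ _ (fun=> 0)
  (fun n => 8 * B * dn n + (`|Re (D n)| + `|Im (D n)|))).
- apply: nearW => n; apply/andP; split; first exact: normc_ge0.
  have -> : rect_integral (- dn n) (dn n) pole_rem =
    cintegral `[- dn n, dn n] (fun x => pole_rem (x +i* -1)) +
    (- cintegral `[- dn n, dn n] (fun x => pole_rem (x +i* 1)) + (0 +i* 1) * D n).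
    by rewrite /rect_integral /D; ring.
  apply: (le_trans (normc_triangle _ _)).
  have hD : normc ((0 +i* 1) * D n) <= `|Re (D n)| + `|Im (D n)|.
    have n1 : normc (0 +i* 1 : R[i]) = 1 by rewrite /= expr0n expr1n add0r sqrtr1.
    by rewrite normcM n1 mul1r; exact: normc_le_ReIm.
  have h1 := hor (-1) n ltac:(by rewrite normrN normr1).
  have h2 := hor 1 n ltac:(by rewrite normr1).
  have := normc_triangle (- cintegral `[- dn n, dn n] (fun x => pole_rem (x +i* 1)))
    ((0 +i* 1) * D n).
  rewrite normcN; move: h1 h2 hD; lra.
- exact: cvg_cst.
rewrite -[X in _ --> X]addr0; apply: cvgD => //.
by rewrite -[X in _ --> X](mulr0 (8 * B)); apply: cvgM => //; exact: cvg_cst.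
Qed.

(** All loops to the right of the origin share one value, all loops to the left another. The thin
    rectangles around the origin identify the two, and loops moving off to -oo show that the common
    value is 0. *)
Lemma pole_rem_loop0 x0 : 0 < x0 -> loop_integral x0 pole_rem = 0.
Proof.
move=> x00.
pose A := loop_integral x0 pole_rem; pose B := loop_integral (-1) pole_rem.
have posl (x : R) : 0 < x -> loop_integral x pole_rem = A.
  move=> x1; have [xx|xx|->//] := ltgtP x x0.
    by rewrite /A (pole_rem_invariant xx) //; left.
  by rewrite /A (pole_rem_invariant xx) //; left.
have negl (x : R) : x < 0 -> loop_integral x pole_rem = B.
  move=> x1; have [xx|xx|->//] := ltgtP x (-1).
    by rewrite /B (pole_rem_invariant xx) //; right; lra.
  by rewrite /B (pole_rem_invariant xx) //; right.
have AB : A = B.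
  apply/eqP; rewrite -subr_eq0; apply/eqP/(@eq0_normc R).
  have E n : normc (rect_integral (- dn n) (dn n) pole_rem) = normc (A - B).
    have dd : - dn n <= dn n by have := dn0 n; lra.
    have := loop_diff dd (pole_rem_integrable (lt0r_neq0 (dn0 n))).
    rewrite posl // negl ?oppr_lt0 // => ->.
    by congr normc; rewrite addrC addKr.
  have := pole_rem_rect_cvg; under eq_fun do rewrite E.
  move=> h; have := cvg_cst (normc (A - B)); move=> /(_ _ \oo _) h2.
  exact: (cvg_unique _ h2 h).
have B0 : B = 0.
  apply/(@eq0_normc R).
  pose d := Num.min kappa (1 - expR (- eta)).
  have d0 : 0 < d by rewrite lt_min kappa0 subr_gt0 expR_lt1 oppr_lt0.
  have dk : d <= kappa by rewrite ge_min lexx.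
  have e0 : 0 < eta - Re c by rewrite subr_gt0.
  pose K1 := 4 * d^-1 * expR (normc c) * ((eta - Re c)^-1 + 1).
  pose K2 := 4 * d^-1 * (eta^-1 + 1).
  have le n : normc B <=
      K1 * expR ((eta - Re c) * (0 - n.+1%:R)) + K2 * expR (eta * (0 - n.+1%:R)).
    have xn : 0 - n.+1%:R < 0 :> R by rewrite sub0r oppr_lt0.
    have dx : d <= `|1 - expR (eta * (0 - n.+1%:R))|.
      apply: le_trans (ler_norm _); rewrite ge_min; apply/orP; right.
      by rewrite lerD2l lerN2 ler_expR sub0r mulrN lerN2 ler_peMr ?(ltW eta0) // ler1n.
    rewrite -(negl _ xn).
    apply: (le_trans (@normc_loop_le _ _ _ (fun x => d^-1 * G x) cmeas2_pole_rem _ _)).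
    - by move=> z; exact: normc_pole_rem_loop.
    - by apply: intbleMl => //; exact: intble_G.
    rewrite intMl //; last exact: intble_G.
    rewrite intD //; last 2 first.
    - by apply: intbleMl => //; exact: intble_expNy.
    - exact: intble_expNy.
    rewrite intMl //; last exact: intble_expNy.
    rewrite !int_expNy // /K1 /K2 /G.
    rewrite le_eqVlt; apply/orP; left; apply/eqP; ring.
  have cv : K1 * expR ((eta - Re c) * (0 - n.+1%:R)) + K2 * expR (eta * (0 - n.+1%:R))
      @[n --> \oo] --> (0 : R).
    have k0 : K1 * 0 + K2 * 0 = 0 :> R by rewrite !mulr0 addr0.
    rewrite -[X in _ --> X]k0; apply: cvgD; apply: cvgM; try exact: cvg_cst;
      exact: cvg_expRN.
  apply/eqP; rewrite eq_le normc_ge0 andbT.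
  rewrite -(cvg_lim _ cv) //; apply: limr_ge; first by apply/cvg_ex; exists 0.
  by apply: nearW => n; exact: le.
rewrite -[LHS]/A AB B0 //.
Qed.

End pole_removal.

(** * The Laplace transform of the kernel *)

Section half_line.
Context {R : realType}.

(** The index starts at 2 so that the endpoints are distinct for every n. *)
Definition itv0y (n : nat) : set R := [set` `[n.+2%:R^-1, n.+2%:R]].

Lemma itv0y_bigcup : `]0, +oo[%classic = \bigcup_n itv0y n.
Proof.
apply/seteqP; split => x /=; last first.
  move=> [n _]; rewrite /itv0y /= !in_itv /= andbT => /andP[h _].
  by apply: lt_le_trans h; rewrite invr_gt0.
rewrite in_itv /= andbT => x0.
have [n xn] : exists n, x <= n%:R by exists (Num.truncn x).+1; rewrite ltW // truncnS_gt.
have [m xm] : exists m, x^-1 <= m%:R by exists (Num.truncn x^-1).+1; rewrite ltW // truncnS_gt.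
exists (maxn n m) => //; rewrite /itv0y /= in_itv /=; apply/andP; split.
  rewrite invf_ple ?posrE // (le_trans xm) // ler_nat.
  by rewrite (leq_trans (leq_maxr n m)) // ltnW.
by rewrite (le_trans xn) // ler_nat (leq_trans (leq_maxl n m)) // ltnW.
Qed.

Lemma nondecreasing_itv0y : nondecreasing_seq itv0y.
Proof.
move=> m n mn; apply/subsetPset => x; rewrite /itv0y /= !in_itv /= => /andP[xm xM].
rewrite (le_trans _ xm) /= ?(le_trans xM) ?ler_nat ?ltnS //.
by rewrite lef_pV2 ?posrE // ler_nat !ltnS.
Qed.

Lemma itv0y_lt n : n.+2%:R^-1 < n.+2%:R :> R.
Proof. by rewrite (@le_lt_trans _ _ 1) // ?invf_le1 // ?ler1n // ltr1n. Qed.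

Lemma itv0y_gt0 n (t : R) : n.+2%:R^-1 <= t -> 0 < t.
Proof. by apply: lt_le_trans; rewrite invr_gt0. Qed.

Lemma measurable_expR_ln (a b : R) :
  measurable_fun setT (fun t : R => expR (a * ln t + b * t)).
Proof.
apply: (measurableT_comp (@measurable_expR R)); apply: measurable_funD.
  by apply: measurable_funM => //; exact: measurable_ln.
by apply: measurable_funM.
Qed.

Lemma intble_gamma (a b : R) : 0 < a -> 0 < b ->
  intble `]0, +oo[ (fun t => expR ((a - 1) * ln t + - b * t)).
Proof.
move=> a0 b0.
pose I (t : R) := (1 + expR (a * ln t))^-1.
pose h (t : R) := expR ((a - 1) * ln t) * (I t * I t).
have I0 t : 0 < I t by rewrite invr_gt0 addr_gt0 // expR_gt0.
have h0 t : 0 <= h t by rewrite mulr_ge0 ?expR_ge0 // mulr_ge0 // ltW.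
(* [I] decreases from 1 to 0 and [- I / a] is an antiderivative of [h]. *)
have dln (t k : R) : 0 < t -> is_derive t (1 : R) (fun x => expR (k * ln x)) (expR (k * ln t) * (k * t^-1)).
  move=> t0; have d1 := is_deriveMf (is_derive_cst k t (1 : R)) (is_derive1_ln t0).
  refine (is_derive_eq (is_derive1_comp (is_derive_expR _) d1) _).
  by rewrite /cst /= mulr0 addr0.
have dI (t : R) : 0 < t -> is_derive t (1 : R) I (- (expR (a * ln t) * (a * t^-1)) * (I t * I t)).
  move=> t0; have d1 := is_deriveDf (is_derive_cst (1 : R) t (1 : R)) (dln t a t0).
  have n0 : 1 + expR (a * ln t) != 0 by rewrite gt_eqF // addr_gt0 // expR_gt0.
  refine (is_derive_eq (@is_deriveVf R (fun t => 1 + expR (a * ln t)) _ _ n0 d1) _).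
  by rewrite add0r /I expr2 invfM.
have dH (t : R) : 0 < t -> cderive (fun x => (- a^-1)%:C * (I x)%:C) t (h t)%:C.
  move=> t0; apply: cderive_eq.
    exact: (cderiveM (cderive_cst _ t) (cderive_real (dI t t0))).
  rewrite mul0r addr0 -rmorphM; congr _%:C; rewrite /h mulrBl mul1r expRB lnK ?posrE //.
  by field; rewrite !gt_eqF.
have dh (t : R) : 0 < t -> exists l, cderive (fun x => (h x)%:C) t l.
  move=> t0; have dII := is_deriveMf (dI t t0) (dI t t0).
  have d1 := is_deriveMf (dln t (a - 1) t0) dII.
  have d2 := cderive_real d1.
  eexists; exact: d2.
have mh : measurable_fun setT h.
  apply: measurable_funM.
    have := measurable_expR_ln (a - 1) 0.
    by under eq_fun do rewrite mul0r addr0.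
  have mI : measurable_fun setT I.
    have m1 : measurable_fun setT (fun t : R => 1 + expR (a * ln t)).
      apply: measurable_funD => //; apply: (measurableT_comp (@measurable_expR R)).
      by apply: measurable_funM => //; exact: measurable_ln.
    have [mI _] := cmeasV (cmeas_real m1); apply: eq_measurable_fun mI => t _.
    by rewrite -fmorphV.
  exact: measurable_funM.
have ih : intble `]0, +oo[ h.
  rewrite itv0y_bigcup; apply: (@ge0_intble_bigcup _ _ _ a^-1).
  - by move=> n; exact: measurable_itv.
  - exact: nondecreasing_itv0y.
  - exact: measurable_funTS.
  - by move=> x _; exact: h0.
  move=> n; have mn : measurable (itv0y n) by exact: measurable_itv.
  rewrite (int_fin mn); last first.
    have [] // := @cintegrable_cont R (fun x => (h x)%:C) n.+2%:R^-1 n.+2%:R.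
    by move=> t /andP[/itv0y_gt0 t0 _]; exact: dh.
  have := cFTC (itv0y_lt n) (fun t tt => dH t (itv0y_gt0 (andP tt).1))
     (fun t tt => dh t (itv0y_gt0 (andP tt).1)).
  move=> /(congr1 (@complex.Re R)); rewrite cReD cReN -!rmorphM /= => e.
  rewrite lee_fin [leLHS]e.
  have I1 t : I t <= 1 by rewrite invf_le1 ?addr_gt0 ?expR_gt0 // lerDl expR_ge0.
  rewrite !mulNr opprK addrC -mulrBr ler_piMr ?invr_ge0 ?(ltW a0) //.
  by rewrite lerBlDr (le_trans (I1 _)) // lerDl ltW.
(* For t > 1 this K gives 2 a ln t <= b t + K, so t^(2 a) e^(- b t) stays bounded and dominates the
   factor (1 + t^a)^2 up to 4; for t <= 1 that factor is itself at most 4. *)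
have [K HK] := expR_dominates_linear (2 * a) b0.
apply: (@le_intble _ _ _ (fun t => (4 * expR `|K|) * h t)) => //.
- exact: (measurable_funTS (measurable_expR_ln _ _)).
- move=> t /=; rewrite in_itv /= andbT => t0; rewrite ger0_norm ?expR_ge0 //.
  rewrite expRD /h mulrCA ler_pM2l ?expR_gt0 //.
  pose X := expR (a * ln t); have X0 : 0 < X by exact: expR_gt0.
  have -> : I t * I t = ((1 + X) * (1 + X))^-1 by rewrite invfM.
  rewrite ler_pdivlMr ?mulr_gt0 ?addr_gt0 //.
  have E1 : expR (- b * t) <= 1 by rewrite expR_le1 mulNr oppr_le0 mulr_ge0 // ltW.
  have E0 := expR_gt0 (- b * t).
  have EK : 1 <= expR `|K| by rewrite -expR0 ler_expR.
  have [l0|l0] := leP (ln t) 0.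
    have X1 : X <= 1 by rewrite expR_le1 pmulr_rle0.
    have : expR (- b * t) * ((1 + X) * (1 + X)) <= 1 * (2 * 2).
      by apply: ler_pM; rewrite ?mulr_ge0 ?addr_ge0 ?(ltW E0) ?(ltW X0) // ler_pM ?addr_ge0 ?(ltW X0) //; lra.
    move=> /le_trans; apply; lra.
  have X1 : 1 <= X by rewrite -expR0 ler_expR mulr_ge0 ?(ltW a0) // ltW.
  have XX : expR (- b * t) * (X * X) <= expR `|K|.
    rewrite -!expRD ler_expR.
    have := HK (ln t); rewrite (min_idPr (ltW l0)) normr0 mulr0 addr0 lnK ?posrE //.
    have := ler_norm K; lra.
  have : expR (- b * t) * ((1 + X) * (1 + X)) <= 4 * (expR (- b * t) * (X * X)).
    rewrite [leRHS]mulrCA ler_pM2l //; nra.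
  move=> /le_trans; apply; lra.
- exact: intbleMl.
Qed.

(** The antiderivative - e^(- a t) / a vanishes at infinity and equals - 1 / a at 0. With a = 1 - V
    this writes the pole factor as an integral of exponentials. *)
Lemma cexp_half_line (a : R[i]) : 0 < Re a ->
  cintegrable `]0, +oo[ (fun t => cexp (- a * t%:C)) /\
  cintegral `]0, +oo[ (fun t => cexp (- a * t%:C)) = a^-1.
Proof.
move=> a0.
have an0 : a != 0 by apply/eqP => e; move: a0; rewrite e ltxx.
have nE t : normc (cexp (- a * t%:C)) = expR (- Re a * t).
  by rewrite normc_cexp cReM cReN /= mulr0 subr0.
have ia : cintegrable `]0, +oo[ (fun t => cexp (- a * t%:C)).
  apply: (@cintegrable_dom _ _ _ (fun t => expR ((1 - 1) * ln t + - Re a * t))) => //.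
  - apply: cmeas_sub => //; apply: cmeas_cexp; apply: cmeasM; first exact: cmeas_cst.
    exact: cmeas_real.
  - by move=> t _; rewrite nE subrr mul0r add0r.
  - exact: intble_gamma.
split => //.
have d t : cderive (fun x : R => - a^-1 * cexp (- a * x%:C)) t (cexp (- a * t%:C)).
  apply: cderive_eq.
    apply: cderiveM (cderive_cst _ t) (cderive_cexp (cderiveM (cderive_cst (- a) t) _)).
    by apply: cderive_real; exact: is_derive_id.
  by rewrite !mul0r !addr0 rmorph1 mulr1 mulrCA mulrNN mulVf // mulr1.
have d2 t : exists l, cderive (fun x : R => cexp (- a * x%:C)) t l.
  eexists; apply: cderive_cexp; apply: (cderiveM (cderive_cst (- a) t)).
  by apply: cderive_real; exact: is_derive_id.
have I n := cFTC (itv0y_lt n) (fun t _ => d t) (fun t _ => d2 t).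
have dcv : n.+2%:R^-1 @[n --> \oo] --> (0 : R).
  have := @cvg_harmonic R; rewrite -(cvg_shiftS (harmonic : nat -> R)); exact.
have [cR cI] := cderive_cont (d 0).
have f0 : - a^-1 * cexp (- a * 0%:C) = - a^-1 by rewrite mulr0 cexp0 mulr1.
have small : normc (- a^-1 * cexp (- a * (n.+2%:R)%:C)) @[n --> \oo] --> (0 : R).
  under eq_fun do rewrite normcM nE.
  rewrite -(mulr0 (normc (- a^-1))); apply: cvgM; first exact: cvg_cst.
  rewrite (_ : (fun n => _) = (fun n => expR (Re a * (-1 - n.+1%:R)))).
    exact: cvg_expRN.
  by apply/funext => n; congr expR; rewrite -[n.+2%:R]natr1; ring.
have fin (k l : R -> R) (v : R) : intble `]0, +oo[ k ->
    (forall n, \int[mu]_(x in itv0y n) k x = l n.+2%:R - l n.+2%:R^-1) ->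
    (forall t, `|l t| <= normc (- a^-1 * cexp (- a * t%:C))) ->
    {for 0, continuous l} -> l 0 = - v -> \int[mu]_(x in `]0, +oo[) k x = v.
  rewrite itv0y_bigcup => ik Ik lK lc lv.
  have H := cvg_Rintegral_bigcup (fun n => measurable_itv _) nondecreasing_itv0y ik.
  have l0 : l n.+2%:R @[n --> \oo] --> (0 : R).
    apply/norm_cvg0P; apply: (@squeeze_cvgr _ _ _ _ (fun=> 0)
        (fun n => normc (- a^-1 * cexp (- a * (n.+2%:R)%:C)))) => //.
    - by apply: nearW => n; rewrite normr_ge0 lK.
    - exact: cvg_cst.
  have H2 : l n.+2%:R - l n.+2%:R^-1 @[n --> \oo] --> v.
    rewrite -[v]opprK -lv -[- l 0]sub0r; apply: cvgB => //.
    exact: (cvg_comp _ _ dcv lc).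
  have H3 : \int[mu]_(x in itv0y n) k x @[n --> \oo] --> v.
    by under eq_fun do rewrite Ik.
  exact: (cvg_unique _ H H3).
have [i1 i2] := ia.
apply: complexP => /=.
  apply: (fin _ (fun t => Re (- a^-1 * cexp (- a * t%:C)))) => //.
  - by move=> n; have /(congr1 (@complex.Re R)) := I n; rewrite cReD cReN.
  - by move=> t; exact: Re_le_normc.
  - by rewrite f0 cReN.
apply: (fin _ (fun t => Im (- a^-1 * cexp (- a * t%:C)))) => //.
- by move=> n; have /(congr1 (@complex.Im R)) := I n; rewrite cImD cImN.
- by move=> t; exact: Im_le_normc.
- by rewrite f0 cImN.
Qed.

End half_line.

Section laplace.
Context {R : realType}.
Variables alpha eta : R.
Hypotheses (alpha01 : 0 < alpha < 1) (eta_gt : pi / 2 < eta) (eta_lt : eta < pi)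
  (alphaeta : alpha * eta < pi / 2).
Implicit Types (z w c : R[i]) (g u x y : R).
Local Notation V := (Vexp eta).
Local Notation Va := (Vaexp alpha eta).
Local Notation F := (fox_kernel alpha eta).
Local Notation F1 := (fox_kernel1 alpha eta).
Local Notation F2 := (fox_kernel2 alpha eta).
Local Notation Fexp := (fox_phase alpha eta).
Local Notation kappa := (kappa eta).
Local Notation pole_inv := (pole_inv eta).
Let eta0 : 0 < eta := eta_gt0 eta_gt.
Let kappa0 : 0 < kappa := kappa_gt0 eta_gt eta_lt.
Let ae0 : 0 < alpha * eta. Proof. by case/andP: alpha01 => a0 _; rewrite mulr_gt0. Qed.

(* By the residue theorem this is 2 i pi / eta; only its being nonzero matters. *)
Definition pole_const : R[i] := loop_integral 1 pole_inv.

Let delta : R := Num.min kappa (1 - expR (- eta)).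
Let delta0 : 0 < delta.
Proof. by rewrite lt_min kappa0 subr_gt0 expR_lt1 oppr_lt0. Qed.
Let delta_k : delta <= kappa. Proof. by rewrite ge_min lexx. Qed.
Let delta_1 : delta <= 1 - expR (- eta). Proof. by rewrite ge_min lexx orbT. Qed.

Let Re_1V z : on_loop 1 z ->
  delta * expR (- eta * Re z) <= Re (1 - V z) /\ delta <= Re (1 - V z).
Proof.
apply: (Re_1V_loop eta_gt eta_lt) => //; first exact: ltW.
by rewrite mulr1.
Qed.

Lemma pole_inv_le z : on_loop 1 z -> normc (pole_inv z) <= delta^-1 * expR (eta * Re z).
Proof.
move=> /Re_1V[h _].
have -> : delta^-1 * expR (eta * Re z) = (delta * expR (- eta * Re z))^-1.
  by rewrite invfM -expRN mulNr opprK.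
have d0 : 0 < delta * expR (- eta * Re z) by rewrite mulr_gt0 // expR_gt0.
have h' : delta * expR (- eta * Re z) <= normc (1 - V z).
  by apply: (le_trans h); apply: le_trans (Re_le_normc _); exact: ler_norm.
rewrite /pole_inv Normc.normcV lef_pV2 ?posrE //; exact: lt_le_trans h'.
Qed.

Lemma pole_inv_integrable : loop_integrable 1 pole_inv.
Proof.
apply: (@loop_dom _ 1 _ (fun x => delta^-1 * expR (eta * x)) (cmeas2_pole_inv eta)).
  by move=> z; exact: pole_inv_le.
by apply: intbleMl => //; exact: intble_expNy.
Qed.

Lemma Im_pole_inv z : Im (pole_inv z) = Im (V z) / (Re (1 - V z) ^+ 2 + Im (1 - V z) ^+ 2).
Proof. by rewrite /pole_inv cImV cImD cImN cIm1 add0r opprK. Qed.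

(** The imaginary part is a sum of three nonnegative terms: on each horizontal side Im V has the
    sign that counts positively with the orientation, because sin eta > 0, and on the right side Re
    (1 / (1 - V)) > 0. *)
Lemma pole_const_neq0 : pole_const != 0.
Proof.
suff : 0 < Im pole_const.
  by apply: contraTneq => ->; rewrite ltxx.
have [[i1 i1'] [i2 i2'] [i3 i3']] := pole_inv_integrable.
have s0 := sin_eta_gt0 eta_gt eta_lt.
have -> : Im pole_const = \int[mu]_(x in `]-oo, 1]) Im (pole_inv (x +i* -1)) +
    \int[mu]_(y in `[-1, 1]) Re (pole_inv (1 +i* y)) -
    \int[mu]_(x in `]-oo, 1]) Im (pole_inv (x +i* 1)).
  by rewrite /pole_const /loop_integral !cImD cImN (cImM (0 +i* 1)) mul0r mul1r add0r.
have pos x y : 0 <= (Re (1 - V (x +i* y)) ^+ 2 + Im (1 - V (x +i* y)) ^+ 2)^-1.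
  by rewrite invr_ge0 addr_ge0 ?sqr_ge0.
have h1 : 0 <= \int[mu]_(x in `]-oo, 1]) Im (pole_inv (x +i* -1)).
  apply: Rintegral_ge0 => x _; rewrite Im_pole_inv mulr_ge0 //.
  rewrite Im_V -mulrN mulr_ge0 ?expR_ge0 //.
  by rewrite (_ : Im (x +i* -1) = -1) // mulrN1 sinN opprK ltW.
have h3 : 0 <= - \int[mu]_(x in `]-oo, 1]) Im (pole_inv (x +i* 1)).
  rewrite -intN //; apply: Rintegral_ge0 => x _; rewrite Im_pole_inv -mulNr mulr_ge0 //.
  rewrite Im_V opprK mulr_ge0 ?expR_ge0 //.
  by rewrite (_ : Im (x +i* 1) = 1) // mulr1 ltW.
(* On the right side Re (1 - V) >= delta and |1 - V| <= 2, so Re (1 / (1 - V)) >= delta / 4 on a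
   segment of length 2. *)
have h2 : delta / 4 * 2 <= \int[mu]_(y in `[-1, 1]) Re (pole_inv (1 +i* y)).
  have N11 : (-1 : R) < 1 by lra.
  have -> : delta / 4 * 2 = \int[mu]_(y in `[-1, 1]) (fun=> delta / 4) y.
    by rewrite Rintegral_cst //= lebesgue_measure_itv /= lte_fin N11 /=; ring.
  apply: le_int => //; first exact: intble_cst11.
  move=> y yI; have yl : on_loop 1 (1 +i* y) by move: yI => /=; rewrite in_itv /= => /(on_loop_right 1).
  have [_ hd] := Re_1V yl.
  have n0 : 1 - V (1 +i* y) != 0.
    by apply: contraTneq hd => ->; rewrite -ltNge.
  have nV : normc (1 - V (1 +i* y)) <= 2.
    apply: (le_trans (normc_triangle _ _)); rewrite normcN normc1 normc_V.
    have : expR (- eta * Re (1 +i* y)) <= 1.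
      by rewrite expR_le1 mulNr oppr_le0 mulr_ge0 // ltW.
    lra.
  have n2 : Re (1 - V (1 +i* y)) ^+ 2 + Im (1 - V (1 +i* y)) ^+ 2 = normc (1 - V (1 +i* y)) ^+ 2.
    by move: (1 - _) => -[a b] /=; rewrite sqr_sqrtr // addr_ge0 ?sqr_ge0.
  rewrite /pole_inv cReV n2.
  have p0 := normc_gt0 n0.
  apply: ler_pM => //; first exact: ltW.
  rewrite lef_pV2 ?posrE ?exprn_gt0 //.
  by rewrite (_ : 4 = 2 ^+ 2) ?lerXn2r ?nnegrE ?normc_ge0 //; ring.
have d4 : 0 < delta / 4 * 2 by rewrite mulr_gt0 // divr_gt0.
by rewrite (lt_le_trans d4) // (le_trans h2) // -addrA addrC -addrA lerDl addr_ge0.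
Qed.

(** The value of the kernel at the pole is e^(- u); what remains after subtracting it is [pole_rem],
    whose loop integral is 0. *)
Lemma pole_residue u c : 0 <= u -> Re c < eta ->
  loop_integral 1 (fun z => F 0 u c z * pole_inv z) = (expR (- u))%:C * pole_const.
Proof.
move=> u0 ce.
have i1 : loop_integrable 1 (pole_rem alpha eta u c).
  exact: (pole_rem_integrable alpha01 eta_gt eta_lt alphaeta u0 ce (oner_neq0 R)).
have i2 := loop_integrableZ (F 0 u c 0) pole_inv_integrable.
have E : loop_integral 1 (fun z => pole_rem alpha eta u c z + F 0 u c 0 * pole_inv z) =
    (expR (- u))%:C * pole_const.
  rewrite (loopD i1 i2) (loopZ _ pole_inv_integrable).
  by rewrite (pole_rem_loop0 alpha01 eta_gt eta_lt alphaeta u0 ce ltr01) add0r F00.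
rewrite -E; apply: eq_loop => z _.
by rewrite /pole_rem /pole_num mulrBl subrK.
Qed.

Definition fox_loop g u c : R[i] := loop_integral 1 (F g u c).

Lemma normc_F_loop g u c x0 : 0 < g -> 0 <= u ->
  exists K, 0 <= K /\ forall z, on_loop x0 z -> normc (F g u c z) <= K * expR (Re z).
Proof.
move=> g0 u0.
have gk : 0 < g * kappa by rewrite mulr_gt0.
(* The coefficient - Re c - 1, in place of - Re c, leaves a factor e^(Re z), integrable at -oo. *)
have [K [K0 HK]] := double_expR_bound 0 (- Re c - 1) x0 eta0 alpha01 gk.
pose C := expR (g * ((1 + kappa) * expR (- eta * x0))) * expR (normc c).
exists (C * K); split; first by rewrite mulr_ge0 // mulr_ge0 ?expR_ge0.
move=> z zl; have [zx z1 _] := zl.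
apply: (le_trans (normc_F_le alpha01 eta_gt alphaeta g c u0 z1)).
have hV := Re_V_loop eta zl.
have h := HK (Re z) zx.
have E0 := expR_ge0 (Re z).
rewrite [leRHS](_ : _ = expR (g * ((1 + kappa) * expR (- eta * x0))) *
  (expR (normc c) * (K * expR (Re z)))); last by rewrite /C; ring.
apply: (@le_trans _ _ (expR (g * (- kappa * expR (- eta * Re z))) *
    expR (g * ((1 + kappa) * expR (- eta * x0))) * (expR (normc c) * expR (- Re c * Re z)))).
  rewrite ler_wpM2r ?mulr_ge0 ?expR_ge0 // -expRD ler_expR -mulrDr ler_wpM2l //.
  exact: ltW.
rewrite [leLHS](_ : _ = expR (g * ((1 + kappa) * expR (- eta * x0))) * (expR (normc c) *
  (expR (g * (- kappa * expR (- eta * Re z))) * expR (- Re c * Re z)))); last by ring.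
rewrite !ler_wpM2l ?expR_ge0 //.
apply: le_trans (ler_wpM2r E0 h); rewrite -!expRD ler_expR mul0r addr0; lra.
Qed.

Lemma F_loop_integrable g u c x0 : 0 < g -> 0 <= u -> loop_integrable x0 (F g u c).
Proof.
move=> g0 u0; have [K [K0 HK]] := normc_F_loop c x0 g0 u0.
apply: (@loop_dom _ x0 _ (fun x => K * expR x) (cmeas2F alpha eta g u c) HK).
apply: intbleMl => //; have := @intble_expNy R 1 x0 ltr01.
by rewrite (_ : (fun x => expR (1 * x)) = @expR R) //; apply/funext => x; rewrite mul1r.
Qed.

(** The kernel is entire, so the abscissa of the right side is free; a loop moved by a real
    translation can be brought back. *)
Lemma Phi_invariant g u c x0 : 0 < g -> 0 <= u -> loop_integral x0 (F g u c) = fox_loop g u c.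
Proof.
move=> g0 u0.
have inv x1 x2 : x1 < x2 -> loop_integral x2 (F g u c) = loop_integral x1 (F g u c).
  move=> x12; have [M HM] := F1_bounded alpha01 eta_gt g u c x1 x2.
  apply: (@loop_invariant _ x1 x2 M _ (F1 g u c) (F2 g u c) x12 (cmeas2F1 alpha eta g u c)).
    move=> z zx zy; split; [exact: holo_F|exact: holo_F1|].
    by have [] := HM z zx zy.
  exact: F_loop_integrable.
by have [/inv|/inv|->] := ltgtP x0 1.
Qed.

Lemma Phi_scaling u w g : 0 <= u -> 0 < g ->
  fox_loop 1 u (eta%:C * (1 - w)) =
  cexp ((1 - w) * (ln g)%:C) * fox_loop g (u * expR (alpha * ln g)) (eta%:C * (1 - w)).
Proof.
move=> u0 g0; set c := eta%:C * (1 - w); pose s := - (ln g / eta).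
have u0' : 0 <= u * expR (alpha * ln g) by rewrite mulr_ge0 ?expR_ge0.
have es : eta * s = - ln g by rewrite /s; field; rewrite gt_eqF.
rewrite -(@Phi_invariant 1 u c (1 + s)) // -loop_shift; last exact: cmeas2F.
rewrite -loopZ; last exact: F_loop_integrable.
apply: eq_loop => z _; rewrite /F -cexpD; congr cexp.
have eV : V (z + s%:C) = g%:C * V z.
  rewrite /V mulrDr cexpD mulrC; congr (_ * _).
  rewrite (_ : - eta%:C * s%:C = (ln g)%:C); last by rewrite mulNr -rmorphM es rmorphN opprK.
  by rewrite cexp_real lnK ?posrE.
have eVa : Va (z + s%:C) = (expR (alpha * ln g))%:C * Va z.
  rewrite /Va mulrDr cexpD mulrC; congr (_ * _); rewrite -cexp_real; congr cexp.
  by rewrite mulNr -rmorphM -mulrA es mulrN rmorphN opprK.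
have ec : c * s%:C = - ((1 - w) * (ln g)%:C).
  by rewrite /c mulrAC -rmorphM es rmorphN mulNr mulrC.
rewrite /Fexp eV eVa mulrDr ec rmorphM; ring.
Qed.

Lemma laplace_Phi u c : 0 <= u -> Re c < eta ->
  cintegrable `]0, +oo[ (fun g => (expR (- g))%:C * fox_loop g u c) /\
  cintegral `]0, +oo[ (fun g => (expR (- g))%:C * fox_loop g u c) =
    (expR (- u))%:C * pole_const.
Proof.
move=> u0 ce.
(* Half of each lower bound for Re (1 - V) gives the factor e^(- g d2 - q) with q = g d2 |V|.
   Bounding e^(- q) by q^(- th) splits it into a power of g and a power of |V|: th < 1 keeps g^(-
   th) integrable at 0, and th eta > Re c makes the integral in z converge. Hence th is taken midway
   between 1 and max(Re c / eta, 0). *)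
pose rho := Num.max (Re c / eta) 0; pose th := (1 + rho) / 2.
have rho0 : 0 <= rho by rewrite le_max lexx orbT.
have rho1 : rho < 1 by rewrite gt_max ltr01 andbT ltr_pdivrMr // mul1r.
have rhoc : Re c <= eta * rho by rewrite mulrC -ler_pdivrMr // le_max lexx.
have th1 : th < 1 by rewrite /th; lra.
have th0 : 0 <= th by rewrite /th; lra.
have thc : Re c < th * eta.
  apply: (le_lt_trans rhoc); rewrite mulrC ltr_pM2r // /th; lra.
pose d2 := delta / 2.
have d20 : 0 < d2 by rewrite divr_gt0.
pose f z g := (expR (- g))%:C * F g u c z.
pose gz x := expR (normc c - th * ln d2) * expR ((th * eta - Re c) * x).
pose hg (g : R) := expR ((1 - th - 1) * ln g + - d2 * g).
have bnd z g : on_loop 1 z -> `]0, +oo[%classic g -> normc (f z g) <= gz (Re z) * hg g.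
  move=> zl gI; have g0 : 0 < g by move: gI; rewrite /= in_itv /= andbT.
  have [zx z1 _] := zl.
  have [h1 h2] := Re_1V zl.
  rewrite (normcM (expR (- g))%:C (F g u c z)) normc_real ger0_norm ?expR_ge0 //.
  apply: (le_trans (ler_wpM2l (expR_ge0 (- g)) (normc_F_le alpha01 eta_gt alphaeta g c u0 z1))).
  pose q := g * d2 * expR (- eta * Re z).
  have q0 : 0 < q by rewrite !mulr_gt0 // expR_gt0.
  have lq : ln q = ln g + ln d2 - eta * Re z.
    by rewrite /q !lnM ?posrE ?mulr_gt0 ?expR_gt0 // expRK mulNr.
  have tq : th * ln q <= q.
    have [l0|l0] := leP (ln q) 0.
      by rewrite (le_trans _ (ltW q0)) // mulr_ge0_le0.
    apply: (@le_trans _ _ (ln q)); first by rewrite ler_piMl ?ltW.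
    by have := expR_ge1Dx (ln q); rewrite lnK ?posrE //; lra.
  have hq : g * Re (V z) <= g - g * d2 - q.
    have : g * Re (V z) <= g * (1 - d2 - d2 * expR (- eta * Re z)).
      rewrite ler_pM2l //; move: h1 h2; rewrite cReD cReN cRe1 /d2.
      move: (Re (V z)) (expR _) => v e; lra.
    by move=> /le_trans; apply; rewrite /q; lra.
  rewrite /gz /hg -!expRD ler_expR.
  move: hq tq; rewrite lq.
  move: (Re (V z)) (ln g) (ln d2) (Re z) (Re c) (normc c) (q) => v lg ld x rc nc qq; nra.
have mf : cmeas setT (fun p : (R * R) * R => f (p.1.1 +i* p.1.2) p.2).
  have m1 : cmeas setT (fun p : (R * R) * R => p.1.1 +i* p.1.2).
    by split => /=; [exact: (measurableT_comp measurable_fst measurable_fst)|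
      exact: (measurableT_comp measurable_snd measurable_fst)].
  apply: cmeasM.
    apply: cmeas_real; apply: (measurableT_comp (@measurable_expR R)).
    by apply: measurable_funN; exact: measurable_snd.
  exact: (cmeas_F alpha eta m1 (cmeas_cst _ c) measurable_snd (measurable_cst u)).
have igz : intble `]-oo, 1] gz.
  by apply: intbleMl => //; apply: intble_expNy; rewrite subr_gt0.
have ihg : intble `]0, +oo[ hg by apply: intble_gamma => //; rewrite subr_gt0.
have [_ j2 e] := loop_set_Fubini (measurable_itv _) mf bnd
  (fun x _ => mulr_ge0 (expR_ge0 _) (expR_ge0 _)) (fun y _ => expR_ge0 _) igz ihg.
have Ef g : `]0, +oo[%classic g -> loop_integral 1 (f ^~ g) = (expR (- g))%:C * fox_loop g u c.
  move=> gI; have g0 : 0 < g by move: gI; rewrite /= in_itv /= andbT.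
  by rewrite /f loopZ //; exact: F_loop_integrable.
have E2 : cintegral `]0, +oo[ (fun g => loop_integral 1 (f ^~ g)) =
    cintegral `]0, +oo[ (fun g => (expR (- g))%:C * fox_loop g u c) by exact: eq_cintegral.
split.
  case: j2 => j2 j2'; split.
    by apply: eq_intble j2 => // g /Ef ->.
  by apply: eq_intble j2' => // g /Ef ->.
rewrite -E2 -e -(pole_residue u0 ce); apply: eq_loop => z zl.
have [_ h2] := Re_1V zl.
have [i3 e3] := cexp_half_line (lt_le_trans delta0 h2).
rewrite /pole_inv -e3 -cintegralZ //; apply: eq_cintegral => g _.
rewrite /f /F -cexp_real -!cexpD; congr cexp; rewrite /Fexp rmorphN; ring.
Qed.

End laplace.

(** * The reciprocal of the gamma function *)

Section reciprocal_gamma.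
Context {R : realType}.
Variables alpha eta : R.
Hypotheses (alpha01 : 0 < alpha < 1) (eta_gt : pi / 2 < eta) (eta_lt : eta < pi)
  (alphaeta : alpha * eta < pi / 2).
Implicit Types (z w c : R[i]) (g u x y : R).
Local Notation V := (Vexp eta).
Local Notation Va := (Vaexp alpha eta).
Local Notation F := (fox_kernel alpha eta).
Local Notation F1 := (fox_kernel1 alpha eta).
Local Notation F2 := (fox_kernel2 alpha eta).
Local Notation Fexp := (fox_phase alpha eta).
Local Notation fox_loop := (fox_loop alpha eta).
Local Notation N := (pole_const eta).
Let N0 : N != 0 := pole_const_neq0 eta_gt eta_lt.

Lemma cmeas_cpow w : cmeas setT (fun t : R => cpow t w).
Proof.
apply: cmeas_cexp; apply: cmeasM; first exact: cmeas_cst.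
by apply: cmeas_real; exact: measurable_ln.
Qed.

Lemma normc_cpow t w : normc (cpow t w) = expR (Re w * ln t).
Proof. by rewrite normc_cexp mulrC cReZ mulrC. Qed.

Lemma normc_euler t w :
  normc (cpow t (w - 1) * (expR (- t))%:C) = expR ((Re w - 1) * ln t + - 1 * t).
Proof.
rewrite normcM normc_cpow normc_real ger0_norm ?expR_ge0 // cReD cReN cRe1.
by rewrite -expRD mulN1r.
Qed.

Lemma cmeas_euler w : cmeas setT (fun t : R => cpow t (w - 1) * (expR (- t))%:C).
Proof.
apply: cmeasM; first exact: cmeas_cpow.
by apply: cmeas_real; apply: (measurableT_comp (@measurable_expR R)); exact: measurable_funN.
Qed.

Lemma euler_integrable w : 0 < Re w ->
  cintegrable `]0, +oo[ (fun t => cpow t (w - 1) * (expR (- t))%:C).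
Proof.
move=> w0.
apply: (@cintegrable_dom _ _ _ (fun t => expR ((Re w - 1) * ln t + - 1 * t))).
- exact: measurable_itv.
- by apply: cmeas_sub; [exact: measurable_itv|exact: cmeas_euler].
- by move=> t _; rewrite normc_euler.
- exact: intble_gamma.
Qed.

(* Hankel's representation of 1 / Gamma, up to the factor [pole_const]. *)
Definition recip_gamma w := fox_loop 1 0 (eta%:C * (1 - w)).

(** By scaling, g^(w - 1) Phi(1, 0, c) = Phi(g, 0, c), so the product is the Laplace integral at u =
    0, which is N. As N is nonzero, [recip_gamma] has no zero in the right half-plane. *)
Lemma euler_E w : 0 < Re w -> euler_integral w * recip_gamma w = N.
Proof.
move=> w0; have e0 := eta_gt0 eta_gt.
have ce : Re (eta%:C * (1 - w)) < eta.
  rewrite cReZ cReD cReN cRe1 gtr_pMr //; lra.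
have [_ e] := laplace_Phi alpha01 eta_gt eta_lt alphaeta (lexx 0) ce.
rewrite oppr0 expR0 mul1r in e.
rewrite /euler_integral mulrC -(cintegralZ _ (measurable_itv _) (euler_integrable w0)) -e.
apply: eq_cintegral => g gI; have g0 : 0 < g by move: gI; rewrite /= in_itv /= andbT.
rewrite /recip_gamma (Phi_scaling alpha01 eta_gt eta_lt alphaeta w (lexx 0) g0) mul0r /cpow.
move: (fox_loop _ _ _) (_%:C) => P l.
have -> : cexp ((1 - w) * l) * P * (cexp ((w - 1) * l) * (expR (- g))%:C) =
  cexp ((1 - w) * l) * cexp ((w - 1) * l) * ((expR (- g))%:C * P) by ring.
by rewrite -cexpD -mulrDl subrKA subrr mul0r cexp0 mul1r.
Qed.

(** Integration by parts: the kernel with c1 = - eta w has derivative - eta V F + eta w F, whose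
    loop integral is 0, and multiplication by V turns c1 into c0 = eta (1 - w). *)
Lemma E_rec w : recip_gamma w = w * recip_gamma (w + 1).
Proof.
have e0 := eta_gt0 eta_gt.
pose c1 := eta%:C * (1 - (w + 1)); pose c0 := eta%:C * (1 - w).
have iF c := @F_loop_integrable R alpha eta alpha01 eta_gt eta_lt alphaeta 1 0 c 1 ltr01 (lexx 0).
have eF : F1 1 0 c1 = (fun z => (- eta)%:C * F 1 0 c0 z + (eta%:C * w) * F 1 0 c1 z).
  apply/funext => z; rewrite /fox_kernel1.
  have <- : F 1 0 c1 z * V z = F 1 0 c0 z.
    rewrite /fox_kernel /Vexp -cexpD; congr cexp; rewrite /fox_phase /c1 /c0; ring.
  rewrite /c1 mulr1 mulr0 rmorph0 rmorphN; ring.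
have iF1 : loop_integrable 1 (F1 1 0 c1).
  by rewrite eF; apply: loop_integrableD; exact: loop_integrableZ.
have [K [K0 HK]] := normc_F_loop alpha01 eta_gt eta_lt alphaeta c1 1 ltr01 (lexx 0).
have HK1 z : on_loop 1 z -> normc (F 1 0 c1 z) <= K * expR (1 * Re z).
  by move=> zl; rewrite mul1r HK.
have hF z : Re z <= 1 -> -1 <= Im z <= 1 ->
    holo (F 1 0 c1) (F1 1 0 c1) z /\ holo (F1 1 0 c1) (F2 1 0 c1) z.
  by move=> _ _; split; [exact: holo_F|exact: holo_F1].
have := @loop_derivative0 R 1 K 1 (F 1 0 c1) (F1 1 0 c1) (F2 1 0 c1) ltr01 hF HK1 iF1.
rewrite eF (loopD (loop_integrableZ _ (iF c0)) (loop_integrableZ _ (iF c1))) !loopZ //.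
rewrite -/(fox_loop 1 0 c0) -/(fox_loop 1 0 c1) -/(recip_gamma w) -/(recip_gamma (w + 1)) rmorphN => H.
have en0 : eta%:C != 0 :> R[i].
  by apply/eqP => /(congr1 (@complex.Re R)) /= H0; move: e0; rewrite H0 ltxx.
apply: (mulfI en0); apply/eqP; rewrite -subr_eq0; apply/eqP.
by rewrite -[RHS]oppr0 -H; ring.
Qed.

Lemma E_prod w n : recip_gamma w = (\prod_(k < n) (w + k%:R)) * recip_gamma (w + n%:R).
Proof.
elim: n => [|n IH]; first by rewrite big_ord0 mul1r addr0.
by rewrite big_ord_recr /= IH (E_rec (w + n%:R)) -addrA natr1 mulrA.
Qed.

(** The identity includes the poles: there the product of shifted factors vanishes, hence so does
    [recip_gamma w], and both quotients by 0 are 0. *)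
Lemma Gamma_E w : Gamma w = N / recip_gamma w.
Proof.
rewrite /Gamma; set n := Num.truncn _.
have wn : 0 < Re (w + n%:R).
  rewrite cReD -(rmorph_nat (real_complex R)) /=.
  by have := truncnS_gt (1 - Re w); rewrite -/n -natr1; lra.
have E0 : recip_gamma (w + n%:R) != 0.
  by apply: contraTneq N0 => E0; rewrite -(euler_E wn) E0 mulr0 eqxx.
by rewrite (E_prod w n) -(euler_E wn) invfM mulrACA mulfV // mulr1.
Qed.

Lemma Gamma_rec w : Gamma w = w^-1 * Gamma (w + 1).
Proof. by rewrite !Gamma_E E_rec invfM mulrCA. Qed.

Lemma Gamma_euler w : 0 < Re w -> Gamma w = euler_integral w.
Proof.
move=> w0; rewrite Gamma_E -(euler_E w0) mulfK //.
by apply: contraTneq N0 => E0; rewrite -(euler_E w0) E0 mulr0 eqxx.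
Qed.

Lemma invGamma_E w : (Gamma w)^-1 = recip_gamma w / N.
Proof. by rewrite Gamma_E invf_div. Qed.

Lemma cmeas_loop d (T : measurableType d) x0 (f : T -> R[i] -> R[i]) :
  cmeas setT (fun p : T * (R * R) => f p.1 (p.2.1 +i* p.2.2)) ->
  cmeas setT (fun t => loop_integral x0 (f t)).
Proof.
move=> [f1 f2].
have m3 (a b : R -> R) : measurable_fun setT a -> measurable_fun setT b ->
    cmeas setT (fun p : T * R => f p.1 (a p.2 +i* b p.2)).
  move=> ma mb.
  have mp : measurable_fun setT (fun p : T * R => (p.1, (a p.2, b p.2))).
    apply: measurable_fun_pair; first exact: measurable_fst.
    by apply: measurable_fun_pair; apply: measurableT_comp => //; exact: measurable_snd.
  split; first exact: (measurableT_comp f1 mp).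
  exact: (measurableT_comp f2 mp).
rewrite /loop_integral; apply: cmeasD.
  apply: cmeasD.
    apply: cmeas_cintegral; first exact: measurable_itv.
    by apply: (m3 id (fun=> -1)) => //; exact: measurable_cst.
  apply: cmeasM; first exact: cmeas_cst.
  apply: cmeas_cintegral; first exact: measurable_itv.
  by apply: (m3 (fun=> x0) id) => //; exact: measurable_cst.
apply: cmeasN; apply: cmeas_cintegral; first exact: measurable_itv.
by apply: (m3 id (fun=> 1)) => //; exact: measurable_cst.
Qed.

Lemma cmeas_pair2 d (T : measurableType d) (a b : T -> R) :
  measurable_fun setT a -> measurable_fun setT b -> cmeas setT (fun t => a t +i* b t).
Proof. by []. Qed.

Lemma cmeas_E d (T : measurableType d) (f : T -> R[i]) :
  cmeas setT f -> cmeas setT (fun t => recip_gamma (f t)).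
Proof.
move=> mf; apply: cmeas_loop.
have mf1 : cmeas setT (fun p : T * (R * R) => f p.1).
  case: mf => f1 f2; split; first exact: (measurableT_comp f1 measurable_fst).
  exact: (measurableT_comp f2 measurable_fst).
have m2 : cmeas setT (fun p : T * (R * R) => p.2.1 +i* p.2.2).
  apply: cmeas_pair2.
    exact: (measurableT_comp measurable_fst measurable_snd).
  exact: (measurableT_comp measurable_snd measurable_snd).
have mc : cmeas setT (fun p : T * (R * R) => eta%:C * (1 - f p.1)).
  apply: cmeasM; first exact: cmeas_cst.
  by apply: cmeasD; [exact: cmeas_cst|exact: cmeasN].
exact (cmeas_F alpha eta m2 mc (@measurable_cst _ _ _ _ setT (1 : R))
  (@measurable_cst _ _ _ _ setT (0 : R))).
Qed.

(** Measurability, which Fubini asks for, is inherited from the integrand of the loop formula for 1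
    / Gamma. *)
Lemma cmeas_Gamma d (T : measurableType d) (f : T -> R[i]) :
  cmeas setT f -> cmeas setT (fun t => Gamma (f t)).
Proof.
move=> mf; rewrite (_ : (fun t => Gamma (f t)) = (fun t => N * (recip_gamma (f t))^-1)).
  by apply: cmeasM; [exact: cmeas_cst|apply: cmeasV; exact: cmeas_E].
by apply/funext => t; exact: Gamma_E.
Qed.

End reciprocal_gamma.

(** * Growth of the gamma function on loops *)

Section gamma_growth.
Context {R : realType}.
Variables alpha eta : R.
Hypotheses (alpha01 : 0 < alpha < 1) (eta_gt : pi / 2 < eta) (eta_lt : eta < pi)
  (alphaeta : alpha * eta < pi / 2).
Implicit Types (z w c s : R[i]) (g u x y : R).
Let Grec := Gamma_rec alpha01 eta_gt eta_lt alphaeta.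
Let Geuler := Gamma_euler alpha01 eta_gt eta_lt alphaeta.

(** In Euler's integral |t^(s - 1)| <= 1 + t^(X - 1), uniformly in Im s. *)
Lemma Gamma_bounded_strip (X : R) : 1 <= X ->
  exists M, 0 <= M /\ forall s, 1 <= Re s <= X -> normc (Gamma s) <= M.
Proof.
move=> X1.
pose h (t : R) := expR ((1 - 1) * ln t + - 1 * t) + expR ((X - 1) * ln t + - 1 * t).
have h0 t : 0 <= h t by rewrite addr_ge0 ?expR_ge0.
have ih : intble `]0, +oo[ h.
  apply: intbleD; first exact: measurable_itv.
    by apply: intble_gamma.
  by apply: intble_gamma => //; exact: lt_le_trans X1.
exists (2 * \int[mu]_(t in `]0, +oo[) h t); split.
  by rewrite mulr_ge0 //; exact: Rintegral_ge0.
move=> s /andP[s1 sX]; rewrite Geuler ?(lt_le_trans ltr01) //.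
apply: normc_cintegral_le => //.
- by apply: cmeas_sub; [exact: measurable_itv|exact: cmeas_euler].
move=> t _; rewrite normc_euler /h.
have [l0|l0] := leP 0 (ln t).
  rewrite (@le_trans _ _ (expR ((X - 1) * ln t + - 1 * t))) // ?lerDr ?expR_ge0 //.
  by rewrite ler_expR lerD2r ler_wpM2r // lerB.
rewrite (@le_trans _ _ (expR ((1 - 1) * ln t + - 1 * t))) // ?lerDl ?expR_ge0 //.
by rewrite ler_expR lerD2r ler_wnM2r ?(ltW l0) // lerB.
Qed.

Lemma expr_fact_le_expR (x : R) n : 0 <= x -> x ^+ n / n`!%:R <= expR x.
Proof.
move=> x0; case: n => [|n]; first by rewrite expr0 fact0 divr1 -expR0 ler_expR.
by apply: le_trans (expR_ge1Dxn n x0); rewrite lerDr.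
Qed.

(* On the horizontal sides |s| >= max(1, |Re s|), so that iterating
   Gamma s = Gamma (s + 1) / s produces the factor 1/n! *)
Lemma Gamma_left_bound (X : R) : 1 <= X ->
  exists M, 0 <= M /\ forall n s, `|Im s| = 1 -> 1 - n%:R <= Re s <= X + 1 - n%:R ->
    normc (Gamma s) <= M * ((X + 2) ^+ n / n`!%:R).
Proof.
move=> X1; have X11 : 1 <= X + 1 by lra.
have [M [M0 HM]] := Gamma_bounded_strip X11.
exists M; split => //; elim => [s _|n IH s si /andP[sl su]].
  by rewrite subr0 expr0 fact0 divr1 mulr1 subr0; exact: HM.
have nS : n.+1%:R = n%:R + 1 :> R by rewrite natr1.
have IHs : normc (Gamma (s + 1)) <= M * ((X + 2) ^+ n / n`!%:R).
  apply: IH; first by rewrite cImD cIm1 addr0.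
  by move: sl su; rewrite cReD cRe1 nS; lra.
have s1 : 1 <= normc s by rewrite -si; exact: Im_le_normc.
have sn : n%:R - X <= normc s.
  apply: le_trans (Re_le_normc s); rewrite ler_normr; apply/orP; right.
  by move: su; rewrite nS; lra.
have s0 : 0 < normc s by exact: lt_le_trans s1.
have X20 : 0 < X + 2 by lra.
have n0 : 0 < n.+1%:R :> R by rewrite ltr0n.
have sD : n.+1%:R <= (X + 2) * normc s.
  have [h|h] := leP n.+1%:R (X + 2).
    by apply: (le_trans h); rewrite ler_pMr.
  apply: (@le_trans _ _ ((X + 2) * (n%:R - X))); last by rewrite ler_wpM2l // ltW.
  rewrite nS in h *; nra.
rewrite Grec normcM Normc.normcV factS natrM exprS invfM.
rewrite [leRHS](_ : _ = ((X + 2) / n.+1%:R) * (M * ((X + 2) ^+ n / n`!%:R))); last by ring.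
apply: ler_pM => //; rewrite ?invr_ge0 ?normc_ge0 //.
by rewrite ler_pdivlMr // mulrC ler_pdivrMr.
Qed.

(** The factorial decay is converted into exponentials: with y = (X + 2) e^b, (X + 2)^n / n! = e^(-
    n b) y^n / n! <= e^(- n b) e^y, and - n is Re s up to a bounded error. The parameter b is left
    free so that it can be tuned to beat any factor e^(- c s). *)
Lemma Gamma_loop_bound (x0 : R) : 0 < x0 ->
  exists K C D, [/\ 0 <= K, 0 <= C & forall s b, on_loop x0 s ->
    normc (Gamma s) <= K * expR (C * `|b| + D * expR b + b * Re s)].
Proof.
move=> x00; pose X := x0 + 1.
have X1 : 1 <= X by rewrite /X; lra.
have [M [M0 HM]] := Gamma_left_bound X1.
have [M' [M'0 HM']] := Gamma_bounded_strip X1.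
have E0 (b : R) : 0 <= (X + 2) * expR b by rewrite mulr_ge0 ?expR_ge0 //; lra.
exists (M + M' / x0), (X + 1), (X + 2); split.
- by rewrite addr_ge0 // divr_ge0 // ltW.
- lra.
have V0 : 0 <= M' / x0 by rewrite divr_ge0 // ltW.
move=> s b [sx si [s0|s1]].
  (* On the right side Re s = x0 may be less than 1, so one step of the recursion moves s into the
     strip 1 <= Re s <= X. *)
  have n0 : x0 <= normc s by rewrite -s0; apply: le_trans (Re_le_normc s); exact: ler_norm.
  apply: (@le_trans _ _ (M' / x0 * 1)).
    rewrite Grec normcM Normc.normcV mulr1 mulrC ler_pM ?normc_ge0 ?invr_ge0 ?normc_ge0 //.
      by apply: HM'; rewrite cReD cRe1 s0 /X lexx andbT; lra.
    by rewrite lef_pV2 ?posrE //; exact: lt_le_trans n0.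
  apply: ler_pM => //; first by rewrite lerDr.
  rewrite -[leLHS]expR0 ler_expR s0 /X.
  have bb : 0 <= (b + `|b|) * x0.
    by apply: mulr_ge0; [have := ler_norm (- b); rewrite normrN; lra|exact: ltW].
  have := E0 b; have := normr_ge0 b; rewrite /X; lra.
apply: (@le_trans _ _ (M * expR ((X + 1) * `|b| + (X + 2) * expR b + b * Re s))); last first.
  by rewrite ler_wpM2r ?expR_ge0 // lerDl.
(* n is chosen with Re s + n in [1, X + 1], the range of [Gamma_left_bound]. *)
have [n [nl nu]] : exists n : nat, 1 - n%:R <= Re s /\ Re s <= X + 1 - n%:R.
  have [h|h] := leP 1 (Re s).
    by exists 0%N; rewrite subr0; split => //; rewrite /X; lra.
  exists (Num.truncn (1 - Re s)).+1; split.
    by have := truncnS_gt (1 - Re s); lra.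
  have : (Num.truncn (1 - Re s))%:R <= 1 - Re s by rewrite truncn_le; lra.
  by rewrite -natr1 /X; lra.
apply: (le_trans (HM n s s1 _)); first by rewrite nl nu.
rewrite ler_wpM2l //.
have := expr_fact_le_expR n (E0 b); rewrite exprMn -expRM_natl => h.
rewrite [leLHS](_ : _ = (X + 2) ^+ n * expR (n%:R * b) / n`!%:R * expR (- (n%:R * b))); last first.
  by rewrite expRN; field; rewrite gt_eqF ?expR_gt0 // pnatr_eq0 -lt0n fact_gt0.
apply: (@le_trans _ _ (expR ((X + 2) * expR b) * expR (- (n%:R * b)))).
  by rewrite ler_wpM2r ?expR_ge0.
rewrite -expRD ler_expR.
have : - ((n%:R + Re s) * b) <= (X + 1) * `|b|.
  apply: (le_trans (ler_norm _)); rewrite normrN normrM ler_wpM2r // ger0_norm; lra.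
lra.
Qed.

Lemma cmeas2_Gamma : cmeas2 (@Gamma R).
Proof. exact: (cmeas_Gamma alpha01 eta_gt eta_lt alphaeta cmeas_pair). Qed.

Lemma cmeas2_Gamma_cexp c : cmeas2 (fun s => Gamma s * cexp (- c * s)).
Proof.
apply: cmeasM; first exact: cmeas2_Gamma.
by apply: cmeas_cexp; apply: cmeasM; [exact: cmeas_cst|exact: cmeas_pair].
Qed.

(** With b = Re c + 1 the factor e^(b Re s) cancels that of e^(- c s) and leaves e^(Re s).
    Uniformity over |c| <= B permits differentiation in c under the integral. *)
Lemma Gamma_cexp_bound (x0 B : R) : 0 < x0 -> 0 <= B -> exists K, 0 <= K /\
  forall s c, on_loop x0 s -> normc c <= B -> normc (Gamma s * cexp (- c * s)) <= K * expR (Re s).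
Proof.
move=> x00 B0; have [K [C [D [K0 C0 HK]]]] := Gamma_loop_bound x00.
exists (K * expR (C * (B + 1) + `|D| * expR (B + 1) + B)); split.
  by rewrite mulr_ge0 ?expR_ge0.
move=> s c sl cB; have [_ s1 _] := sl.
have rc : `|Re c| <= B by apply: le_trans cB; exact: Re_le_normc.
have ic : `|Im c| <= B by apply: le_trans cB; exact: Im_le_normc.
rewrite normcM normc_cexp; apply: (le_trans (ler_wpM2r (expR_ge0 _) (HK s (Re c + 1) sl))).
rewrite -!mulrA ler_wpM2l // -!expRD ler_expR (cReM (- c) s) cReN cImN.
have h1 : C * `|Re c + 1| <= C * (B + 1).
  by rewrite ler_wpM2l // (le_trans (ler_normD _ _)) // normr1 lerD2r.
have h2 : D * expR (Re c + 1) <= `|D| * expR (B + 1).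
  apply: (le_trans (ler_wpM2r (expR_ge0 _) (ler_norm D))); apply: ler_wpM2l => //.
  by rewrite ler_expR lerD2r (le_trans (ler_norm _)).
have h3 : Im c * Im s <= B.
  apply: (le_trans (ler_norm _)); rewrite normrM -[leRHS]mulr1; exact: ler_pM.
lra.
Qed.

End gamma_growth.

(** * Loop integrals of the gamma function *)

Section under_integral.
Context {R : realType}.

Lemma is_derive_Rintegral (A : set R) (f f' : R -> R -> R) (a u v : R) (G : R -> R) :
  measurable A -> u < a < v ->
  (forall x, u < x < v -> intble A (f x)) ->
  (forall x y, u < x < v -> A y -> is_derive x (1 : R) (f ^~ y) (f' x y)) ->
  (forall y, 0 <= G y) -> intble A G ->
  (forall x y, u < x < v -> A y -> `|f' x y| <= G y) ->
  is_derive a (1 : R) (fun x => \int[mu]_(y in A) f x y) (\int[mu]_(y in A) f' a y).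
Proof.
move=> mA uav fi df G0 iG fG.
have Ia : `]u, v[%classic a by rewrite /= in_itv.
have Ixy x : `]u, v[%classic x -> u < x < v by rewrite /= in_itv.
have d1 x y : `]u, v[%classic x -> A y -> derivable (f ^~ y) x 1.
  by move=> /Ixy xI Ay; exact: (@ex_derive _ _ _ _ _ _ _ (df x y xI Ay)).
have e1 x y : `]u, v[%classic x -> A y -> partial1of2 f x y = f' x y.
  move=> /Ixy xI Ay; rewrite partial1of2E; exact: (@derive_val _ _ _ _ _ _ _ (df x y xI Ay)).
have fG' x y : `]u, v[%classic x -> A y -> `|partial1of2 f x y| <= G y.
  by move=> xI Ay; rewrite e1 // fG //; exact: Ixy.
have fi' x : `]u, v[%classic x -> intble A (f x) by move=> /Ixy; exact: fi.
have D := @derivable_under_integral R _ (measurableTypeR R) mu f A mA a u v Ia fi' d1 G G0 iG fG'.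
have E := @differentiation_under_integral R _ (measurableTypeR R) mu f A mA a u v Ia fi' d1 G G0 iG fG'.
apply: DeriveDef D _; rewrite -derive1E E; apply: eq_Rintegral => y /set_mem Ay.
exact: e1.
Qed.

Lemma cderive_cintegral (A : set R) (f f' : R -> R -> R[i]) (a u v : R) (G : R -> R) :
  measurable A -> u < a < v ->
  (forall x, u < x < v -> cintegrable A (f x)) ->
  (forall x y, u < x < v -> A y -> cderive (f ^~ y) x (f' x y)) ->
  (forall y, 0 <= G y) -> intble A G ->
  (forall x y, u < x < v -> A y -> normc (f' x y) <= G y) ->
  cderive (fun x => cintegral A (f x)) a (cintegral A (f' a)).
Proof.
move=> mA uav fi df G0 iG fG; split.
  apply: (is_derive_Rintegral (f := fun x y => Re (f x y)) (f' := fun x y => Re (f' x y))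
    mA uav _ _ G0 iG).
  - by move=> x /fi[].
  - by move=> x y xI Ay; have [] := df x y xI Ay.
  - by move=> x y xI Ay; apply: le_trans (Re_le_normc _) (fG _ _ xI Ay).
apply: (is_derive_Rintegral (f := fun x y => Im (f x y)) (f' := fun x y => Im (f' x y))
  mA uav _ _ G0 iG).
- by move=> x /fi[].
- by move=> x y xI Ay; have [] := df x y xI Ay.
- by move=> x y xI Ay; apply: le_trans (Im_le_normc _) (fG _ _ xI Ay).
Qed.

Lemma cderive_loop (x0 : R) (f f' : R -> R[i] -> R[i]) (a u v : R) (g : R -> R) :
  u < a < v ->
  (forall x, u < x < v -> loop_integrable x0 (f x)) ->
  (forall x z, u < x < v -> on_loop x0 z -> cderive (f ^~ z) x (f' x z)) ->
  (forall y, 0 <= g y) -> intble `]-oo, x0] g ->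
  (forall x z, u < x < v -> on_loop x0 z -> normc (f' x z) <= g (Re z)) ->
  cderive (fun x => loop_integral x0 (f x)) a (loop_integral x0 (f' a)).
Proof.
move=> uav fi df g0 ig fg.
have hor b : (forall x, x <= x0 -> on_loop x0 (x +i* b)) ->
    (forall x, u < x < v -> cintegrable `]-oo, x0] (fun y => f x (y +i* b))) ->
    cderive (fun x => cintegral `]-oo, x0] (fun y => f x (y +i* b))) a
      (cintegral `]-oo, x0] (fun y => f' a (y +i* b))).
  move=> bl bi; apply: (cderive_cintegral (f := fun x y => f x (y +i* b))
    (f' := fun x y => f' x (y +i* b)) (measurable_itv _) uav bi _ g0 ig).
    by move=> x y xI; rewrite /= in_itv /= => /bl; exact: df.
  by move=> x y xI; rewrite /= in_itv /= => /bl; exact: fg.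
have ver : cderive (fun x => cintegral `[-1, 1] (fun y => f x (x0 +i* y))) a
      (cintegral `[-1, 1] (fun y => f' a (x0 +i* y))).
  apply: (cderive_cintegral (f := fun x y => f x (x0 +i* y))
    (f' := fun x y => f' x (x0 +i* y)) (measurable_itv _) uav _ _ (fun=> g0 x0) (intble_cst11 _)).
  - by move=> x /fi[].
  - by move=> x y xI; rewrite /= in_itv /= => /(on_loop_right x0); exact: df.
  - by move=> x y xI; rewrite /= in_itv /= => /(on_loop_right x0); exact: fg.
rewrite /loop_integral; apply: cderive_eq.
  apply: (cderiveD (cderiveD (hor (-1) (@on_loop_bot R x0) _)
    (cderiveM (cderive_cst (0 +i* 1) a) ver)) (cderiveN (hor 1 (@on_loop_top R x0) _))).
    by move=> x /fi[].
  by move=> x /fi[].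
by rewrite mul0r addr0.
Qed.

End under_integral.

Section exp_rect.
Context {R : realType}.

Lemma normc_rect_le (x1 x2 : R) z : x1 <= Re z <= x2 -> -1 <= Im z <= 1 ->
  normc z <= `|x1| + `|x2| + 1.
Proof.
move=> /andP[z1 z2] zi; apply: (le_trans (normc_le_ReIm z)); rewrite lerD //.
  rewrite ler_norml; apply/andP; split.
    have := ler_norm (- x1); have := normr_ge0 x2; rewrite normrN; lra.
  by have := ler_norm x2; have := normr_ge0 x1; lra.
by rewrite ler_norml.
Qed.

Lemma cmeas_affine d (T : measurableType d) (l m f : T -> R[i]) : cmeas setT l -> cmeas setT m ->
  cmeas setT f -> cmeas setT (fun t => cexp (l t * f t + m t)).
Proof. by move=> ml mm mf; apply: cmeas_cexp; apply: cmeasD => //; exact: cmeasM. Qed.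

Lemma rect_cexp (x1 x2 : R) (l m : R[i]) : x1 < x2 ->
  rect_integral x1 x2 (fun z => cexp (l * z + m)) = 0.
Proof.
move=> x12; pose Q z := cexp (l * z + m).
pose B := normc l * (`|x1| + `|x2| + 1) + normc m.
have hQ z : holo Q (fun z => Q z * l) z.
  have h := holo_cexp (holoD (holoM (holo_cst l z) (holo_id z)) (holo_cst m z)).
  by apply: eq_holo h; rewrite mulr1 mul0r !addr0.
have mQ : cmeas2 (fun z => Q z * l).
  apply: cmeasM; last exact: cmeas_cst.
  apply: cmeas_affine; [exact: cmeas_cst|exact: cmeas_cst|exact: cmeas_pair].
apply: (@rect_integral0 _ x1 x2 (expR B * normc l) Q _ (fun z => Q z * 0 + Q z * l * l) x12 mQ).
move=> z zr zi; split; [exact: hQ|exact: (holoM (hQ z) (holo_cst l z))|].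
rewrite (normcM (Q z) l) ler_wpM2r ?normc_ge0 // normc_cexp ler_expR.
apply: (le_trans (ler_norm _)); apply: (le_trans (Re_le_normc _)).
apply: (le_trans (normc_triangle _ _)); rewrite normcM lerD2r ler_wpM2l ?normc_ge0 //.
exact: normc_rect_le.
Qed.

End exp_rect.

Section gamma_loop.
Context {R : realType}.
Variables alpha eta : R.
Hypotheses (alpha01 : 0 < alpha < 1) (eta_gt : pi / 2 < eta) (eta_lt : eta < pi)
  (alphaeta : alpha * eta < pi / 2).
Implicit Types (z w c s : R[i]) (g u x y : R).
Let Grec := Gamma_rec alpha01 eta_gt eta_lt alphaeta.
Let Geuler := Gamma_euler alpha01 eta_gt eta_lt alphaeta.

Let q c (g : R) z := cpow g (z - 1) * (expR (- g))%:C * cexp (- c * z).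

Let q_exp c g : q c g = fun z => cexp (((ln g)%:C - c) * z + (- ln g - g)%:C).
Proof.
apply/funext => z; rewrite /q /cpow -cexp_real -!cexpD; congr cexp.
rewrite rmorphB /= !rmorphN; ring.
Qed.

Let cmeas_q c d (T : measurableType d) (a : T -> R) (f : T -> R[i]) :
  measurable_fun setT a -> cmeas setT f -> cmeas setT (fun t => q c (a t) (f t)).
Proof.
move=> ma mf; have ml := measurableT_comp (@measurable_ln R) ma.
rewrite (_ : (fun t => q c (a t) (f t)) =
  fun t => cexp (((ln (a t))%:C - c) * f t + (- ln (a t) - a t)%:C)).
  apply: cmeas_affine => //.
    by apply: cmeasD; [exact: cmeas_real|exact: cmeas_cst].
  by apply: cmeas_real; apply: measurable_funB => //; exact: measurable_funN.
by apply/funext => t; rewrite q_exp.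
Qed.

Let Gamma_mul_euler c z : 0 < Re z ->
  cintegral `]0, +oo[ (fun g => q c g z) = Gamma z * cexp (- c * z).
Proof.
move=> z0; rewrite (Geuler z0).
have e := cintegralZ (cexp (- c * z)) (measurable_itv _) (euler_integrable z0).
rewrite [RHS]mulrC -[RHS]e; apply: eq_cintegral => g _.
by rewrite /q [RHS]mulrC.
Qed.

(** Holomorphy of Gamma itself is avoided: by Euler's integral the integrand is a superposition over
    g > 0 of exponentials of affine functions of z, each with zero integral over the rectangle, and
    Fubini exchanges the order. *)
Lemma rect_Gamma c (x1 x2 : R) : 0 < x1 -> x1 < x2 ->
  rect_integral x1 x2 (fun z => Gamma z * cexp (- c * z)) = 0.
Proof.
move=> x10 x12; have x20 := lt_trans x10 x12.
pose h (t : R) := expR ((x1 - 1) * ln t + - 1 * t) + expR ((x2 - 1) * ln t + - 1 * t).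
pose B := expR (normc c * (`|x1| + `|x2| + 1)).
have h0 t : 0 <= h t by rewrite addr_ge0 ?expR_ge0.
have ih : intble `]0, +oo[ h.
  by apply: intbleD; [exact: measurable_itv|exact: intble_gamma|exact: intble_gamma].
have qb g z : x1 <= Re z <= x2 -> -1 <= Im z <= 1 -> normc (q c g z) <= B * h g.
  move=> zr zi; rewrite /q (normcM _ (cexp (- c * z))) normc_euler mulrC.
  apply: ler_pM; rewrite ?normc_ge0 ?expR_ge0 //.
    rewrite normc_cexp ler_expR (le_trans (ler_norm _)) // (le_trans (Re_le_normc _)) //.
    by rewrite normcM normcN ler_wpM2l ?normc_ge0 // normc_rect_le.
  case/andP: zr => z1 z2; rewrite /h; have [l0|l0] := leP 0 (ln g).
    rewrite (@le_trans _ _ (expR ((x2 - 1) * ln g + - 1 * g))) // ?lerDr ?expR_ge0 //.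
    by rewrite ler_expR lerD2r ler_wpM2r // lerB.
  rewrite (@le_trans _ _ (expR ((x1 - 1) * ln g + - 1 * g))) // ?lerDl ?expR_ge0 //.
  by rewrite ler_expR lerD2r ler_wnM2r ?(ltW l0) // lerB.
have piece (I : set R) (p : R -> R[i]) : measurable I -> (mu I < +oo)%E -> cmeas setT p ->
    (forall t, I t -> x1 <= Re (p t) <= x2 /\ -1 <= Im (p t) <= 1) ->
    cintegrable `]0, +oo[ (fun g => cintegral I (fun t => q c g (p t))) /\
    cintegral I (fun t => Gamma (p t) * cexp (- c * p t)) =
    cintegral `]0, +oo[ (fun g => cintegral I (fun t => q c g (p t))).
  move=> mI Ioo mp pI.
  have iB : intble I (fun=> B) by apply: (@intble_bounded _ _ _ `|B|).
  have mf : cmeas setT (fun t : R * R => q c t.2 (p t.1)).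
    case: mp => mp1 mp2; apply: cmeas_q; first exact: measurable_snd.
    by split; [exact: (measurableT_comp mp1 measurable_fst)|
               exact: (measurableT_comp mp2 measurable_fst)].
  have [_ j e] := cintegral_Fubini (f := fun t g => q c g (p t)) mI (measurable_itv _) mf
    (fun x _ => expR_ge0 _) (fun y _ => h0 y)
    (fun t g It _ => qb g (p t) (pI t It).1 (pI t It).2) iB ih.
  split; first exact: j.
  rewrite -e; apply: eq_cintegral => t It.
  have p0 : 0 < Re (p t) by have [/andP[+ _] _] := pI t It; exact: lt_le_trans.
  exact: (esym (Gamma_mul_euler c p0)).
have N11 : -1 <= 1 :> R by lra.
have itv_fin (a b : R) : (mu `[a, b]%classic < +oo)%E.
  by rewrite lebesgue_measure_itv /=; case: ifP => _; rewrite ltry.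
have hor b : -1 <= b <= 1 -> _ := fun bb => piece `[x1, x2]%classic (fun x => x +i* b) (measurable_itv _)
  (itv_fin x1 x2) (cmeas_pair2 (@measurable_id _ _ _) (measurable_cst b))
  (fun t It => conj It bb).
have ver a : x1 <= a <= x2 -> _ := fun aa => piece `[-1, 1]%classic (fun y => a +i* y) (measurable_itv _)
  (itv_fin (-1) 1) (cmeas_pair2 (measurable_cst a) (@measurable_id _ _ _))
  (fun t It => conj aa It).
have l11 : -1 <= (1 : R) <= 1 by rewrite lexx andbT.
have l12 : -1 <= (-1 : R) <= 1 by rewrite lexx.
have a1 : x1 <= x1 <= x2 by rewrite lexx ltW.
have a2 : x1 <= x2 <= x2 by rewrite lexx ltW.
have [i1 e1] := hor (-1) l12; have [i2 e2] := ver x2 a2.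
have [i3 e3] := hor 1 l11; have [i4 e4] := ver x1 a1.
rewrite /rect_integral e1 e2 e3 e4.
have [i5 <-] := cintegral_comb (0 +i* 1) (measurable_itv _) i1 i2 i3.
have i6 := cintegrableZ (0 +i* 1) (measurable_itv _) i4.
rewrite -(cintegralZ _ (measurable_itv _) i4) -(cintegralB (measurable_itv _) i5 i6).
transitivity (cintegral `]0, +oo[ (fun=> 0 : R[i])); last first.
  by apply: complexP; rewrite /= /Rintegral integral0.
apply: eq_cintegral => g _.
have := rect_cexp ((ln g)%:C - c) (- ln g - g)%:C x12; rewrite -q_exp; exact.
Qed.

Lemma Gamma_cexp_integrable c (x0 : R) : 0 < x0 ->
  loop_integrable x0 (fun s => Gamma s * cexp (- c * s)).
Proof.
move=> x00; have [K [K0 HK]] := Gamma_cexp_bound alpha01 eta_gt eta_lt alphaeta x00 (normc_ge0 c).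
apply: (@loop_dom _ x0 _ (fun x => K * expR (1 * x))).
- exact: (cmeas2_Gamma_cexp alpha01 eta_gt eta_lt alphaeta).
- by move=> z zl; rewrite mul1r; exact: HK.
- by apply: intbleMl => //; exact: intble_expNy.
Qed.

Lemma loop_Gamma_step c (x0 : R) : 0 < x0 ->
  loop_integral (x0 + 1) (fun s => Gamma s * cexp (- c * s)) =
  loop_integral x0 (fun s => Gamma s * cexp (- c * s)).
Proof.
move=> x00; have x01 : x0 < x0 + 1 by rewrite ltrDl.
have i := Gamma_cexp_integrable c (lt_trans x00 x01).
by rewrite (loop_diff (ltW x01) i) rect_Gamma // addr0.
Qed.

(* As a function of [xi], the loop integral satisfies L' = - e^xi L. *)
Lemma loop_Gamma (x0 : R) : 0 < x0 -> exists C : R[i], forall xi,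
  loop_integral x0 (fun s => Gamma s * cexp (- xi * s)) = C * cexp (- cexp xi).
Proof.
move=> x00; pose L c := loop_integral x0 (fun s => Gamma s * cexp (- c * s)).
exists (L 0 * cexp 1) => xi; rewrite -/(L xi).
pose f (t : R) s := Gamma s * cexp (- (t%:C * xi) * s).
pose f' (t : R) s := f t s * (- xi * s).
have x01 : 0 < x0 + 1 by rewrite addr_gt0.
have s_neq0 s : on_loop x0 s -> s != 0.
  move=> [_ _ [e|e]]; apply: contraTneq x00 => s0; first by rewrite -e s0 ltxx.
  by move: e; rewrite s0 normr0 => /eqP; rewrite eq_sym oner_eq0.
(* Differentiation brings down a factor s, and s Gamma(s) = Gamma(s + 1) absorbs it. The loop is
   thereby shifted by 1 to the right, which leaves the integral unchanged, and the shift of the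
   exponential costs a factor e^(t xi). *)
have f'E t s : on_loop x0 s -> f' t s =
    - xi * cexp (t%:C * xi) * (Gamma (s + 1) * cexp (- (t%:C * xi) * (s + 1))).
  move=> /s_neq0 s0; rewrite /f' /f (Grec s) mulrDr cexpD mulr1.
  rewrite (_ : - xi * cexp (t%:C * xi) * _ = (cexp (t%:C * xi) * cexp (- (t%:C * xi))) *
    (- xi * (Gamma (s + 1) * cexp (- (t%:C * xi) * s)))); last by ring.
  rewrite -cexpD subrr cexp0 mul1r.
  rewrite (_ : s^-1 * _ * _ * _ = (s^-1 * s) * (- xi * (Gamma (s + 1) *
    cexp (- (t%:C * xi) * s)))); last by ring.
  by rewrite mulVf // mul1r.
(* On ]-1, 2[, an open neighbourhood of [0, 1], |t xi| <= 2 |xi|: one majorant serves all t. *)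
have B0 : 0 <= 2 * normc xi by rewrite mulr_ge0 ?normc_ge0.
have [K [K0 HK]] := Gamma_cexp_bound alpha01 eta_gt eta_lt alphaeta x01 B0.
have tB (t : R) : -1 < t < 2 -> normc (t%:C * xi) <= 2 * normc xi.
  move=> /andP[t1 t2]; rewrite normcM normc_real ler_wpM2r ?normc_ge0 //.
  by rewrite ler_norml; lra.
have dL (t : R) : -1 < t < 2 ->
    cderive (fun t : R => L (t%:C * xi)) t (- xi * cexp (t%:C * xi) * L (t%:C * xi)).
  move=> tI; apply: cderive_eq.
    apply: (cderive_loop (f := f) (f' := f')
      (g := fun x => normc xi * expR (2 * normc xi) * (K * (expR 1 * expR (1 * x)))) tI).
    - by move=> x _; exact: Gamma_cexp_integrable.
    - move=> x z xI zl; rewrite /f' /f; apply: cderive_eq.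
        apply: (cderiveM (cderive_cst (Gamma z) x) (cderive_cexp
          (cderiveM (cderiveN (cderiveM (cderive_real (is_derive_id x (1 : R))) (cderive_cst xi x)))
          (cderive_cst z x)))).
      rewrite rmorph1; ring.
    - by move=> y; rewrite !mulr_ge0 ?expR_ge0 ?normc_ge0.
    - by apply: intbleMl => //; apply: intbleMl => //; apply: intbleMl => //; exact: intble_expNy.
    - move=> x z xI zl; rewrite f'E // normcM normcM normcN normc_cexp.
      have nR : Re (x%:C * xi) <= 2 * normc xi.
        by apply: (le_trans (ler_norm _)); apply: (le_trans (Re_le_normc _)); exact: tB.
      have zl1 : on_loop (x0 + 1) (z + 1).
        case: zl => z1 z2 z3; rewrite /on_loop cReD cRe1 cImD cIm1 addr0 lerD2r; split => //.
        by case: z3 => [->|->]; [left|right].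
      apply: ler_pM; rewrite ?mulr_ge0 ?normc_ge0 ?expR_ge0 //.
        by rewrite ler_wpM2l ?normc_ge0 // ler_expR.
      apply: (le_trans (HK _ _ zl1 (tB x xI))).
      by rewrite ler_wpM2l // -expRD ler_expR mul1r cReD cRe1 addrC.
  rewrite (eq_loop (f'E t)).
  pose Q s := Gamma s * cexp (- (t%:C * xi) * s).
  have mQ : cmeas2 Q by exact: (cmeas2_Gamma_cexp alpha01 eta_gt eta_lt alphaeta).
  have sh := loop_shift x0 1 mQ.
  have iQ : loop_integrable x0 (fun s => Q (s + 1)).
    apply: (@loop_dom _ x0 _ (fun x => K * (expR 1 * expR (1 * x)))).
    - have mP : measurable_fun setT (fun p : R * R => p.1 + 1).
        by apply: measurable_funD; [exact: measurable_fst|exact: measurable_cst].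
      have mQ1 := cmeas_fst2 mP measurable_snd mQ.
      rewrite /cmeas2 (_ : (fun p : R * R => Q (p.1 +i* p.2 + 1)) =
        (fun p : R * R => Q ((p.1 + 1) +i* p.2))) //.
      by apply/funext => p; congr Q; apply: complexP => /=; rewrite ?addr0.
    - move=> z zl.
      have zl1 : on_loop (x0 + 1) (z + 1).
        case: zl => z1 z2 z3; rewrite /on_loop cReD cRe1 cImD cIm1 addr0 lerD2r; split => //.
        by case: z3 => [->|->]; [left|right].
      apply: (le_trans (HK _ _ zl1 (tB t tI))).
      by rewrite ler_wpM2l // -expRD ler_expR mul1r cReD cRe1 addrC.
    - by apply: intbleMl => //; apply: intbleMl => //; exact: intble_expNy.
  rewrite (loopZ _ iQ) /L -(loop_Gamma_step (t%:C * xi) x00) -sh; congr (_ * _).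
(* The product of L with exp(e^(t xi)) has derivative 0, so its values at t = 1 and t = 0 agree; the
   second is L(0) e. *)
pose H (t : R) := L (t%:C * xi) * cexp (cexp (t%:C * xi)).
have dH (t : R) : 0 <= t <= 1 -> cderive H t 0.
  move=> /andP[t0 t1]; have tI : -1 < t < 2 by lra.
  have dt := cderiveM (cderive_real (is_derive_id t (1 : R))) (cderive_cst xi t).
  apply: cderive_eq; first exact: (cderiveM (dL t tI) (cderive_cexp (cderive_cexp dt))).
  rewrite rmorph1; ring.
have := cFTC ltr01 dH (fun t _ => ex_intro _ 0 (cderive_cst 0 t)).
have -> : cintegral `[0, 1] (fun=> 0 : R[i]) = 0.
  by apply: complexP; rewrite /= /Rintegral integral0.
rewrite /H rmorph1 rmorph0 mul1r mul0r cexp0 => /esym/eqP; rewrite subr_eq0 => /eqP <-.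
by rewrite -mulrA -cexpD subrr cexp0 mulr1.
Qed.

End gamma_loop.

(** * The Fox function as a loop integral of the kernel *)

Section fox.
Context {R : realType}.
Variables alpha eta : R.
Hypotheses (alpha01 : 0 < alpha < 1) (eta_gt : pi / 2 < eta) (eta_lt : eta < pi)
  (alphaeta : alpha * eta < pi / 2).
Implicit Types (z w c s : R[i]) (g u x y : R).
Local Notation V := (Vexp eta).
Local Notation Va := (Vaexp alpha eta).
Local Notation F := (fox_kernel alpha eta).
Local Notation fox_loop := (fox_loop alpha eta).
Local Notation kappa := (kappa eta).
Local Notation N := (pole_const eta).
Let eta0 : 0 < eta := eta_gt0 eta_gt.
Let kappa0 : 0 < kappa := kappa_gt0 eta_gt eta_lt.
Let alpha0 : 0 < alpha. Proof. by case/andP: alpha01. Qed.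
Let ae0 : 0 < alpha * eta. Proof. by rewrite mulr_gt0. Qed.

(** With b = Re xi + 1, the term D e^b of [Gamma_loop_bound] is a multiple of |V|^alpha, and the
    decay e^(- kappa |V|) of the kernel beats it because alpha < 1. The resulting majorant is a
    product, as Fubini for two loops requires. *)
Lemma Gamma_F_bound (x1 : R) c (l : R) : 0 < x1 -> exists K, 0 <= K /\
  forall s z, on_loop x1 s -> on_loop 1 z ->
    normc (F 1 0 c z * (Gamma s * cexp (- (l%:C - (alpha * eta)%:C * z) * s))) <=
    expR (1 * Re s) * (K * expR (1 * Re z)).
Proof.
move=> x10; have [K [C [D [K0 C0 HK]]]] := Gamma_loop_bound alpha01 eta_gt eta_lt alphaeta x10.
have [K' [K'0 HK']] := double_expR_bound (D * expR (1 + l)) (- Re c - C * (alpha * eta) - 1) 1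
  eta0 alpha01 kappa0.
pose A := (1 + kappa) * expR (- eta * 1) + normc c.
pose A' := C * (1 + `|l| + alpha * eta * 2) + alpha * eta.
exists (expR A * (K * expR A') * K'); split; first by rewrite !mulr_ge0 ?expR_ge0.
move=> s z sl zl; have [_ s1 _] := sl; have [zx z1 _] := zl.
set xi := l%:C - (alpha * eta)%:C * z.
have Rxi : Re xi = l - alpha * eta * Re z by rewrite /xi cReD cReN (cReZ (alpha * eta) z).
have Ixi : Im xi = - (alpha * eta * Im z) by rewrite /xi cImD cImN (cImZ (alpha * eta) z) /= add0r.
pose b := Re xi + 1.
have bE : expR b = expR (1 + l) * expR (- (alpha * eta) * Re z).
  by rewrite -expRD /b Rxi; congr expR; ring.
have zn : `|Re z| <= 2 - Re z.
  by rewrite ler_norml; lra.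
have bn : `|b| <= 1 + `|l| + alpha * eta * (2 - Re z).
  rewrite /b Rxi; apply: (le_trans (ler_normD _ _)); rewrite normr1.
  apply: (@le_trans _ _ (`|l| + alpha * eta * `|Re z| + 1)).
    rewrite lerD2r; apply: (le_trans (ler_normB _ _)); rewrite normrM (gtr0_norm ae0).
    exact: lexx.
  have : alpha * eta * `|Re z| <= alpha * eta * (2 - Re z) by rewrite ler_wpM2l // ltW.
  lra.
have Cb : C * `|b| <= C * (1 + `|l| + alpha * eta * (2 - Re z)) by rewrite ler_wpM2l.
have H1 : normc (Gamma s * cexp (- xi * s)) <=
    K * expR A' * expR (D * expR b - C * (alpha * eta) * Re z) * expR (Re s).
  rewrite (normcM (Gamma s)) normc_cexp; apply: (le_trans (ler_wpM2r (expR_ge0 _) (HK s b sl))).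
  rewrite -!mulrA ler_wpM2l // -!expRD ler_expR (cReM (- xi) s) cReN cImN.
  have h3 : Im xi * Im s <= alpha * eta.
    have -> : Im xi * Im s = alpha * eta * (- (Im z * Im s)) by rewrite Ixi; ring.
    rewrite -[leRHS]mulr1 ler_wpM2l ?(ltW ae0) //.
    apply: (le_trans (ler_norm _)); rewrite normrN normrM -[leRHS]mulr1; exact: ler_pM.
  rewrite /A'; have eb : b * Re s = Re xi * Re s + Re s by rewrite /b; ring.
  rewrite eb; move: Cb h3.
  move: (C * `|b|) (expR b) (Re xi) => p1 e2 p2; lra.
have H2 : normc (F 1 0 c z) <= expR A * expR (- kappa * expR (- eta * Re z) - Re c * Re z).
  apply: (le_trans (normc_F_le alpha01 eta_gt alphaeta 1 c (lexx 0) z1)).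
  rewrite -!expRD ler_expR; have := Re_V_loop eta zl; rewrite /A mul1r.
  move: (Re (V z)) (expR _) (expR _) => v e1 e2; lra.
rewrite (normcM (F 1 0 c z)).
apply: (le_trans (ler_pM (normc_ge0 _) (normc_ge0 _) H2 H1)).
rewrite [leLHS](_ : _ = expR (Re s) * (expR A * (K * expR A') *
  (expR (- kappa * expR (- eta * Re z) - Re c * Re z) *
   expR (D * expR b - C * (alpha * eta) * Re z)))); last by ring.
rewrite !mul1r ler_wpM2l ?expR_ge0 // -[leRHS]mulrA ler_wpM2l ?mulr_ge0 ?expR_ge0 //.
have h := HK' (Re z) zx.
apply: le_trans (ler_wpM2r (expR_ge0 (Re z)) h).
rewrite -!expRD ler_expR bE mulrA; lra.
Qed.

Lemma foxH_Phi (r x0 : R) : 1 - r < x0 -> exists C : R[i], forall t, 0 < t ->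
  foxH1011 x0 (r - alpha) alpha (r - 1) 1 t =
  C * ((expR ((r - 1) * ln t))%:C * fox_loop 1 t (eta%:C * (1 - (r * (1 - alpha))%:C))).
Proof.
(* Replacing s by s - (r - 1) puts the poles at 0, -1, -2, ... and turns r - alpha + alpha s into r
   (1 - alpha) + alpha s. *)
move=> x0r; pose x1 := x0 + (r - 1).
have x10 : 0 < x1 by rewrite /x1; lra.
have [C HC] := loop_Gamma alpha01 eta_gt eta_lt alphaeta x10.
exists ((0 +i* (2 * pi))^-1 * (N^-1 * C)) => t t0; rewrite /foxH1011 -mulrA; congr (_ * _).
set c := eta%:C * _.
pose beta : R[i] := (r * (1 - alpha))%:C.
pose l := ln t.
pose k : R[i] := N^-1 * (expR ((r - 1) * l))%:C.
pose G s := Gamma s / Gamma (beta + alpha%:C * s) * cpow t ((r - 1)%:C - s).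
have mG : cmeas2 G.
  have m1 : cmeas setT (fun p : R * R => beta + alpha%:C * (p.1 +i* p.2)).
    by apply: cmeasD; [exact: cmeas_cst|apply: cmeasM; [exact: cmeas_cst|exact: cmeas_pair]].
  apply: cmeasM.
    apply: cmeasM; first exact: (cmeas2_Gamma alpha01 eta_gt eta_lt alphaeta).
    apply: cmeasV; exact: (cmeas_Gamma alpha01 eta_gt eta_lt alphaeta m1).
  apply: cmeas_cexp; apply: cmeasM; last exact: cmeas_cst.
  by apply: cmeasD; [exact: cmeas_cst|apply: cmeasN; exact: cmeas_pair].
transitivity (loop_integral x0 (fun s => G (s + (r - 1)%:C))).
  apply: eq_loop => s _; rewrite /G rmorph1 mul1r [s + _]addrC; congr (_ / Gamma _ * cpow t _).
    rewrite mulrDr addrA -rmorphM -rmorphD; congr (_%:C + _); ring.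
  by rewrite opprD addrA subrr add0r.
rewrite (loop_shift _ _ mG) -/x1.
(* 1 / Gamma(beta + alpha s) becomes Hankel's loop in z, in which s occurs only through e^(alpha eta
   z s). *)
pose f s z := k * (F 1 0 c z * (Gamma s * cexp (- (l%:C - (alpha * eta)%:C * z) * s))).
transitivity (loop_integral x1 (fun s => loop_integral 1 (f s))).
  apply: eq_loop => s _; pose cs := eta%:C * (1 - (beta + alpha%:C * s)).
  have iF := @F_loop_integrable R alpha eta alpha01 eta_gt eta_lt alphaeta 1 0 cs 1 ltr01 (lexx 0).
  transitivity (Gamma s * N^-1 * cpow t ((r - 1)%:C - s) * loop_integral 1 (F 1 0 cs)).
    rewrite /G (invGamma_E alpha01 eta_gt eta_lt alphaeta) /recip_gamma -/cs -/(fox_loop 1 0 cs).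
    move: (fox_loop 1 0 cs) (cpow _ _) (Gamma s) (N^-1) => a1 a2 a3 a4; ring.
  rewrite -(loopZ _ iF); apply: eq_loop => z _.
  have e1 : F 1 0 cs z = F 1 0 c z * cexp ((alpha * eta)%:C * z * s).
    rewrite /fox_kernel -cexpD; congr cexp; rewrite /fox_phase /cs /c rmorphM; ring.
  have e2 : cpow t ((r - 1)%:C - s) = (expR ((r - 1) * l))%:C * cexp (- l%:C * s).
    by rewrite /cpow -cexp_real -cexpD; congr cexp; rewrite rmorphM /= -/l; ring.
  have e3 : cexp (- (l%:C - (alpha * eta)%:C * z) * s) =
      cexp (- l%:C * s) * cexp ((alpha * eta)%:C * z * s).
    by rewrite -cexpD; congr cexp; ring.
  rewrite e1 e2 /f e3 /k.
  move: (F 1 0 c z) (cexp _) (cexp _) (_%:C) (Gamma s) (N^-1) => a1 a2 a3 a4 a5 a6; ring.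
have [K [K0 HK]] := Gamma_F_bound c l x10.
have kn : 0 <= normc k := normc_ge0 k.
rewrite (@loop_loop_Fubini _ x1 1 f (fun x => expR (1 * x))
  (fun x => normc k * (K * expR (1 * x)))); last 6 first.
- have ms : cmeas setT (fun p : (R * R) * (R * R) => p.1.1 +i* p.1.2).
    by apply: cmeas_pair2; [exact: (measurableT_comp measurable_fst measurable_fst)|
      exact: (measurableT_comp measurable_snd measurable_fst)].
  have mz : cmeas setT (fun p : (R * R) * (R * R) => p.2.1 +i* p.2.2).
    by apply: cmeas_pair2; [exact: (measurableT_comp measurable_fst measurable_snd)|
      exact: (measurableT_comp measurable_snd measurable_snd)].
  apply: cmeasM; first exact: cmeas_cst.
  apply: cmeasM.
    exact (cmeas_F alpha eta mz (cmeas_cst _ c) (@measurable_cst _ _ _ _ setT (1 : R))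
      (@measurable_cst _ _ _ _ setT (0 : R))).
  apply: cmeasM; first exact: (cmeas_Gamma alpha01 eta_gt eta_lt alphaeta ms).
  apply: cmeas_cexp; apply: cmeasM ms; apply: cmeasN.
  apply: cmeasD; first exact: cmeas_cst.
  by apply: cmeasN; apply: cmeasM mz; exact: cmeas_cst.
- move=> s z sl zl; rewrite /f (normcM k) [leRHS]mulrCA; apply: ler_wpM2l => //.
  exact: HK.
- by move=> x _; exact: expR_ge0.
- by move=> x _; rewrite !mulr_ge0 ?expR_ge0.
- exact: intble_expNy.
- by apply: intbleMl => //; apply: intbleMl => //; exact: intble_expNy.
have iF := @F_loop_integrable R alpha eta alpha01 eta_gt eta_lt alphaeta 1 t c 1 ltr01 (ltW t0).
transitivity (loop_integral 1 (fun z => k * C * F 1 t c z)); last first.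
  rewrite (loopZ _ iF) -/(fox_loop 1 t c) /k /l.
  move: (fox_loop 1 t c) (expR _)%:C (N^-1) => a1 a2 a3; ring.
apply: eq_loop => z _; rewrite /f.
have iG := Gamma_cexp_integrable alpha01 eta_gt eta_lt alphaeta
  (l%:C - (alpha * eta)%:C * z) x10.
(* For xi = ln t - alpha eta z one has e^xi = t V^alpha: the inner integral supplies the term - u
   V^alpha with u = t. *)
have e4 : F 1 0 c z * cexp (- cexp (l%:C - (alpha * eta)%:C * z)) = F 1 t c z.
  rewrite /fox_kernel -cexpD; congr cexp; rewrite cexpD cexp_real lnK ?posrE // -mulNr /fox_phase /Vaexp.
  rewrite -(mulNr (alpha * eta)%:C z) rmorph0; ring.
rewrite -e4 -(mulrA k C) (mulrCA C) -HC -!(loopZ _ iG) -(loopZ _ (loop_integrableZ _ iG)).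
by apply: eq_loop.
Qed.

End fox.

(** * Laws and densities *)

Section layer_cake.
Context {R : realType}.

Lemma integral_itv0 (k a : R) : 0 <= k -> 0 <= a ->
  (\int[mu]_t (if (0 <= t) && (t < a) then k else 0)%:E = (k * a)%:E)%E.
Proof.
move=> k0 a0; transitivity (\int[mu]_(t in `[0%R, a[) k%:E)%E.
  rewrite [RHS]integral_mkcond; apply: eq_integral => t _; rewrite patchE.
  by rewrite mem_setE in_itv /=; case: ifP.
rewrite integral_cst //= lebesgue_measure_itv /= lte_fin.
have [a1|a1] := ltP 0 a; first by rewrite sube0.
by rewrite (_ : a = 0) ?mulr0 ?mule0 //; apply/le_anti/andP.
Qed.

Lemma measurable_below d (T : measurableType d) (h k : T -> R) :
  measurable_fun setT h -> measurable_fun setT k ->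
  measurable_fun setT (fun p : T * R => (if (0 <= p.2) && (p.2 < h p.1) then k p.1 else 0)%:E).
Proof.
move=> mh mk; apply/measurable_EFinP; apply: measurable_fun_ifT.
- apply: measurable_and; first by apply: measurable_fun_ler; [exact: measurable_cst|exact: measurable_snd].
  apply: measurable_fun_ltr; first exact: measurable_snd.
  exact: (measurableT_comp mh measurable_fst).
- exact: (measurableT_comp mk measurable_fst).
- exact: measurable_cst.
Qed.

Lemma measurable_superlevel d (T : measurableType d) (h : T -> R) (t : R) :
  measurable_fun setT h -> measurable [set w | t < h w].
Proof.
move=> mh; have := mh measurableT _ (measurable_itv `]t, +oo[).
rewrite setTI; congr measurable; apply/seteqP; split => w /=; by rewrite in_itv /= andbT.
Qed.

(** Tonelli for the region 0 <= t < h(w). Densities and equalities in law speak of events; this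
    formula carries them over to expectations. *)
Lemma layer_cake d (T : measurableType d) (P : probability T R) (h : T -> R) :
  measurable_fun setT h -> (forall w, 0 <= h w) ->
  (\int[P]_w (h w)%:E = \int[mu]_(t in `[0%R, +oo[) P [set w | (t < h w)%R])%E.
Proof.
move=> mh h0.
pose G (p : T * R) := (if (0 <= p.2) && (p.2 < h p.1) then 1 else 0 : R)%:E.
have mG : measurable_fun setT G by exact: (measurable_below mh (@measurable_cst _ _ T R setT 1)).
have G0 p : (0 <= G p)%E by rewrite /G lee_fin; case: ifP.
have := @fubini_tonelli _ _ T (measurableTypeR R) R P mu G mG G0.
have -> : (\int[P]_w \int[mu]_t G (w, t) = \int[P]_w (h w)%:E)%E.
  by apply: eq_integral => w _; rewrite /G /= integral_itv0 // mul1r.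
move=> ->; rewrite [RHS]integral_mkcond; apply: eq_integral => t _.
rewrite patchE mem_setE in_itv /= andbT /G /=; case: (leP 0 t) => t0 /=; last first.
  by rewrite integral0_eq.
have mE : measurable [set w | t < h w] by exact: measurable_superlevel.
rewrite -[RHS]mul1e -(setIT [set w | t < h w]) -integral_indic //.
by rewrite mul1e; apply: eq_integral => w _; rewrite indicE; congr (_%:E); case: ifPn => h1;
  [rewrite mem_set|rewrite memNset //; exact/negP].
Qed.

(** Layer cake on the probability space, the density on the superlevel sets of phi, and Tonelli to
    return. *)
Lemma integral_density d (T : measurableType d) (P : probability T R) (X : T -> R)
    (D : set R) (rho phi : R -> R) : measurable D -> measurable_fun setT X ->
  has_density P X D rho -> measurable_fun setT phi -> (forall x, 0 <= phi x) ->
  (\int[P]_w (phi (X w))%:E = \int[mu]_(x in D) (phi x * rho x)%:E)%E.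
Proof.
move=> mD mX [mrho rho0 PX] mphi phi0.
rewrite layer_cake //; last exact: measurableT_comp.
pose r := rho \_ D.
have mr : measurable_fun setT r by apply/(measurable_restrictT _ mD).
have r0 x : 0 <= r x by rewrite /r patchE; case: ifPn => // /set_mem; exact: rho0.
pose G (p : R * R) := (if (0 <= p.2) && (p.2 < phi p.1) then r p.1 else 0 : R)%:E.
have mG : measurable_fun setT G by exact: (measurable_below mphi mr).
have G0 p : (0 <= G p)%E by rewrite /G lee_fin; case: ifP.
transitivity (\int[mu]_t \int[mu]_x G (x, t))%E; last first.
  rewrite -(@fubini_tonelli _ _ (measurableTypeR R) (measurableTypeR R) R mu mu G mG G0).
  rewrite [RHS]integral_mkcond; apply: eq_integral => x _.
  rewrite /G /= integral_itv0 // /r !patchE.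
  by case: ifP => _; rewrite ?mul0r // mulrC.
rewrite [LHS]integral_mkcond; apply: eq_integral => t _.
rewrite patchE mem_setE in_itv /= andbT /G /=; case: (leP 0 t) => t0 /=; last first.
  by rewrite integral0_eq.
have mE : measurable [set x | t < phi x] by exact: measurable_superlevel.
have -> : [set w | t < phi (X w)] = X @^-1` [set x | t < phi x] by [].
rewrite PX // integral_mkcondr [LHS]integral_mkcond; apply: eq_integral => x _.
rewrite /r !patchE; case: ifPn => [/set_mem /= ->|]; first by case: ifP.
by move=> /negP h; case: ifP => // h2; exfalso; apply: h; rewrite inE.
Qed.

End layer_cake.

(** * Uniqueness for the equation Z = Z^alpha Y in law *)

Section perpetuity.
Context {R : realType}.
Variables (alpha : R) (rho : R -> R).
Hypotheses (alpha01 : 0 < alpha < 1) (mrho : measurable_fun setT rho) (rho0 : forall y, 0 <= rho y)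
  (rho1 : (\int[mu]_(y in `]0%R, +oo[) (rho y)%:E = 1)%E).

Definition unit_fun (phi : R -> R) :=
  measurable_fun setT phi /\ forall x, 0 <= phi x <= 1.

Definition log_lipschitz (k : R) (phi : R -> R) :=
  forall x y, 0 < x -> 0 < y -> `|phi x - phi y| <= k * `|ln x - ln y|.

Definition perp (phi : R -> R) (x : R) : R :=
  \int[mu]_(y in `]0, +oo[) (phi (x `^ alpha * y) * rho y).

Lemma intble_rho : intble pos rho.
Proof.
apply/integrableP; split; first by apply/measurable_EFinP; exact: measurable_funTS.
have -> : (\int[mu]_(x in `]0%R, +oo[) `|(EFin \o rho) x| = \int[mu]_(x in `]0%R, +oo[) (rho x)%:E)%E.
  by apply: eq_integral => x _; rewrite /= ger0_norm.
by rewrite rho1 ltry.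
Qed.

Lemma int_rho : \int[mu]_(y in `]0, +oo[) rho y = 1.
Proof. by rewrite /Rintegral rho1. Qed.

Lemma measurable_mul_powR : measurable_fun setT (fun p : R * R => p.1 `^ alpha * p.2).
Proof.
apply: measurable_funM; last exact: measurable_snd.
exact: (measurableT_comp (@measurable_powR R alpha) measurable_fst).
Qed.

Lemma measurable_perp_integrand (phi : R -> R) : measurable_fun setT phi ->
  measurable_fun setT (fun p : R * R => phi (p.1 `^ alpha * p.2) * rho p.2).
Proof.
move=> mphi; apply: measurable_funM; first exact: (measurableT_comp mphi measurable_mul_powR).
exact: (measurableT_comp mrho measurable_snd).
Qed.

Lemma perp_intble phi x : unit_fun phi -> intble pos (fun y => phi (x `^ alpha * y) * rho y).
Proof.
move=> [mphi phi01]; apply: (@le_intble _ _ _ rho) => //.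
- apply: measurable_funTS.
  exact: (measurableT_comp (measurable_perp_integrand mphi)
    (measurable_fun_pair (measurable_cst x) (@measurable_id _ _ setT))).
- move=> y _; have /andP[p0 p1] := phi01 (x `^ alpha * y).
  by rewrite ger0_norm ?mulr_ge0 // ler_piMl.
- exact: intble_rho.
Qed.

Lemma perpE phi x : unit_fun phi ->
  (\int[mu]_(y in `]0%R, +oo[) (phi (x `^ alpha * y) * rho y)%:E = (perp phi x)%:E)%E.
Proof. by move=> u; apply: int_fin => //; exact: perp_intble. Qed.

Lemma perp_unit phi : unit_fun phi -> unit_fun (perp phi).
Proof.
move=> u; have [mphi phi01] := u; split.
  exact: (measurable_Rintegral (measurable_itv _) (measurable_perp_integrand mphi)).
move=> x; apply/andP; split.
  by apply: Rintegral_ge0 => y _; rewrite mulr_ge0 //; case/andP: (phi01 (x `^ alpha * y)).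
rewrite -int_rho; apply: le_int => //; first exact: perp_intble.
  exact: intble_rho.
by move=> y _; rewrite ler_piMl //; case/andP: (phi01 (x `^ alpha * y)).
Qed.

Lemma perp_lipschitz phi k : unit_fun phi -> log_lipschitz k phi ->
  log_lipschitz (k * alpha) (perp phi).
Proof.
move=> u lip x x' x0 x'0; have a0 : 0 < alpha by case/andP: alpha01.
have i1 := perp_intble x u; have i2 := perp_intble x' u.
rewrite /perp -intN // -intD //; last exact: intbleN.
have i3 : intble pos (fun y => phi (x `^ alpha * y) * rho y + - (phi (x' `^ alpha * y) * rho y)).
  by apply: intbleD => //; exact: intbleN.
apply: (le_trans (le_normr_int _ i3)) => //.
rewrite -[leRHS]mulr1 -int_rho -intMl //; last exact: intble_rho.
apply: le_int => //; first exact: intble_norm.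
  by apply: intbleMl => //; exact: intble_rho.
move=> y; rewrite /= in_itv /= andbT => y0.
rewrite -mulNr -mulrDl normrM (ger0_norm (rho0 y)) ler_wpM2r //.
apply: (le_trans (lip _ _ _ _)); rewrite ?mulr_gt0 ?powR_gt0 //.
rewrite !lnM ?posrE ?powR_gt0 // !ln_powR opprD addrACA subrr addr0 -mulrBr normrM.
by rewrite (gtr0_norm a0) mulrA.
Qed.

Lemma iter_perp_unit phi n : unit_fun phi -> unit_fun (iter n perp phi).
Proof. by move=> u; elim: n => //= n; exact: perp_unit. Qed.

Lemma iter_perp_lipschitz phi k n : unit_fun phi -> log_lipschitz k phi ->
  log_lipschitz (k * alpha ^+ n) (iter n perp phi).
Proof.
move=> u lip; elim: n => [|n IH] /=; first by rewrite expr0 mulr1.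
by rewrite exprSr mulrA; apply: perp_lipschitz => //; exact: iter_perp_unit.
Qed.

Section fixed_point.
Context d (T : measurableType d) (P : probability T R) (Z : T -> R).
Hypotheses (mZ : measurable_fun setT Z) (Zpos : {ae P, forall w, 0 < Z w})
  (Zfix : forall phi, unit_fun phi ->
    (\int[P]_w (phi (Z w))%:E = \int[P]_w (perp phi (Z w))%:E)%E).

Lemma unit_integrable phi : unit_fun phi -> P.-integrable setT (EFin \o (phi \o Z)).
Proof.
move=> [mphi phi01]; apply: measurable_bounded_integrable => //.
- by rewrite (le_lt_trans (probability_le1 _ _)) ?ltry.
- exact: measurableT_comp.
- exists 1; split; first exact: num_real.
  move=> M M1 w _ /=; apply: (le_trans _ (ltW M1)).
  by have /andP[p0 p1] := phi01 (Z w); rewrite ger0_norm.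
Qed.

Lemma Zfix_iter phi n : unit_fun phi ->
  (\int[P]_w (phi (Z w))%:E = \int[P]_w (iter n perp phi (Z w))%:E)%E.
Proof.
move=> u; elim: n => //= n ->; apply: Zfix; exact: iter_perp_unit.
Qed.

(** The iterates flatten: the n-th one differs between Z and 1 by at most k alpha^n |ln Z|, which
    tends to 0 almost surely, and bounded convergence applies because all values lie in [0, 1]. The
    sequence on the left does not involve Z, so it determines the expectation. *)
Lemma iter_perp_cvg phi k : unit_fun phi -> log_lipschitz k phi ->
  iter n perp phi 1 @[n --> \oo] --> fine (\int[P]_w (phi (Z w))%:E)%E.
Proof.
move=> u lip; have /andP[a0 a1] := alpha01.
pose c n := iter n perp phi 1.
have c01 n : 0 <= c n <= 1 by have [_] := iter_perp_unit n u; exact.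
pose f n w := (iter n perp phi (Z w) - c n)%:E.
have iu n := unit_integrable (iter_perp_unit n u).
have ic n : P.-integrable setT (EFin \o (fun=> c n)).
  by apply: (unit_integrable (phi := fun=> c n)); split => //; exact: measurable_cst.
have mf n : measurable_fun setT (f n).
  apply/measurable_EFinP; apply: measurable_funB => //.
  by have [m _] := iter_perp_unit n u; exact: measurableT_comp.
have [] := @dominated_convergence _ _ _ P _ measurableT f (fun=> 0%E) (fun=> 1%E) mf.
- exact: measurable_cst.
- apply: filterS Zpos => w Z0 _; apply: cvg_EFin; first exact: nearW.
  apply/norm_cvg0P.
  apply: (@squeeze_cvgr _ _ _ _ (fun=> 0) (geometric (k * `|ln (Z w)|) alpha)) => //.
  + apply: nearW => n; rewrite normr_ge0 /=.
    have := iter_perp_lipschitz n u lip Z0 ltr01.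
    by rewrite ln1 subr0 /geometric /= mulrAC.
  + exact: cvg_cst.
  + by apply: cvg_geometric; rewrite gtr0_norm.
- have ione : P.-integrable setT (EFin \o ((fun=> 1) \o Z)).
    by apply: unit_integrable; split => [|x]; [exact: measurable_cst|rewrite ler01 lexx].
  exact: ione.
- apply: aeW => w n _; rewrite /f /= lee_fin ler_norml.
  have /andP[p0 p1] := c01 n; have [_ /(_ (Z w))/andP[q0 q1]] := iter_perp_unit n u.
  by apply/andP; split; lra.
move=> _ _; rewrite integral0 => H.
have fE n : (\int[P]_w f n w = \int[P]_w (phi (Z w))%:E - (c n)%:E)%E.
  rewrite /f (integralB_EFin measurableT (iu n) (ic n)) (Zfix_iter n u); congr (_ - _)%E.
  by rewrite integral_cst // -[LHS]/((c n)%:E * P setT)%E probability_setT mule1.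
pose e := fine (\int[P]_w (phi (Z w))%:E)%E.
have eE : (\int[P]_w (phi (Z w))%:E = e%:E)%E.
  by rewrite /e fineK //; exact: (integrable_fin_num measurableT (unit_integrable u)).
have H2 : e - c n @[n --> \oo] --> (0 : R).
  have -> : (fun n => e - c n) = (fun n => fine (\int[P]_w f n w)%E).
    by apply/funext => n; rewrite fE eE.
  exact: (fine_cvg H).
have -> : (fun n => iter n perp phi 1) = (fun n => e - (e - c n)).
  by apply/funext => n; rewrite opprB addrC subrK.
have ce : e @[_ --> \oo] --> e by exact: cvg_cst.
have h := cvgB ce H2; rewrite subr0 in h; exact: h.
Qed.

End fixed_point.
End perpetuity.

(** * Equality in law, independence and expectations *)

Section laws.
Context {R : realType}.

Lemma eq_law_rays d d' (T : measurableType d) (T' : measurableType d')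
    (P : probability T R) (P' : probability T' R) (X : {RV P >-> R}) (X' : {RV P' >-> R}) :
  (forall s, P [set w | s <= X w] = P' [set w | s <= X' w]) -> eq_law P P' X X'.
Proof.
move=> H A mA.
have cvE (Q : T -> R) s : Q @^-1` `[s, +oo[%classic = [set w | s <= Q w] :> set T.
  by apply/seteqP; split => w /=; rewrite in_itv /= andbT.
have cvE' (Q : T' -> R) s : Q @^-1` `[s, +oo[%classic = [set w | s <= Q w] :> set T'.
  by apply/seteqP; split => w /=; rewrite in_itv /= andbT.
pose g (k : nat) : set R := `[- k%:R, +oo[%classic.
have U := @measure_unique _ R (R : measurableType _) (@RGenCInfty.G R) g (RGenCInfty.measurableE R).
apply: (U _ _ _ (distribution P X) (distribution P' X')) => //.
- move=> _ _ [x ->] [y ->]; exists (Num.max x y).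
  by apply/seteqP; split => z /=; rewrite !in_itv /= !andbT ge_max => /andP.
- by move=> k; exists (- k%:R).
- rewrite -subTset => x _; exists (Num.truncn (- x)).+1 => //=.
  by rewrite /g /= in_itv /= andbT lerNl ltW // truncnS_gt.
- move=> _ [s ->]; have e := H s.
  by rewrite -(cvE X s) -(cvE' X' s) in e; exact: e.
- by move=> k; rewrite (le_lt_trans (probability_le1 _ _)) ?ltry //; exact: measurable_itv.
Qed.

Lemma eq_law_integral d d' (T : measurableType d) (T' : measurableType d')
    (P : probability T R) (P' : probability T' R) (X : T -> R) (X' : T' -> R) (phi : R -> R) :
  measurable_fun setT X -> measurable_fun setT X' -> measurable_fun setT phi ->
  (forall x, 0 <= phi x) -> eq_law P P' X X' ->
  (\int[P]_w (phi (X w))%:E = \int[P']_w (phi (X' w))%:E)%E.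
Proof.
move=> mX mX' mphi phi0 H.
rewrite !layer_cake //; try exact: measurableT_comp.
apply: eq_integral => t _; exact: (H _ (measurable_superlevel t mphi)).
Qed.

(** The joint law agrees with the product law on rectangles, hence everywhere; Tonelli for the
    product then integrates over X with Y frozen. *)
Lemma independent_integral d (T : measurableType d) (P : probability T R)
    (X Y : {RV P >-> R}) (psi : R * R -> \bar R) : independent_rv P X Y ->
  measurable_fun setT psi -> (forall p, 0 <= psi p)%E ->
  (\int[P]_w psi (X w, Y w) = \int[P]_w \int[P]_v psi (X v, Y w))%E.
Proof.
move=> ind mpsi psi0.
have mXY : measurable_fun setT (fun w => (X w, Y w)) by exact: measurable_fun_pair.
pose XY : {mfun T >-> (R * R)%type} := HB.pack (fun w => (X w, Y w))
  (isMeasurableFun.Build _ _ _ _ _ mXY).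
transitivity (\int[distribution P XY]_p psi p)%E.
  by rewrite ge0_integral_distribution.
have e := @product_measure_unique _ _ R R R (distribution P X) (distribution P Y)
  (distribution P XY) (fun A B mA mB => ind A B mA mB).
transitivity (\int[(distribution P X \x distribution P Y)%E]_p psi p)%E.
  by apply: eq_measure_integral => A mA _; exact: (esym (e A mA)).
rewrite fubini_tonelli2 // /fubini_G.
have mG : measurable_fun setT (fun y => \int[distribution P X]_x psi (x, y))%E.
  exact: measurable_fun_fubini_tonelli_G.
rewrite ge0_integral_distribution //; last by move=> y; exact: integral_ge0.
apply: eq_integral => w _ /=; rewrite ge0_integral_distribution //.
exact: (measurableT_comp mpsi (measurable_fun_pair (@measurable_id _ _ setT) (measurable_cst _))).
Qed.

End laws.

(** * Logarithmic ramps as test functions, and uniqueness of the law *)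

Section uniqueness.
Context {R : realType}.
Variables (alpha : R) (rho : R -> R).
Hypotheses (alpha01 : 0 < alpha < 1) (mrho : measurable_fun setT rho) (rho0 : forall y, 0 <= rho y)
  (rho1 : (\int[mu]_(y in `]0%R, +oo[) (rho y)%:E = 1)%E).
Local Notation perp := (perp alpha rho).

Lemma clip_lipschitz (a b : R) :
  `|Num.max 0 (Num.min 1 a) - Num.max 0 (Num.min 1 b)| <= `|a - b|.
Proof.
have := ler_norm (a - b); have := ler_norm (b - a); rewrite distrC.
move: `|a - b| => n h1 h2; rewrite ler_norml; apply/andP.
by case: (leP 1 a) => a1; case: (leP 1 b) => b1; rewrite ?(max_idPr ler01);
  try case: (leP 0 a) => a0; try case: (leP 0 b) => b0; split; lra.
Qed.

(** For j > 0 this is 1 where ln x >= s, 0 where ln x <= s - 1 / j, and affine in ln x in between: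
    an approximation, Lipschitz in ln x, of the indicator of a ray. *)
Definition ramp (s : R) (j : nat) (x : R) : R :=
  Num.max 0 (Num.min 1 (1 + j%:R * (ln x - s))).

Lemma ramp_unit s j : unit_fun (ramp s j).
Proof.
split; last first.
  by move=> x; rewrite /ramp le_max lexx /= ge_max ler01 ge_min lexx.
apply: measurable_maxr; first exact: measurable_cst.
apply: measurable_minr; first exact: measurable_cst.
apply: measurable_funD; first exact: measurable_cst.
apply: measurable_funM; first exact: measurable_cst.
by apply: measurable_funB; [exact: measurable_ln|exact: measurable_cst].
Qed.

Lemma ramp_lipschitz s j : log_lipschitz j%:R (ramp s j).
Proof.
move=> x y _ _; apply: (le_trans (clip_lipschitz _ _)).
rewrite (_ : 1 + j%:R * (ln x - s) - _ = j%:R * (ln x - ln y)); last by ring.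
by rewrite normrM ger0_norm.
Qed.

Lemma ramp_cvg s x : ramp s j x @[j --> \oo] --> (if s <= ln x then 1 else 0 : R).
Proof.
apply: cvg_near_cst; case: leP => h.
  apply: nearW => j; rewrite /ramp; apply/eqP.
  rewrite (min_idPl _) ?(max_idPr _) //.
  by rewrite lerDl mulr_ge0 // subr_ge0.
exists (Num.truncn (s - ln x)^-1).+1 => // j /= jn; apply/eqP; rewrite /ramp.
have sx : 0 < s - ln x by rewrite subr_gt0.
have : (s - ln x)^-1 <= j%:R.
  by apply: (le_trans (ltW (truncnS_gt _))); rewrite ler_nat.
rewrite -[_^-1]mul1r ler_pdivrMr // => h1.
rewrite (max_idPl _) // ge_min; apply/orP; right; lra.
Qed.

Section expectation_ramp.
Context d (T : measurableType d) (P : probability T R) (Z : T -> R).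
Hypothesis mZ : measurable_fun setT Z.

Lemma measurable_log_ray s : measurable [set w | s <= ln (Z w)].
Proof.
have mlZ : measurable_fun setT (fun w => ln (Z w)) by exact: (measurableT_comp (@measurable_ln R) mZ).
have := mlZ measurableT _ (measurable_itv `[s, +oo[).
by rewrite setTI; congr measurable; apply/seteqP; split => w /=; rewrite in_itv /= andbT.
Qed.

Lemma ramp_expectation s :
  (\int[P]_w (ramp s j (Z w))%:E)%E @[j --> \oo] --> P [set w | s <= ln (Z w)].
Proof.
pose f w := (if s <= ln (Z w) then 1 else 0 : R)%:E.
have fE : (\int[P]_w f w = P [set w | (s <= ln (Z w))%R])%E.
  rewrite -(setIT [set w | s <= ln (Z w)]) -integral_indic //; last exact: measurable_log_ray.
  by apply: eq_integral => w _; rewrite /f indicE; congr (_%:E); case: ifPn => h1;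
    [rewrite mem_set|rewrite memNset //; exact/negP].
rewrite -fE.
have mr j : measurable_fun setT (fun w => (ramp s j (Z w))%:E).
  by apply/measurable_EFinP; have [m _] := ramp_unit s j; exact: measurableT_comp.
have mf : measurable_fun setT f.
  rewrite (_ : f = EFin \o \1_[set w | s <= ln (Z w)]).
    apply/measurable_EFinP; apply: measurable_indic; exact: measurable_log_ray.
  by apply/funext => w; rewrite /f /= indicE; congr (_%:E); case: ifPn => h1;
    [rewrite mem_set|rewrite memNset //; exact/negP].
have [] := @dominated_convergence _ _ _ P _ measurableT _ f (fun=> 1%E) mr mf.
- apply: aeW => w _; apply: cvg_EFin; first exact: nearW.
  exact: ramp_cvg.
- have u1 : unit_fun (fun=> 1 : R) by split => [|x]; [exact: measurable_cst|rewrite ler01 lexx].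
  exact: (unit_integrable P mZ u1).
- apply: aeW => w j _; have [_ /(_ (Z w))/andP[p0 p1]] := ramp_unit s j.
  by rewrite /= ger0_norm.
by [].
Qed.

End expectation_ramp.

(** Both expectations of a ramp are the limit of the same numerical sequence, the iterates at 1.
    Letting the slope grow gives the laws of ln Z and ln Z' on closed rays, which determine them. *)
Lemma perpetuity_unique d d' (T : measurableType d) (T' : measurableType d')
    (P : probability T R) (P' : probability T' R) (Z : {RV P >-> R}) (Z' : {RV P' >-> R}) :
  P [set w | 0 < Z w] = 1%E -> P' [set w | 0 < Z' w] = 1%E ->
  (forall phi, unit_fun phi ->
    (\int[P]_w (phi (Z w))%:E = \int[P]_w (perp phi (Z w))%:E)%E) ->
  (forall phi, unit_fun phi ->
    (\int[P']_w (phi (Z' w))%:E = \int[P']_w (perp phi (Z' w))%:E)%E) ->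
  eq_law P P' Z Z'.
Proof.
move=> Z0 Z'0 fZ fZ'.
have mpos e (U : measurableType e) (Q : probability U R) (X : {RV Q >-> R}) :
    measurable [set w | 0 < X w] by exact: measurable_superlevel.
have ae_pos e (U : measurableType e) (Q : probability U R) (X : {RV Q >-> R}) :
    Q [set w | 0 < X w] = 1%E -> {ae Q, forall w, 0 < X w}.
  move=> h; exists (~` [set w | 0 < X w]); split; last by move=> w /=.
    by apply: measurableC; exact: mpos.
  by rewrite (probability_setC _ (mpos _ _ _ X)) h subee.
have mln e (U : measurableType e) (Q : probability U R) (X : {RV Q >-> R}) :
  measurable_fun setT (fun w => ln (X w)) by exact: measurableT_comp.
pose L : {RV P >-> R} := HB.pack (fun w => ln (Z w)) (isMeasurableFun.Build _ _ _ _ _ (mln _ _ _ Z)).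
pose L' : {RV P' >-> R} := HB.pack (fun w => ln (Z' w)) (isMeasurableFun.Build _ _ _ _ _ (mln _ _ _ Z')).
have LL : eq_law P P' L L'.
  apply: eq_law_rays => s.
  have mZ : measurable_fun setT Z by [].
  have mZ' : measurable_fun setT Z' by [].
  have c1 := @ramp_expectation d T P Z mZ s; have c2 := @ramp_expectation d' T' P' Z' mZ' s.
  have E j : (\int[P]_w (ramp s j (Z w))%:E = \int[P']_w (ramp s j (Z' w))%:E)%E.
    have u := ramp_unit s j; have l := ramp_lipschitz s j.
    have h1 := iter_perp_cvg alpha01 mrho rho0 rho1 mZ (ae_pos _ _ _ _ Z0) fZ u l.
    have h2 := iter_perp_cvg alpha01 mrho rho0 rho1 mZ' (ae_pos _ _ _ _ Z'0) fZ' u l.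
    have h3 : fine (\int[P]_w (ramp s j (Z w))%:E)%E = fine (\int[P']_w (ramp s j (Z' w))%:E)%E.
      exact: (cvg_unique _ h1 h2).
    have f1 := integrable_fin_num measurableT (unit_integrable P mZ u).
    have f2 := integrable_fin_num measurableT (unit_integrable P' mZ' u).
    exact: (etrans (esym (fineK f1)) (etrans (congr1 EFin h3) (fineK f2))).
  have c3 : (\int[P]_w (ramp s j (Z w))%:E)%E @[j --> \oo] --> P' [set w | s <= ln (Z' w)].
    by under eq_fun do rewrite E.
  exact: (cvg_unique _ c1 c3).
move=> A mA.
(* The way back through the exponential: X in A and ln X in the preimage of A agree where X > 0, an
   event of full probability; elsewhere ln X has no meaning. *)
have red e (U : measurableType e) (Q : probability U R) (X : {RV Q >-> R}) :
    Q [set w | 0 < X w] = 1%E ->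
    Q (X @^-1` A) = Q ((fun w => ln (X w)) @^-1` (@expR R @^-1` A)).
  move=> h; have mS := mpos _ _ _ X.
  have mB : measurable (@expR R @^-1` A) by rewrite -[X in measurable X]setTI; exact: measurable_expR.
  have full C : measurable C -> Q C = Q (C `&` [set w | 0 < X w]).
    move=> mC; pose S := [set w | 0 < X w].
    have qS : Q (~` S) = 0%E by rewrite (probability_setC _ mS) h subee.
    have q0 : Q (C `\` S) = 0%E.
      apply: (subset_measure0 _ _ _ qS); [exact: measurableD|exact: measurableC|by move=> w []].
    exact: (etrans (measureDI Q mC mS) (etrans (congr1 (fun x => (x + Q (C `&` S))%E) q0) (add0e _))).
  rewrite (full (X @^-1` A)) ?(full ((fun w => ln (X w)) @^-1` _)).
  - congr (Q _); apply/seteqP; split => w [/= h1 h2]; split => //; by move: h1; rewrite lnK.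
  - by have := mln _ _ _ X measurableT _ mB; rewrite setTI.
  - have mX : measurable_fun setT X by [].
    by have := mX measurableT _ mA; rewrite setTI.
rewrite red // [RHS]red //.
have mB : measurable (@expR R @^-1` A) by rewrite -[X in measurable X]setTI; exact: measurable_expR.
exact: (LL _ mB).
Qed.

End uniqueness.

(** * The gamma law *)

Section transform.
Context {R : realType}.

Lemma ge0_Fubini_set (A B : set R) (F : R * R -> R) : measurable A -> measurable B ->
  measurable_fun setT F -> (forall p, 0 <= F p) ->
  (\int[mu]_(x in A) \int[mu]_(y in B) (F (x, y))%:E =
   \int[mu]_(y in B) \int[mu]_(x in A) (F (x, y))%:E)%E.
Proof.
move=> mA mB mF F0.
pose G (p : R * R) := (F p * (\1_A p.1 * \1_B p.2))%:E.
have mG : measurable_fun setT G.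
  apply/measurable_EFinP; apply: measurable_funM => //; apply: measurable_funM.
    exact: (measurableT_comp (measurable_indic mA) measurable_fst).
  exact: (measurableT_comp (measurable_indic mB) measurable_snd).
have G0 p : (0 <= G p)%E by rewrite lee_fin !mulr_ge0 ?F0 // indicE; case: (_ \in _).
have := @fubini_tonelli _ _ (measurableTypeR R) (measurableTypeR R) R mu mu G mG G0.
have -> : (\int[mu]_x \int[mu]_y G (x, y) = \int[mu]_(x in A) \int[mu]_(y in B) (F (x, y))%:E)%E.
  rewrite [RHS]integral_mkcond; apply: eq_integral => x _; rewrite patchE.
  rewrite /G /= indicE; case: ifPn => xA; last first.
    by rewrite integral0_eq // => y _; rewrite mul0r mulr0.
  rewrite [RHS]integral_mkcond; apply: eq_integral => y _; rewrite patchE indicE mul1r.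
  by case: ifPn => _; rewrite ?mulr1 ?mulr0.
move=> ->; rewrite [RHS]integral_mkcond; apply: eq_integral => y _; rewrite patchE.
rewrite /G /= [\1_B y]indicE; case: ifPn => yB; last first.
  by rewrite integral0_eq // => x _; rewrite !mulr0.
rewrite [RHS]integral_mkcond; apply: eq_integral => x _; rewrite patchE indicE mulr1.
by case: ifPn => _; rewrite ?mulr1 ?mulr0.
Qed.

Variables (alpha : R) (rho gm : R -> R).
Hypotheses (alpha01 : 0 < alpha < 1) (mrho : measurable_fun setT rho) (rho0 : forall y, 0 <= rho y)
  (rho1 : (\int[mu]_(y in `]0%R, +oo[) (rho y)%:E = 1)%E)
  (mgm : measurable_fun setT gm) (gm0 : forall y, 0 <= gm y).
Local Notation perp := (perp alpha rho).

(** This is g^(- alpha), the Jacobian of the substitution y = g^(- alpha) x. *)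
Definition dilation (g : R) := expR (- (alpha * ln g)).

Lemma measurable_dil : measurable_fun setT dilation.
Proof.
apply: (measurableT_comp (@measurable_expR R)); apply: measurable_funN.
by apply: measurable_funM => //; exact: measurable_ln.
Qed.

Lemma perp_dilate phi g : unit_fun phi -> 0 < g ->
  ((perp phi g * gm g)%:E =
   \int[mu]_(x in `]0%R, +oo[) (phi x * (dilation g * rho (dilation g * x) * gm g))%:E)%E.
Proof.
move=> u g0; have [mphi phi01] := u; have s0 : 0 < dilation g by exact: expR_gt0.
have gs y : g `^ alpha * (dilation g * y) = y.
  by rewrite mulrA /powR gt_eqF // -expRD subrr expR0 mul1r.
have phi0 x : 0 <= phi x by case/andP: (phi01 x).
have mpg : measurable_fun setT (fun y => phi (g `^ alpha * y) * rho y).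
  apply: measurable_funM => //; apply: (measurableT_comp mphi).
  by apply: measurable_funM => //; exact: measurable_cst.
rewrite EFinM -(perpE alpha mrho rho0 rho1 g u).
have mpos : measurable (pos : set R) by exact: measurable_itv.
rewrite (@ge0_integral_affine _ (dilation g) 0) //; last 2 first.
- by apply: measurable_funTS; exact/measurable_EFinP.
- by move=> x; rewrite lee_fin mulr_ge0.
have -> : (fun x => dilation g * x + 0) @^-1` pos = pos :> set R.
  by apply/seteqP; split => x /=; rewrite !in_itv /= !andbT addr0 pmulr_rgt0.
rewrite -muleA muleC -muleA -EFinM.
have -> : (\int[mu]_(x in `]0%R, +oo[) (phi (g `^ alpha * (dilation g * x + 0)%R) * rho (dilation g * x + 0)%R)%:E =
   \int[mu]_(x in `]0%R, +oo[) (phi x * rho (dilation g * x)%R)%:E)%E.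
  by apply: eq_integral => x _; rewrite addr0 gs.
rewrite -ge0_integralZr //.
- by apply: eq_integral => x _; rewrite -EFinM; congr (_%:E); ring.
- apply: measurable_funTS; apply/measurable_EFinP; apply: measurable_funM => //.
  by apply: (measurableT_comp mrho); apply: measurable_funM => //; exact: measurable_cst.
- by move=> x _; rewrite lee_fin mulr_ge0.
- by rewrite lee_fin mulr_ge0 // ltW.
Qed.

(** [dilation g * rho (dilation g * x)] is the density of g^alpha Y at x. The hypothesis thus says
    that the multiplicative step maps the density gm to c0 gm, and Tonelli transposes this to test
    functions. *)
Lemma perp_transform phi (c0 : R) : unit_fun phi ->
  (forall x, 0 < x ->
    (\int[mu]_(g in `]0%R, +oo[) (dilation g * rho (dilation g * x) * gm g)%:E = (c0 * gm x)%:E)%E) ->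
  (\int[mu]_(g in `]0%R, +oo[) (perp phi g * gm g)%:E =
   \int[mu]_(x in `]0%R, +oo[) (c0 * (phi x * gm x))%:E)%E.
Proof.
move=> u H; have [mphi phi01] := u.
have phi0 x : 0 <= phi x by case/andP: (phi01 x).
pose K (p : R * R) := dilation p.1 * rho (dilation p.1 * p.2) * gm p.1.
have K0 p : 0 <= K p by rewrite !mulr_ge0 // expR_ge0.
have md1 := measurableT_comp measurable_dil (@measurable_fst _ _ R R).
have mK : measurable_fun setT K.
  apply: measurable_funM; last exact: (measurableT_comp mgm measurable_fst).
  apply: measurable_funM => //; apply: (measurableT_comp mrho).
  by apply: measurable_funM => //; exact: measurable_snd.
transitivity (\int[mu]_(g in `]0%R, +oo[) \int[mu]_(x in `]0%R, +oo[) (phi x * K (g, x))%:E)%E.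
  apply: eq_integral => g /set_mem /=; rewrite in_itv /= andbT => g0.
  exact: perp_dilate.
have mF : measurable_fun setT (fun p : R * R => phi p.2 * K p).
  by apply: measurable_funM => //; exact: (measurableT_comp mphi measurable_snd).
rewrite (ge0_Fubini_set (F := fun p => phi p.2 * K p)) //=; last by move=> p; rewrite mulr_ge0.
apply: eq_integral => x /set_mem /=; rewrite in_itv /= andbT => x0.
have mKx : measurable_fun setT (fun g => K (g, x)).
  exact: (measurableT_comp mK (measurable_fun_pair (@measurable_id _ _ setT) (measurable_cst x))).
transitivity ((phi x)%:E * \int[mu]_(g in `]0%R, +oo[) (K (g, x))%:E)%E.
  rewrite -ge0_integralZl //.
  - by apply: measurable_funTS; exact/measurable_EFinP.
  - by move=> g _; rewrite lee_fin.
  - by rewrite lee_fin.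
have e : (\int[mu]_(g in `]0%R, +oo[) (K (g, x))%:E = (c0 * gm x)%:E)%E by exact: H.
by rewrite e -EFinM; congr (_%:E); ring.
Qed.

End transform.

(** * The gamma density under the Fox kernel *)

Section gamma_kernel.
Context {R : realType}.
Variables (r alpha : R).
Hypotheses (r0 : 0 < r) (alpha01 : 0 < alpha < 1).

(** 1 < 1 + alpha < 2 gives pi / 2 < eta < pi, and 2 alpha < 1 + alpha gives alpha eta < pi / 2.
    Here the aperture of the contour, a parameter so far, is chosen. *)
Lemma aperture_bounds (eta := pi / (1 + alpha) : R) :
  [/\ pi / 2 < eta, eta < pi & alpha * eta < pi / 2].
Proof.
have p0 := pi_gt0 R; have /andP[a0 a1] := alpha01; have a10 : 0 < 1 + alpha by lra.
rewrite /eta; split.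
- by rewrite ltr_pM2l // ltf_pV2 ?posrE //; lra.
- by rewrite ltr_pdivrMr //; nra.
- by rewrite mulrA ltr_pdivrMr // mulrAC ltr_pdivlMr //; nra.
Qed.

Lemma foxH_gamma_kernel (x0 : R) (rho : R -> R) : 1 - r < x0 ->
  (forall t, 0 < t -> (rho t)%:C = foxH1011 x0 (r - alpha) alpha (r - 1) 1 t) ->
  exists c0, forall x, 0 < x ->
    (\int[mu]_(g in `]0%R, +oo[) (dilation alpha g * rho (dilation alpha g * x) * gamma_density r g)%:E =
     (c0 * gamma_density r x)%:E)%E.
Proof.
move=> x0r rhoE; have /andP[a0 a1] := alpha01.
have [eta_gt eta_lt alphaeta] := aperture_bounds; set eta := pi / (1 + alpha) in eta_gt eta_lt alphaeta.
have e0 := eta_gt0 eta_gt.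
have [C HC] := foxH_Phi alpha01 eta_gt eta_lt alphaeta x0r.
pose w : R[i] := (r * (1 - alpha))%:C; pose c := eta%:C * (1 - w).
pose k := (Re (Gamma r%:C))^-1; pose N := pole_const eta.
(* The complex identity has a real left side, so its real part gives the constant. *)
exists (Re (C * N)) => x xp.
pose h g := dilation alpha g * rho (dilation alpha g * x) * gamma_density r g.
have gdE t : 0 < t -> gamma_density r t = k * expR ((r - 1) * ln t) * expR (- t).
  by move=> t0; rewrite /gamma_density /powR gt_eqF.
(* Re c = eta (1 - r (1 - alpha)) and r (1 - alpha) > 0, as the Laplace identity requires. *)
have ce : Re c < eta.
  rewrite /c cReZ cReD cReN cRe1 /= gtr_pMr // ltrBlDr ltrDl mulr_gt0 //; lra.
have [[i1 i2] e1] := laplace_Phi alpha01 eta_gt eta_lt alphaeta (ltW xp) ce.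
pose A : R[i] := C * (k * expR ((r - 1) * ln x))%:C.
have hE g : pos g -> (h g)%:C = A * ((expR (- g))%:C * fox_loop alpha eta g x c).
  rewrite /= in_itv /= andbT => g0.
  have t0 : 0 < dilation alpha g * x by rewrite mulr_gt0 ?expR_gt0.
  have lt : ln (dilation alpha g * x) = ln x - alpha * ln g.
    by rewrite lnM ?posrE ?expR_gt0 // expRK addrC.
  rewrite /h gdE // !rmorphM /= rhoE // HC // -/w -/c.
  rewrite (Phi_scaling alpha01 eta_gt eta_lt alphaeta w (ltW t0) g0).
  have -> : dilation alpha g * x * expR (alpha * ln g) = x.
    by rewrite mulrAC -expRD addrC subrr expR0 mul1r.
  rewrite -/c lt /A /w.
  have -> : (1 - (r * (1 - alpha))%:C) * (ln g)%:C = ((1 - r * (1 - alpha)) * ln g)%:C :> R[i].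
    by rewrite [RHS]rmorphM [X in _ = X * _]rmorphB rmorph1.
  rewrite cexp_real; move: (fox_loop alpha eta g x c) => p.
  rewrite !rmorphM /=.
  (* The powers of g cancel: - alpha - alpha (r - 1) + (1 - r (1 - alpha)) + (r - 1) = 0. Only e^(-
     g) Phi(g, x, c) still depends on g. *)
  have -> : (expR ((r - 1) * ln x))%:C = (dilation alpha g)%:C * (expR ((r - 1) * (ln x - alpha * ln g)))%:C *
      (expR ((1 - r * (1 - alpha)) * ln g))%:C * (expR ((r - 1) * ln g))%:C :> R[i].
    rewrite -!rmorphM /= /dilation -!expRD; congr (expR _)%:C; ring.
  move: (dilation alpha g)%:C (expR _)%:C (expR _)%:C (expR _)%:C (expR _)%:C k%:C => a1' a2 a3 a4 a5 a6.
  ring.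
have mpos : measurable (pos : set R) by exact: measurable_itv.
have ih : cintegrable pos (fun g => (h g)%:C).
  have [j1 j2] := cintegrableZ A mpos (conj i1 i2).
  split; [apply: eq_intble j1 => //|apply: eq_intble j2 => //] => g gp; by rewrite -hE.
have [ih1 _] := ih.
have eh : cintegral pos (fun g => (h g)%:C) = A * ((expR (- x))%:C * N).
  rewrite -[N]/(pole_const eta) -e1 -(cintegralZ A mpos (conj i1 i2)).
  exact: eq_cintegral.
rewrite -/h (int_fin mpos ih1); congr (_%:E).
have := congr1 (@complex.Re R) eh; rewrite [LHS]/= => ->.
have -> : A * ((expR (- x))%:C * N) = (gamma_density r x)%:C * (C * N).
  by rewrite gdE // /A !rmorphM /=; ring.
by rewrite cReZ mulrC.
Qed.

End gamma_kernel.

Theorem proposition3p3 (R : realType) (r alpha : R)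
    (r_gt0 : 0 < r) (alpha_gt0 : 0 < alpha) (alpha_lt1 : alpha < 1)
    (d : measure_display) (T : measurableType d) (P : probability T R)
    (Z Y : {RV P >-> R}) (rhoZ rhoY : R -> R)
    (Z_density : has_density P Z `[0, +oo[ rhoZ)
    (Z_strip : exists2 c : R, 1 < c &
       forall z : R[i], 1 - r < complex.Re z -> complex.Re z < c ->
         cintegrable `[0, +oo[ (fun x => cpow x (z - 1) * (rhoZ x)%:C))
    (Y_pos : {ae P, forall w, 0 < Y w})
    (YZ_indep : independent_rv P Y Z)
    (Y_density : has_density P Y `]0, +oo[ rhoY)
    (x0 : R) (x0_right : 1 - r < x0)
    (rhoY_H : forall t : R, 0 < t ->
       (rhoY t)%:C = foxH1011 x0 (r - alpha) alpha (r - 1) 1 t)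
    (Z_law : eq_law P P Z (fun w => Z w `^ alpha * Y w))
    (d' : measure_display) (T' : measurableType d') (P' : probability T' R)
    (Zr : {RV P' >-> R})
    (Zr_density : has_density P' Zr `]0, +oo[ (gamma_density r)) :
  eq_law P P' Z Zr.
Proof.
have alpha01 : 0 < alpha < 1 by rewrite alpha_gt0.
have mpos : measurable (pos : set R) by exact: measurable_itv.
have mZ : measurable_fun setT Z by [].
have mY : measurable_fun setT Y by [].
have mZr : measurable_fun setT Zr by [].
have [mrhoY rhoY0 YE] := Y_density; have [mgam gam0 ZrE] := Zr_density.
have [mrhoZ rhoZ0 ZE] := Z_density.
(* Both densities are extended by 0 to functions that are measurable and nonnegative on the whole
   line, as Tonelli requires. *)
pose rho := rhoY \_ pos; pose gm := gamma_density r \_ pos.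
have mrho : measurable_fun setT rho by apply/(measurable_restrictT _ mpos).
have mgm : measurable_fun setT gm by apply/(measurable_restrictT _ mpos).
have rho0 y : 0 <= rho y by rewrite /rho patchE; case: ifPn => // /set_mem; exact: rhoY0.
have gm0 y : 0 <= gm y by rewrite /gm patchE; case: ifPn => // /set_mem; exact: gam0.
have rhoE y : 0 < y -> rho y = rhoY y.
  by move=> y0; rewrite /rho patchE mem_set //= /= in_itv /= y0.
have gmE y : 0 < y -> gm y = gamma_density r y.
  by move=> y0; rewrite /gm patchE mem_set //= /= in_itv /= y0.
have posP y : y \in pos -> 0 < y by move=> /set_mem; rewrite /= in_itv /= andbT.
(* The mass of the Fox density is read off from the total probability of Y. *)
have rho1 : (\int[lebesgue_measure]_(y in `]0%R, +oo[) (rho y)%:E = 1)%E.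
  rewrite -(@probability_setT _ _ _ P) -[setT]/(Y @^-1` setT) YE //.
  by rewrite setTI; apply: eq_integral => y /posP y0; rewrite rhoE.
have gm1 : (\int[lebesgue_measure]_(y in `]0%R, +oo[) (gm y)%:E = 1)%E.
  rewrite -(@probability_setT _ _ _ P') -[setT]/(Zr @^-1` setT) ZrE //.
  by rewrite setTI; apply: eq_integral => y /posP y0; rewrite gmE.
have EZr phi : unit_fun phi -> (\int[P']_w (phi (Zr w))%:E =
    \int[lebesgue_measure]_(x in `]0%R, +oo[) (phi x * gm x)%:E)%E.
  move=> [mphi phi01]; rewrite (integral_density mpos mZr Zr_density mphi).
    by apply: eq_integral => y /posP y0; rewrite gmE.
  by move=> x; case/andP: (phi01 x).
have [c0 Hc0] := foxH_gamma_kernel r_gt0 alpha01 x0_right rhoY_H.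
have Hc x : 0 < x -> (\int[lebesgue_measure]_(g in `]0%R, +oo[)
    (dilation alpha g * rho (dilation alpha g * x) * gm g)%:E = (c0 * gm x)%:E)%E.
  move=> xp; rewrite gmE // -Hc0 //; apply: eq_integral => g /posP g0.
  by rewrite gmE // rhoE // mulr_gt0 ?expR_gt0.
have igm := intble_rho mgm gm0 gm1.
have fixc phi : unit_fun phi -> (\int[P']_w (perp alpha rho phi (Zr w))%:E =
    c0%:E * \int[P']_w (phi (Zr w))%:E)%E.
  move=> u; have [mphi phi01] := u.
  rewrite (EZr _ (perp_unit alpha mrho rho0 rho1 u)) (EZr _ u).
  rewrite (perp_transform mrho rho0 rho1 mgm gm0 u Hc).
  have ip : lebesgue_measure.-integrable pos (EFin \o (fun x => phi x * gm x)).
    apply: (@le_intble _ _ _ gm) => //.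
      by apply: measurable_funTS; exact: measurable_funM.
    move=> x _; have /andP[p0 p1] := phi01 x.
    by rewrite ger0_norm ?mulr_ge0 // ler_piMl.
  by rewrite (int_fin mpos ip) (int_fin mpos (intbleMl c0 mpos ip)) intMl.
have u1 : unit_fun (fun=> 1 : R) by split => [|x]; [exact: measurable_cst|rewrite ler01 lexx].
(* Tested on the constant 1, which [perp] fixes, the relation becomes 1 = c0 because the gamma
   density has mass one. *)
have c01 : c0 = 1.
  have := fixc _ u1; rewrite (EZr _ u1) (EZr _ (perp_unit alpha mrho rho0 rho1 u1)).
  have p1 x : perp alpha rho (fun=> 1) x = 1.
    by rewrite /perp -[RHS](int_rho rho1); apply: eq_Rintegral => y _; exact: mul1r.
  under eq_integral do rewrite p1.
  under [in RHS]eq_integral do rewrite mul1r.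
  under [in LHS]eq_integral do rewrite mul1r.
  by rewrite gm1 mule1 => -[].
have fZr phi : unit_fun phi -> (\int[P']_w (phi (Zr w))%:E =
    \int[P']_w (perp alpha rho phi (Zr w))%:E)%E.
  by move=> u; rewrite fixc // c01 mul1e.
have fZ phi : unit_fun phi -> (\int[P]_w (phi (Z w))%:E =
    \int[P]_w (perp alpha rho phi (Z w))%:E)%E.
  move=> u; have [mphi phi01] := u.
  have phi0 x : 0 <= phi x by case/andP: (phi01 x).
  have mW : measurable_fun setT (fun w => Z w `^ alpha * Y w).
    by apply: measurable_funM => //; exact: (measurableT_comp (@measurable_powR R alpha)).
  (* Z is replaced in law by Z^alpha Y; independence then lets Y be integrated against its density
     with Z frozen, which is [perp]. *)
  rewrite (eq_law_integral mZ mW mphi phi0 Z_law).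
  pose psi (p : R * R) := (phi (p.2 `^ alpha * p.1))%:E.
  have mpsi : measurable_fun setT psi.
    apply/measurable_EFinP; apply: (measurableT_comp mphi); apply: measurable_funM.
      exact: (measurableT_comp (@measurable_powR R alpha) measurable_snd).
    exact: measurable_fst.
  have psi0 p : (0 <= psi p)%E by rewrite lee_fin.
  rewrite [LHS](independent_integral YZ_indep mpsi psi0); apply: eq_integral => w _.
  have mphiw : measurable_fun setT (fun y => phi (Z w `^ alpha * y)).
    by apply: (measurableT_comp mphi); apply: measurable_funM => //; exact: measurable_cst.
  rewrite /psi /= (integral_density mpos mY Y_density mphiw) // -(perpE alpha mrho rho0 rho1 _ u).
  by apply: eq_integral => y /posP y0; rewrite rhoE.
have setE e (U : measurableType e) (Q : probability U R) (X : {RV Q >-> R}) :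
    Q (X @^-1` `]-oo, 0]%classic) = 0%E -> Q [set w | 0 < X w] = 1%E.
  move=> h; have mX : measurable_fun setT X by [].
  have mS : measurable (X @^-1` `]-oo, 0]%classic).
    by have := mX measurableT _ (measurable_itv `]-oo, 0]); rewrite setTI.
  have -> : [set w | 0 < X w] = ~` (X @^-1` `]-oo, 0]%classic).
    by apply/seteqP; split => w /=; rewrite in_itv /= ltNge => /negP.
  by rewrite (probability_setC _ mS) h sube0.
apply: (perpetuity_unique alpha01 mrho rho0 rho1 _ _ fZ fZr); apply: setE.
(* The two half-lines meet at 0 only, a null set, so Z > 0 almost surely although its density is
   given on the closed half-line. *)
- rewrite ZE //; have -> : `]-oo, 0]%classic `&` `[0, +oo[%classic = [set 0 : R].
    apply/seteqP; split => x /=; rewrite !in_itv /= ?andbT.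
      by move=> [h1 h2]; apply/le_anti/andP.
    by move=> ->; rewrite lexx.
  by rewrite integral_set1.
- rewrite ZrE //; have -> : `]-oo, 0]%classic `&` `]0, +oo[%classic = set0 :> set R.
    apply/seteqP; split => x //= []; rewrite !in_itv /= andbT => h1 h2.
    by move: (le_lt_trans h1 h2); rewrite ltxx.
  by rewrite integral_set0.
Qed.
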